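(* Let $\nu>-1$, $\kappa\in[0,2(\nu+1))$, and let $\mathcal D,\widetilde{\mathcal I},\widetilde{\mathcal S}$ be the functions defined in the context. For $M\ge1$, positive integers $N_1,\dots,N_M$, $s_1<\dots<s_M<0$ and $\mathbf y^{(m)}_{N_m}=(y^{(m)}_1,\dots,y^{(m)}_{N_m})$ with positive coordinates, let $$\rho^{\mathbf Y}\left(s_1,\{\mathbf y^{(1)}_{N_1}\};\dots;s_M,\{\mathbf y^{(M)}_{N_M}\}\right)=\mathrm{Pf}\Big[\big(\mathcal A^{m,n}(y^{(m)}_i,y^{(n)}_j)\big)_{1\le i\le N_m,1\le j\le N_n,1\le m,n\le M}\Big],\quad \mathcal A^{m,n}(x,y)=\begin{pmatrix}\mathcal D(s_m,x;s_n,y)&\widetilde{\mathcal S}(s_n,y;s_m,x)\\-\widetilde{\mathcal S}(s_m,x;s_n,y)&-\widetilde{\mathcal I}(s_m,x;s_n,y)\end{pmatrix}.$$ Take the limit $s_m\to-\infty$ with all time differences $s_n-s_m$, $1\le m,n\le M$, fixed. In this limit $\mathcal D(s_m,x;s_n,y)\,\widetilde{\mathcal I}(s_m,x;s_n,y)\to0$ for $1\le m,n\le M$, and the correlation functions $\rho^{\mathbf Y}$ converge to those of a temporally homogeneous determinantal system, $$\widetilde\rho^{\,\mathbf Y}\left(s_1,\{\mathbf y^{(1)}_{N_1}\};\dots;s_M,\{\mathbf y^{(M)}_{N_M}\}\right)=\det\Big[\widetilde{\mathbb S}(s_m,y^{(m)}_i;s_n,y^{(n)}_j)\Big]_{1\le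 i\le N_m,1\le j\le N_n,1\le m,n\le M},$$ where $$\widetilde{\mathbb S}(s,x;t,y)=\begin{cases}\displaystyle\int_0^1d\theta\,J_\nu(2\sqrt{\theta x})J_\nu(2\sqrt{\theta y})e^{2(s-t)\theta},&s>t,\\[2mm]\displaystyle\frac{J_\nu(2\sqrt x)\sqrt yJ_\nu'(2\sqrt y)-J_\nu(2\sqrt y)\sqrt xJ'_\nu(2\sqrt x)}{x-y},&s=t,\\[2mm]\displaystyle-\int_1^\infty d\theta\,J_\nu(2\sqrt{\theta x})J_\nu(2\sqrt{\theta y})e^{2(s-t)\theta},&s<t,\end{cases}$$ with $J'_\nu(z)=dJ_\nu(z)/dz$ (the $s=t$ expression being extended by continuity to $x=y$).
   Context: Put $\mathfrak a=\nu-\kappa/2$, $\mathfrak b=\nu-\kappa$; $[c]$ is the largest integer $\le c$, $x_+=\max\{x,0\}$, $\mathbf 1_{(\omega)}$ is the indicator of $\omega$, $J_\nu$ is the Bessel function. $\mathrm{Pf}$ is the Pfaffian of a skew-symmetric matrix. Riemann–Liouville differintegrals: for $c\in\mathbb R$ and $n=[c+1]_+$, $${}_0\mathbf D_x^cf(x)=\frac1{\Gamma(n-c)}\Big(\frac d{dx}\Big)^n\int_0^x(x-y)^{n-c-1}f(y)dy,\qquad {}_x\mathbf D_\infty^cf(x)=\frac1{\Gamma(n-c)}\Big(-\frac d{dx}\Big)^n\int_x^\infty(y-x)^{n-c-1}f(y)dy .$$ Let $$\widetilde J_\nu(\theta,\eta,x,s)=(\theta\eta x)^{\nu/2}J_\nu(2\sqrt{\theta\eta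 x})e^{2s\theta\eta},\qquad \widehat J_\nu(\theta,\eta,x,s)=(\theta\eta x)^{-\nu/2}J_\nu(2\sqrt{\theta\eta x})e^{2s\theta\eta},$$ $$\widetilde J_\nu^{(c)}(\theta,\eta,x,s)={}_0\mathbf D_\eta^c\widetilde J_\nu(\theta,\eta,x,s)\ (\theta,\eta>0,s\in\mathbb R),\qquad \widehat J_\nu^{(c)}(\theta,\eta,x,s)={}_\eta\mathbf D_\infty^c\widehat J_\nu(\theta,\eta,x,s)\ (\theta,\eta>0,s<0).$$ For $s,t<0$: $$\mathcal D(s,x;t,y)=-\frac1{4(xy)^{\kappa/2}}\int_0^1d\theta\,\theta^{1-\kappa}\Big[\widetilde J_\nu^{(-\mathfrak b-1)}(\theta,1,x,-s)\widetilde J_\nu^{(-\mathfrak b)}(\theta,1,y,-t)-\widetilde J_\nu^{(-\mathfrak b)}(\theta,1,x,-s)\widetilde J_\nu^{(-\mathfrak b-1)}(\theta,1,y,-t)\Big],$$ $$\widetilde{\mathcal I}(s,x;t,y)=-(xy)^{\kappa/2}\int_1^\infty d\theta\,\theta^{\kappa-1}\Big[\int_1^\infty d\xi\,\xi^{\mathfrak a}\widehat J_\nu^{(\mathfrak b+1)}(\theta,\xi,x,s)\,\widehat J_\nu^{(\mathfrak b+1)}(\theta,1,y,t)-\widehat J_\nu^{(\mathfrak b+1)}(\theta,1,x,s)\int_1^\infty d\xi\,\xi^{\mathfrak a}\widehat J_\nu^{(\mathfrak b+1)}(\theta,\xi,y,t)\Big],$$ $$\mathcal S(s,x;t,y)=\frac12\Big(\frac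 xy\Big)^{\kappa/2}\int_0^1d\theta\Big[\widehat J_\nu^{(\mathfrak b+1)}(\theta,1,x,s)\widetilde J_\nu^{(-\mathfrak b-1)}(\theta,1,y,-t)-\big\{\mathfrak a\widetilde J_\nu^{(-\mathfrak b-1)}(\theta,1,y,-t)-\widetilde J_\nu^{(-\mathfrak b)}(\theta,1,y,-t)\big\}\int_1^\infty d\xi\,\xi^{\mathfrak a}\widehat J_\nu^{(\mathfrak b+1)}(\theta,\xi,x,s)\Big],$$ $$\widetilde{\mathcal S}(s,x;t,y)=\mathcal S(s,x;t,y)-\mathbf 1_{(s<t)}\Big(\frac yx\Big)^{\mathfrak b/2}\int_0^\infty d\theta\,J_\nu(2\sqrt{\theta x})J_\nu(2\sqrt{\theta y})e^{2(s-t)\theta}.$$ *)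

(* Defs.v *)
From HB Require Import structures.
From mathcomp Require Import all_boot all_order all_algebra.
From mathcomp Require Import all_fingroup.
From mathcomp Require Import all_classical all_reals all_analysis.

Set Implicit Arguments.
Unset Strict Implicit.
Unset Printing Implicit Defensive.

Import Order.TTheory GRing.Theory Num.Theory.
Import numFieldNormedType.Exports.

Local Open Scope classical_set_scope.
Local Open Scope ring_scope.

(* All integrals are Lebesgue integrals; removing the endpoints of the range of
   integration, as done throughout, does not change them. *)

Section SpecialFunctions.
Context {R : realType}.
Local Notation mu := (@lebesgue_measure R).

(* The Euler integral: Gamma c is meaningful for 0 < c only. *)
Definition Gamma (c : R) : R :=
  \int[mu]_(t in `]0, +oo[%classic) (t `^ (c - 1) * expR (- t)).

(* The power series of the Bessel function of the first kind, for -1 < nu and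
   0 < z. *)
Definition besselJ (nu z : R) : R :=
  limn (series (fun k : nat =>
    (-1) ^+ k / (k`!%:R * Gamma (k%:R + nu + 1)) * (z / 2) `^ (k.*2%:R + nu))).

(* n = [c + 1]_+ : truncn is the integer part on nonnegative reals, and 0 on
   negative reals. *)
Definition RLorder (c : R) : nat := Num.truncn (c + 1).

(* {}_0 D_x^c f (x) and, below, {}_x D_oo^c f (x). *)
Definition RLleft (c : R) (f : R -> R) (x : R) : R :=
  let n := RLorder c in
  (Gamma (n%:R - c))^-1 *
  derive1n n (fun z => \int[mu]_(y in `]0, z[%classic)
                         ((z - y) `^ (n%:R - c - 1) * f y)) x.

Definition RLright (c : R) (f : R -> R) (x : R) : R :=
  let n := RLorder c in
  (Gamma (n%:R - c))^-1 * (-1) ^+ n *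
  derive1n n (fun z => \int[mu]_(y in `]z, +oo[%classic)
                         ((y - z) `^ (n%:R - c - 1) * f y)) x.

End SpecialFunctions.

Section Kernels.
Context {R : realType}.
Variables nu kappa : R.
Local Notation mu := (@lebesgue_measure R).
Local Notation J := (besselJ nu).
Local Notation a := (nu - kappa / 2).
Local Notation b := (nu - kappa).

Definition Jtilde (theta eta x s : R) : R :=
  (theta * eta * x) `^ (nu / 2) * J (2 * Num.sqrt (theta * eta * x)) *
  expR (2 * s * theta * eta).

Definition Jhat (theta eta x s : R) : R :=
  (theta * eta * x) `^ (- (nu / 2)) * J (2 * Num.sqrt (theta * eta * x)) *
  expR (2 * s * theta * eta).

Definition JtildeD (c theta eta x s : R) : R :=
  RLleft c (fun e => Jtilde theta e x s) eta.

Definition JhatD (c theta eta x s : R) : R :=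
  RLright c (fun e => Jhat theta e x s) eta.

(* The inner integral over xi of the kernels \widetilde I and S. *)
Definition JhatI (theta x s : R) : R :=
  \int[mu]_(xi in `]1, +oo[%classic) (xi `^ a * JhatD (b + 1) theta xi x s).

(* Dker, Iker, Sker0, Sker and Shom stand for the calligraphic D, \widetilde I,
   S, \widetilde S and the blackboard \widetilde S respectively. *)
Definition Dker (s x t y : R) : R :=
  - (4 * (x * y) `^ (kappa / 2))^-1 *
  \int[mu]_(theta in `]0, 1[%classic)
    (theta `^ (1 - kappa) *
     (JtildeD (- b - 1) theta 1 x (- s) * JtildeD (- b) theta 1 y (- t)
      - JtildeD (- b) theta 1 x (- s) * JtildeD (- b - 1) theta 1 y (- t))).

Definition Iker (s x t y : R) : R :=
  - (x * y) `^ (kappa / 2) *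
  \int[mu]_(theta in `]1, +oo[%classic)
    (theta `^ (kappa - 1) *
     (JhatI theta x s * JhatD (b + 1) theta 1 y t
      - JhatD (b + 1) theta 1 x s * JhatI theta y t)).

Definition Sker0 (s x t y : R) : R :=
  2^-1 * (x / y) `^ (kappa / 2) *
  \int[mu]_(theta in `]0, 1[%classic)
    (JhatD (b + 1) theta 1 x s * JtildeD (- b - 1) theta 1 y (- t)
     - (a * JtildeD (- b - 1) theta 1 y (- t) - JtildeD (- b) theta 1 y (- t))
       * JhatI theta x s).

Definition Jprod (s x t y theta : R) : R :=
  J (2 * Num.sqrt (theta * x)) * J (2 * Num.sqrt (theta * y)) *
  expR (2 * (s - t) * theta).

Definition Sker (s x t y : R) : R :=
  Sker0 s x t y -
  (s < t)%R%:R * (y / x) `^ (b / 2) *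
  \int[mu]_(theta in `]0, +oo[%classic) Jprod s x t y theta.

Definition bessel_kernel (x y : R) : R :=
  (J (2 * Num.sqrt x) * Num.sqrt y * derive1 J (2 * Num.sqrt y)
   - J (2 * Num.sqrt y) * Num.sqrt x * derive1 J (2 * Num.sqrt x)) / (x - y).

(* For s = t and x = y, the kernel is extended by continuity. *)
Definition Shom (s x t y : R) : R :=
  if s > t then \int[mu]_(theta in `]0, 1[%classic) Jprod s x t y theta
  else if s == t then
    if x == y then lim (bessel_kernel x z @[z --> x^']) else bessel_kernel x y
  else - \int[mu]_(theta in `]1, +oo[%classic) Jprod s x t y theta.

Definition Ablock (s x t y : R) : 'M[R]_(1 + 1) :=
  block_mx (Dker s x t y)%:M (Sker t y s x)%:M
           (- Sker s x t y)%:M (- Iker s x t y)%:M.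

End Kernels.

(* For n even,
     Pf A = (2 ^ (n/2) (n/2)!)^-1
            \sum_(s in S_n) sgn(s) \prod_(k < n/2) A (s (2k)) (s (2k+1)) ;
   ordS i has value i + 1 for every even i < n. *)
Definition Pf (R : fieldType) (n : nat) (A : 'M[R]_n) : R :=
  if odd n then 0
  else (2 ^+ n./2 * n./2`!%:R)^-1 *
       \sum_(s : 'S_n) (-1) ^+ s *
         \prod_(i < n | ~~ odd i) A (s i) (s (ordS i)).

Section Correlations.
Context {R : realType}.
Variables (nu kappa : R) (M : nat) (N : 'I_M -> nat).

(* The rows and the columns are indexed by the pairs (m, i) in lexicographic
   order, each pair giving two consecutive rows and columns. *)
Definition rhoY (s : 'I_M -> R) (y : forall m, 'I_(N m) -> R) : R :=
  Pf (\mxblock_(m < M, n < M) \mxblock_(i < N m, j < N n)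
        Ablock nu kappa (s m) (y m i) (s n) (y n j)).

Definition rhoY_hom (s : 'I_M -> R) (y : forall m, 'I_(N m) -> R) : R :=
  \det (\mxblock_(m < M, n < M) \matrix_(i < N m, j < N n)
          Shom nu (s m) (y m i) (s n) (y n j)).

End Correlations.

(* Main.v *)
Require Import Defs.
From HB Require Import structures.
From mathcomp Require Import all_boot all_order all_algebra all_fingroup.
From mathcomp Require Import all_classical all_reals all_analysis.
From mathcomp Require Import measurable_realfun.
From mathcomp Require Import ring lra.

(* J_nu (2 sqrt u) = u^(nu/2) G u with G entire of exponential type 0. Hence the
   functions to differintegrate are, up to a power, products of an entire function
   of small type with exp (-r eta) or exp (r eta), where r = 2 |s| theta, and as
   |s| -> oo a differintegral of order c merely multiplies them by r^c, with error
   bounds that are integrable in theta.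
   Write l = 2 |s| and b = nu - kappa. By dominated convergence, the integral in S
   tends to (y/x)^(b/2) times the integral of Jprod over (0, 1), whereas the
   integrands of l^(2b+1) exp (-2l) D and of l^(-2b-1) exp (2l) I concentrate at
   theta = 1, so that these two tend to 0. In particular D I -> 0.
   The Pfaffian does not change when the two rows and columns of each pair are
   multiplied by q and 1/q; with q^2 = l^(2b+1) exp (-2l) only the S-entries survive
   in the limit, and the Pfaffian is then their determinant, in which the factors
   (y/x)^(b/2) amount to a conjugation by a diagonal matrix. The integral of Jprod
   over (0, 1) is evaluated by the Christoffel-Darboux formula for s = t, and for
   s < t the indicator term turns it into minus the integral over (1, oo). *)

Set Implicit Arguments.
Unset Strict Implicit.
Unset Printing Implicit Defensive.

Import Order.TTheory GRing.Theory Num.Theory.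
Import numFieldNormedType.Exports.

Local Open Scope classical_set_scope.
Local Open Scope ring_scope.

(** The obstacle is uniformity in theta. Near theta = 0 the rate r = m theta is not large, so the
    power r^c that a differintegral produces is not a usable bound there. The bounds are therefore
    stated with powers of 1 + r for the left differintegrals and of (1 + r)/r for the inner integral
    over xi. When the factors of an integrand are multiplied, what remains is a power of r/(1 + r)
    or of l/(1 + l theta), and this is at most a constant plus a power of theta, uniformly in m. The
    assumptions on nu and kappa make the resulting powers of theta integrable at 0; in particular
    kappa < 2 (nu + 1) says that a > -1. Uniformity is also the reason for working with the series G
    instead of J_nu: theta can be moved into the argument of G, so that one bound on the
    coefficients, scaled by theta^k, serves for all theta. At fixed theta the limits come from
    Laplace's method: the left differintegrals concentrate at the endpoint eta = 1 within a distance
    of order 1/r, and the right ones just beyond it. *)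

Local Notation mu := (@lebesgue_measure _).
Local Notation integ D f := (mu.-integrable D (EFin \o f)).

(** * Lebesgue integrals: domination, parameters, affine substitutions *)

Section IntegralUtilities.
Context {R : realType}.

Lemma eq_ler (x y : R) : x = y -> x <= y.
Proof. by move=> ->. Qed.

Lemma gt0_powRD (x r s : R) : 0 < x -> x `^ (r + s) = x `^ r * x `^ s.
Proof. by move=> x0; apply: powRD; apply/implyP => _; rewrite gt_eqF. Qed.

Lemma is_derive_derivable (f : R -> R) (x d : R) :
  is_derive x 1 f d -> derivable f x 1.
Proof. by case. Qed.

Lemma is_derive_derive1 (f : R -> R) (x d : R) :
  is_derive x 1 f d -> derive1 f x = d.
Proof. by move=> h; rewrite derive1E derive_val. Qed.

Lemma is_derive_continuous (f : R -> R) (x d : R) :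
  is_derive x 1 f d -> {for x, continuous f}.
Proof.
by move=> h; apply: differentiable_continuous; apply/derivable1_diffP; case: h.
Qed.

Lemma integrable_dom (D : set R) (f g : R -> R) :
  measurable D -> measurable_fun D f -> integ D g ->
  (forall x, D x -> `|f x| <= g x) -> integ D f.
Proof.
move=> mD mf ig fg; apply: le_integrable ig => //.
  exact/measurable_EFinP.
by move=> x Dx /=; rewrite lee_fin (le_trans (fg _ Dx))// ler_norm.
Qed.

Lemma normr_Rintegral_dom (D : set R) (f g : R -> R) :
  measurable D -> measurable_fun D f -> integ D g ->
  (forall x, D x -> `|f x| <= g x) ->
  `|\int[mu]_(x in D) f x| <= \int[mu]_(x in D) g x.
Proof.
move=> mD mf ig fg; have if_ := integrable_dom mD mf ig fg.
apply: le_trans; first exact: (le_normr_Rintegral _ if_).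
apply: le_Rintegral => //; apply: (integrable_dom mD _ ig).
  exact: measurableT_comp.
by move=> x Dx; rewrite normr_id fg.
Qed.

Lemma integrableZ (D : set R) (f : R -> R) (k : R) :
  measurable D -> integ D f -> integ D (fun x => k * f x).
Proof. by move=> mD h; exact: (@integrableZl _ _ _ mu D mD k (EFin \o f) h). Qed.

Lemma integrable_add (D : set R) (f g : R -> R) :
  measurable D -> integ D f -> integ D g -> integ D (fun x => f x + g x).
Proof. by move=> mD h1 h2; exact: (@integrableD _ _ _ mu D mD _ _ h1 h2). Qed.

Lemma integrable_measurable (D : set R) (f : R -> R) :
  integ D f -> measurable_fun D f.
Proof. by move=> /measurable_int/measurable_EFinP. Qed.

Lemma integrable_eq (D : set R) (f g : R -> R) :
  measurable D -> (forall x, D x -> f x = g x) -> integ D f -> integ D g.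
Proof.
move=> mD fg; apply: eq_integrable => // x xD /=; rewrite fg//; exact: set_mem.
Qed.

Lemma eq_Rint (D : set R) (f g : R -> R) : (forall x, D x -> f x = g x) ->
  \int[mu]_(x in D) f x = \int[mu]_(x in D) g x.
Proof. by move=> fg; apply: eq_Rintegral => x /set_mem; exact: fg. Qed.

(** The conditions are asked for large n only, because the bounds on the kernels hold only once the
    times are large; the first terms are shifted away. Sequences suffice, since a limit at -oo can
    be tested on sequences. *)
Lemma Rintegral_dominated_cvg (D : set R) (f_ : nat -> R -> R) (f g : R -> R) :
  measurable D -> (\forall n \near \oo, measurable_fun D (f_ n)) ->
  (forall x, D x -> f_ n x @[n --> \oo] --> f x) ->
  integ D g ->
  (\forall n \near \oo, forall x, D x -> `|f_ n x| <= g x) ->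
  integ D f /\ \int[mu]_(x in D) f_ n x @[n --> \oo] --> \int[mu]_(x in D) f x.
Proof.
move=> mD [N1 _ mf] cf ig [N2 _ fg]; pose N := maxn N1 N2.
have mf' n : measurable_fun D (f_ (n + N)%N).
  by apply: mf => /=; rewrite (leq_trans (leq_maxl N1 N2)) ?leq_addl.
have fg' n x : D x -> `|f_ (n + N)%N x| <= g x.
  by apply: fg => /=; rewrite (leq_trans (leq_maxr N1 N2)) ?leq_addl.
have cf' x : D x -> f_ (n + N)%N x @[n --> \oo] --> f x.
  by move=> Dx; rewrite (cvg_shiftn N (fun n => f_ n x)); exact: cf.
have mlim : measurable_fun D f by exact: measurable_fun_cvg cf'.
have [|||||if_ _ c] := @dominated_convergence _ _ _ mu D mD
  (fun n => EFin \o f_ (n + N)%N) (EFin \o f) (EFin \o g).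
- by move=> n; apply/measurable_EFinP; exact: mf'.
- by apply/measurable_EFinP; exact: mlim.
- by apply: aeW => x Dx; apply: cvg_EFin; [exact: nearW|exact: cf'].
- exact: ig.
- by apply: aeW => x Dx n; rewrite lee_fin; exact: fg'.
split => //.
rewrite -(cvg_shiftn N).
apply: fine_cvg.
rewrite fineK; last by apply: (integrable_fin_num (mu:=mu) _ if_). exact c.
Qed.

(** By Tonelli the integrals of the positive and of the negative part are measurable in the
    parameter, and [Rintegral] is [fine] of their difference, be it finite or not. *)
Lemma measurable_Rintegral_param (D : set R) (f : R * R -> R) :
  measurable D -> measurable_fun setT f ->
  measurable_fun setT (fun x => \int[mu]_(y in D) f (x, y)).
Proof.
move=> mD mf.
pose g := fun p : R * R => (f p * \1_D p.2)%:E.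
have mg : measurable_fun setT g.
  apply/measurable_EFinP; apply: measurable_funM => //.
  by apply: (measurableT_comp (f := \1_D : R -> R)); [exact: measurable_indic|exact: measurable_snd].
have -> : (fun x => \int[mu]_(y in D) f (x, y)) =
  (fun x => fine (\int[mu]_y g^\+ (x, y) - \int[mu]_y g^\- (x, y))%E).
  apply/funext => x; rewrite /Rintegral; congr fine.
  rewrite integral_mkcond [LHS]integralE; congr (_ - _)%E; apply: eq_integral => y _.
    rewrite !funeposE /g /patch /=; congr maxe; rewrite indicE; case: (y \in D); by rewrite ?mulr1 ?mulr0.
  rewrite !funenegE /g /patch /=; congr maxe; rewrite indicE; case: (y \in D); by rewrite ?mulr1 ?mulr0.
apply: measurableT_comp => //; apply: emeasurable_funB.
  by apply: (measurable_fun_fubini_tonelli_F (m2 := mu)); [exact: measurable_funepos|move=> p; exact: funepos_ge0].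
by apply: (measurable_fun_fubini_tonelli_F (m2 := mu)); [exact: measurable_funeneg|move=> p; exact: funeneg_ge0].
Qed.

Definition affine (k c x : R) : R := k * x + c.

Lemma measurable_affine k c : measurable_fun setT (affine k c).
Proof.
apply: continuous_measurable_fun => x; apply: cvgD; last exact: cvg_cst.
by apply: cvgMr; exact: cvg_id.
Qed.

(** The left-hand side is a measure in [A], so by uniqueness of Lebesgue measure only half-open
    intervals have to be compared. A negative [k] reverses them, whence the two cases. *)
Lemma lebesgue_measure_affine (k c : R) (A : set R) : k != 0 -> measurable A ->
  (`|k|%:E * mu (affine k c @^-1` A) = mu A)%E.
Proof.
move=> k0 mA.
have mk : measurable_fun setT (affine k c : measurableTypeR R -> measurableTypeR R).
  exact: measurable_affine.
pose m := mscale (NngNum (normr_ge0 k))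
  (pushforward mu (affine k c : measurableTypeR R -> measurableTypeR R))
  : {measure set (measurableTypeR R) -> \bar R}.
apply/esym; apply: (@lebesgue_measure_unique R (m mk)) => //.
move=> _ [[u v]] _ <- /=.
have [kp|kn|k0'] := ltgtP 0 k; last by rewrite k0' eqxx in k0.
- pose I : set R := `](u - c) / k, (v - c) / k]%classic.
  have E : affine k c @^-1` `]u, v]%classic = I.
    apply/seteqP; split => x; rewrite /I /affine /= !in_itv/= ltr_pdivrMr// ler_pdivlMr//;
      by rewrite ltrBlDr lerBrDr mulrC.
  transitivity (`|k|%:E * mu I)%E; last by rewrite -E.
  rewrite gtr0_norm// /I !lebesgue_measure_itv /= !lte_fin ltr_pM2r ?invr_gt0// ltrD2r.
  case: ifPn => _; last by rewrite mule0.
  by rewrite -?EFinN -?EFinD -?EFinM -?EFinD; congr EFin; field.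
- pose I : set R := `[(v - c) / k, (u - c) / k[%classic.
  have E : affine k c @^-1` `]u, v]%classic = I.
    apply/seteqP; split => x; rewrite /I /affine /= !in_itv/= ltr_ndivlMr// ler_ndivrMr//;
      by rewrite ltrBlDr lerBrDr mulrC andbC.
  transitivity (`|k|%:E * mu I)%E; last by rewrite -E.
  rewrite ltr0_norm// /I !lebesgue_measure_itv /= !lte_fin ltr_nM2r ?invr_lt0// ltrD2r.
  case: ifPn => _; last by rewrite mule0.
  by rewrite -?EFinN -?EFinD -?EFinM -?EFinD; congr EFin; field.
Qed.

Lemma ge0_integral_affine (k c : R) (D : set R) (f : R -> \bar R) : k != 0 ->
  measurable D -> measurable_fun D f -> (forall x, D x -> 0 <= f x)%E ->
  (\int[mu]_(x in D) f x =
   `|k|%:E * \int[mu]_(x in affine k c @^-1` D) f (affine k c x))%E.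
Proof.
move=> k0 mD mf f0.
have mk : measurable_fun setT (affine k c : measurableTypeR R -> measurableTypeR R).
  exact: measurable_affine.
have H := @ge0_integral_pushforward _ _ (measurableTypeR R) (measurableTypeR R) R
  (affine k c) mk mu D f mD mf.
rewrite -[X in (_ * X)%E]H; last by move=> x /set_mem Dx; exact: f0.
pose m := pushforward mu (affine k c : measurableTypeR R -> measurableTypeR R)
  : {measure set (measurableTypeR R) -> \bar R}.
apply: (eq_trans _ (@ge0_integral_mscale _ (measurableTypeR R) R (m mk) D mD
  (NngNum (normr_ge0 k)) f mf f0)).
by apply: eq_measure_integral => A mA _ /=; apply/esym/lebesgue_measure_affine.
Qed.

Lemma integral_affine (k c : R) (D : set R) (f : R -> R) : k != 0 ->
  measurable D -> measurable_fun D f ->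
  integ (affine k c @^-1` D) (f \o affine k c) ->
  integ D f /\
  \int[mu]_(x in D) f x = `|k| * \int[mu]_(x in affine k c @^-1` D) f (affine k c x).
Proof.
move=> k0 mD mf intf.
have mf' : measurable_fun D (EFin \o f) by exact/measurable_EFinP.
have k0' : 0 < `|k| by rewrite normr_gt0.
have iD : integ D f.
  apply/integrableP; split => //.
  rewrite (@ge0_integral_affine k c)//; last exact: measurableT_comp.
  case/integrableP : intf => _ h.
  by rewrite lte_mul_pinfty.
split => //.
rewrite /Rintegral integralE.
rewrite (@ge0_integral_affine k c)//; last exact: measurable_funepos.
rewrite (@ge0_integral_affine k c _ (_^\-)%E)//; last exact: measurable_funeneg.
set h := EFin \o (f \o affine k c).
have Ep : (\int[mu]_(x in affine k c @^-1` D) (fun x => (f x)%:E)^\+ (affine k c x) =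
    \int[mu]_(x in affine k c @^-1` D) h^\+ x)%E.
  by apply: eq_integral => x _; rewrite !funeposE.
have En : (\int[mu]_(x in affine k c @^-1` D) (fun x => (f x)%:E)^\- (affine k c x) =
    \int[mu]_(x in affine k c @^-1` D) h^\- x)%E.
  by apply: eq_integral => x _; rewrite !funenegE.
have mD' : measurable (affine k c @^-1` D).
  by rewrite -[_ @^-1` _]setTI; apply: measurable_affine.
rewrite Ep En -muleBr//; last exact: (integrable_add_def (mu := mu)).
rewrite fineM//; last first.
  rewrite fin_numB; apply/andP; split.
    exact: (integrable_pos_fin_num (mu := mu)).
  exact: (integrable_neg_fin_num (mu := mu)).
by congr (_ * fine _); rewrite [RHS]integralE.
Qed.

Lemma affine_itvoy (k c p : R) : 0 < k ->
  affine k c @^-1` `]p, +oo[%classic = `](p - c) / k, +oo[%classic.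
Proof.
move=> k0; apply/seteqP; split => x; rewrite /affine /= !in_itv/= !andbT ltr_pdivrMr//;
  by rewrite ltrBlDr mulrC.
Qed.

Lemma affine_itvoo (k c p q : R) : 0 < k ->
  affine k c @^-1` `]p, q[%classic = `](p - c) / k, (q - c) / k[%classic.
Proof.
move=> k0; apply/seteqP; split => x; rewrite /affine /= !in_itv/= ltr_pdivrMr// ltr_pdivlMr//;
  by rewrite ltrBlDr ltrBrDr mulrC.
Qed.

Lemma affine_itvoo_neg (k c p q : R) : k < 0 ->
  affine k c @^-1` `]p, q[%classic = `](q - c) / k, (p - c) / k[%classic.
Proof.
move=> k0; apply/seteqP; split => x; rewrite /affine /= !in_itv/= ltr_ndivrMr// ltr_ndivlMr//;
  by rewrite ltrBlDr ltrBrDr mulrC andbC.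
Qed.

End IntegralUtilities.

(** * The Gamma function and differentiation under the integral sign *)

Section Gamma.
Context {R : realType}.

Lemma integrable_union (A B : set R) (f : R -> R) :
  measurable A -> measurable B -> integ A f -> integ B f -> integ (A `|` B) f.
Proof.
move=> mA mB iA iB.
have iA' : integ setT (f \_ A) by rewrite -restrict_EFin; apply: (integrable_mkcond (mu := mu) _ mA).1.
have iB' : integ setT (f \_ B) by rewrite -restrict_EFin; apply: (integrable_mkcond (mu := mu) _ mB).1.
have nA : integ setT (fun x => `|(f \_ A) x|) by exact: (integrable_norm (mu := mu)).
have nB : integ setT (fun x => `|(f \_ B) x|) by exact: (integrable_norm (mu := mu)).
have mf : measurable_fun (A `|` B) f.
  by apply/measurable_funU => //; split; exact: integrable_measurable.
apply: (@integrable_dom _ _ _ (fun x => `|(f \_ A) x| + `|(f \_ B) x|)) => //.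
- exact: measurableU.
- by apply: integrableS (integrable_add _ nA nB) => //; exact: measurableU.
- move=> x [Ax|Bx].
    by rewrite patchE mem_set// lerDl.
  by rewrite [X in _ <= _ + `|X|]patchE mem_set// lerDr.
Qed.

(** Multiply ln u <= u by q for u = t / k; the choice k = q / e turns the right-hand side into e
    t. *)
Lemma powR_le_exp (q e : R) : 0 <= q -> 0 < e ->
  exists2 C : R, 0 < C & forall t, 0 <= t -> t `^ q <= C * expR (e * t).
Proof.
move=> q0 e0; have [->|qn0] := eqVneq q 0.
  exists 1 => // t t0; rewrite powRr0 mul1r; apply: le_trans (expR_ge1Dx _).
  by rewrite lerDl mulr_ge0// ltW.
have q1 : 0 < q by rewrite lt_neqAle eq_sym qn0.
pose k := q / e; have k0 : 0 < k by rewrite divr_gt0.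
exists (k `^ q); first exact: powR_gt0.
move=> t; rewrite le_eqVlt => /predU1P[<-|t0].
  by rewrite powR0// mulr_ge0// ?powR_ge0 ?expR_ge0.
rewrite -ler_pdivrMl ?powR_gt0// -powRN -[X in _ * X `^ _](@mulfVK _ k)//; last by rewrite gt_eqF.
have tk0 : 0 <= t / k by rewrite ltW// divr_gt0.
rewrite (powRM q tk0 (ltW k0)).
rewrite mulrCA -gt0_powRD//.
rewrite addNr powRr0 mulr1 /powR gt_eqF ?divr_gt0// ler_expR.
have tk : 0 < t / k by rewrite divr_gt0.
have : ln (t / k) <= t / k by rewrite ltW// ln_sublinear.
move=> /(ler_wpM2l q0)/le_trans; apply.
by rewrite /k; apply: eq_ler; field; rewrite !gt_eqF.
Qed.

Lemma integrable_expR_itv0y (k : R) : 0 < k -> integ `]0, +oo[ (fun t => expR (- (k * t))).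
Proof.
move=> k0.
have h := integrable_exponential_pdf k0.
have h1 : integ `]0, +oo[ (fun t => k^-1 * exponential_pdf k t).
  by apply: integrableZ => //; apply: integrableS h.
apply: integrable_eq h1 => // t /=; rewrite in_itv/= andbT => t0.
by rewrite exponential_pdfE ?ltW// /= mulKf ?gt_eqF// mulNr.
Qed.

(** Monotone convergence along the intervals from 1/(i+1) to 1, on which the antiderivative
    t^(p+1)/(p+1) bounds the integrals by 1/(p+1). *)
Lemma integrable_powR01 (p : R) : -1 < p -> integ `]0, 1[ (fun t => t `^ p).
Proof.
move=> p1; have p10 : 0 < p + 1 by rewrite -ltrBlDr sub0r.
pose F (i : nat) : set R := `[i.+1%:R^-1, 1]%classic.
have mp : measurable_fun setT (fun t : R => t `^ p) by exact: measurable_powR.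
have i01 (i : nat) : i.+1%:R^-1 <= 1 :> R by rewrite invf_le1// ler1n.
have Fi0 (i : nat) : 0 < i.+1%:R^-1 :> R by rewrite invr_gt0.
have U : \bigcup_i F i = `]0, 1]%classic.
  apply/seteqP; split => t.
    move=> [i _]; rewrite /F /= !in_itv/= => /andP[h ->]; rewrite andbT.
    exact: lt_le_trans h.
  rewrite /= in_itv/= => /andP[t0 t1].
  exists (Num.truncn t^-1) => //; rewrite /F /= in_itv/= t1 andbT.
  rewrite invf_ple ?posrE//; apply/ltW; rewrite truncnS_gt//.
have : integ `]0, 1] (fun t => t `^ p).
  apply/integrableP; split.
    by apply/measurable_EFinP; exact: measurable_funTS.
  rewrite -U.
  under eq_integral do rewrite /= ger0_norm ?powR_ge0//.
  have cv := @ge0_nondecreasing_set_cvg_integral _ (measurableTypeR R) R F (fun x => (x `^ p)%:E) mu.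
  apply: (@le_lt_trans _ _ (p + 1)^-1%:E); last by rewrite ltry.
  rewrite -(cvg_lim _ (cv _ _ _ _))//; last 4 first.
  - move=> m n mn; apply/subsetPset => t; rewrite /F /= !in_itv/= => /andP[h ->].
    by rewrite andbT; apply: le_trans h; rewrite lef_pV2 ?posrE// ler_nat.
  - by move=> i; apply: measurable_itv.
  - by move=> i; apply/measurable_EFinP; exact: measurable_funTS.
  - by move=> i x _; rewrite lee_fin powR_ge0.
  apply: lime_le.
    apply/cvg_ex; eexists; apply: cv.
    - move=> m n mn; apply/subsetPset => t; rewrite /F /= !in_itv/= => /andP[h ->].
      by rewrite andbT; apply: le_trans h; rewrite lef_pV2 ?posrE// ler_nat.
    - by move=> i; apply: measurable_itv.
    - by move=> i; apply/measurable_EFinP; exact: measurable_funTS.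
    - by move=> i x _; rewrite lee_fin powR_ge0.
  apply: nearW => -[|i].
    by rewrite /F invr1 set_itv1 integral_set1 lee_fin invr_ge0 ltW.
  have dP (x : R) : 0 < x -> is_derive x 1 (fun t : R => (p + 1)^-1 * t `^ (p + 1)) (x `^ p).
    move=> x0; have h := is_derive1_powR (p + 1) x0.
    have hZ := is_deriveZ (p + 1)^-1 h.
    apply: is_derive_eq hZ _.
    rewrite addrK /GRing.scale/= mulrA mulVf ?gt_eqF// mul1r//.
  rewrite (@continuous_FTC2 _ _ (fun t => (p + 1)^-1 * t `^ (p + 1))).
  - rewrite powR1 mulr1 -EFinB lee_fin gerBl mulr_ge0 ?powR_ge0// invr_ge0 ltW//.
  - by rewrite invf_lt1// ltr1n.
  - apply: derivable_within_continuous => x; rewrite in_itv/= => /andP[h _].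
    by apply: derivable_powR; rewrite in_itv/= andbT (lt_le_trans _ h).
  - have cP (x : R) : 0 < x -> {for x, continuous (fun t : R => (p + 1)^-1 * t `^ (p + 1))}.
      by move=> x0; exact: is_derive_continuous (dP _ x0).
    split.
    + move=> x; rewrite in_itv/= => /andP[h _].
      exact: is_derive_derivable (dP _ (lt_trans (Fi0 _) h)).
    + by apply: cvg_at_right_filter; exact: cP.
    + by apply: cvg_at_left_filter; exact: cP.
  - move=> x; rewrite in_itv/= => /andP[h _].
    exact: is_derive_derive1 (dP _ (lt_trans (Fi0 _) h)).
by apply: integrableS => //; apply: subset_itv_oo_oc.
Qed.

Lemma integrable_Gamma (z : R) : 0 < z ->
  integ `]0, +oo[ (fun t => t `^ (z - 1) * expR (- t)).
Proof.
move=> z0.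
have mf : measurable_fun setT (fun t : R => t `^ (z - 1) * expR (- t)).
  apply: measurable_funM; first exact: measurable_powR.
  by apply: measurableT_comp => //; exact: oppr_measurable.
have U : `]0, +oo[%classic = `]0, 1[%classic `|` `[1, +oo[%classic :> set R.
  by rewrite -itv_bndbnd_setU// bnd_simp.
rewrite U; apply: integrable_union => //.
- apply: (@integrable_dom _ _ _ (fun t => t `^ (z - 1))) => //.
  + exact: measurable_funTS.
  + by apply: integrable_powR01; rewrite -ltrBlDr opprK addNr.
  + move=> t; rewrite /= in_itv/= => /andP[t0 t1].
    rewrite ger0_norm ?mulr_ge0 ?powR_ge0 ?expR_ge0//.
    by rewrite ler_piMr ?powR_ge0// -expR0 ler_expR oppr_le0 ltW.
- have [C C0 hC] := @powR_le_exp z 2^-1 (ltW z0) ltac:(by []).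
  apply: (@integrable_dom _ _ _ (fun t => C * expR (- (2^-1 * t)))) => //.
  + exact: measurable_funTS.
  + apply: integrableZ => //.
    apply: integrableS (@integrable_expR_itv0y 2^-1 ltac:(by [])) => //.
    by apply: subset_itvr; rewrite bnd_simp.
  + move=> t; rewrite /= in_itv/= andbT => t1.
    have t0 : 0 <= t by rewrite (le_trans _ t1).
    rewrite ger0_norm ?mulr_ge0 ?powR_ge0 ?expR_ge0//.
    apply: (@le_trans _ _ (t `^ z * expR (- t))).
      by rewrite ler_pM2r ?expR_gt0// ler_powR// gerBl.
    apply: (@le_trans _ _ (C * expR (2^-1 * t) * expR (- t))).
      by rewrite ler_pM2r ?expR_gt0// hC.
    rewrite -mulrA -expRD.
    by apply: eq_ler; congr (_ * expR _); field.
Qed.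

Lemma Gamma_scale (z k : R) : 0 < z -> 0 < k ->
  integ `]0, +oo[ (fun t => t `^ (z - 1) * expR (- (k * t))) /\
  \int[mu]_(t in `]0, +oo[) (t `^ (z - 1) * expR (- (k * t))) = k `^ (- z) * Gamma z.
Proof.
move=> z0 k0; have kV0 : 0 < k^-1 by rewrite invr_gt0.
have mf : measurable_fun setT (fun t : R => t `^ (z - 1) * expR (- (k * t))).
  apply: measurable_funM; first exact: measurable_powR.
  by do 2 apply: measurableT_comp => //.
have E t : 0 < t -> affine k^-1 0 t `^ (z - 1) * expR (- (k * affine k^-1 0 t)) =
    (k^-1) `^ (z - 1) * (t `^ (z - 1) * expR (- t)).
  move=> t0; rewrite /affine addr0 mulVKf ?gt_eqF// powRM ?(ltW t0) ?(ltW kV0)//.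
  by rewrite mulrA.
have := @integral_affine R k^-1 0 `]0, +oo[%classic
  (fun t => t `^ (z - 1) * expR (- (k * t))).
rewrite affine_itvoy// subr0 mul0r => /(_ _ _ _ _)[].
- by rewrite gt_eqF.
- exact: measurable_itv.
- exact: measurable_funTS.
- apply: integrable_eq (integrableZ (k^-1 `^ (z - 1)) _ (integrable_Gamma z0)) => //.
  by move=> t /=; rewrite in_itv/= andbT => t0; rewrite E.
move=> h ->; split; first exact: h.
rewrite (eq_Rint (g := fun t => k^-1 `^ (z - 1) * (t `^ (z - 1) * expR (- t)))); last first.
  by move=> t /=; rewrite in_itv/= andbT => t0; rewrite E.
rewrite RintegralZl//; last exact: integrable_Gamma.
rewrite mulrA gtr0_norm// -/(Gamma z); congr (_ * _).
rewrite -{1}(powRr1 (ltW kV0)) -gt0_powRD//.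
rewrite addrC subrK -powR_inv1 ?ltW// -powRrM; congr (_ `^ _); ring.
Qed.

Lemma Gamma_gt0 (z : R) : 0 < z -> 0 < Gamma z.
Proof.
move=> z0.
have iG := integrable_Gamma z0.
(* On []1, 2[] the power is at least the smaller of its values at the endpoints, whatever the sign
   of z - 1. *)
apply: (@lt_le_trans _ _ (\int[mu]_(t in `]1, 2[) (Num.min 1 (2 `^ (z - 1)) * expR (- 2)))).
  rewrite Rintegral_cst//= lebesgue_measure_itv/= lte_fin ltr1n/=.
  apply: mulr_gt0; last by rewrite subr_gt0 ltr1n.
  by apply: mulr_gt0; rewrite ?expR_gt0// lt_min ltr01 powR_gt0.
apply: (@le_trans _ _ (\int[mu]_(t in `]1, 2[) (t `^ (z - 1) * expR (- t)))).
  apply: le_Rintegral => //.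
  - apply: (@integrableS _ _ _ mu `[1, 2]) => //.
      exact: subset_itv_oo_cc.
    apply: continuous_compact_integrable; first exact: segment_compact.
    by move=> x; exact: cvg_cst.
  - apply: integrableS iG => //.
    by apply: subset_itv; rewrite bnd_simp.
  - move=> t; rewrite /= in_itv/= => /andP[t1 t2].
    apply: ler_pM => //.
    + have [z1|z1] := leP 0 (z - 1).
        rewrite ge_min; apply/orP; left.
        by rewrite -[leLHS](powRr0 t) ler_powR// ltW.
      rewrite ge_min; apply/orP; right.
      have t0 : 0 < t by rewrite (lt_trans _ t1).
      rewrite -[z - 1]opprK powRN [leRHS]powRN lef_pV2 ?posrE ?powR_gt0//.
      apply: ge0_ler_powR; rewrite ?nnegrE ?(ltW t0) ?(ltW t2)//.
      by rewrite oppr_ge0 ltW.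
    + by rewrite ler_expR lerN2 ltW.
rewrite /Gamma.
have U : `]0, +oo[%classic = `]1, 2[%classic `|` (`]0, +oo[%classic `\` `]1, 2[%classic) :> set R.
  by rewrite setDUK//; apply: subset_itv; rewrite bnd_simp.
rewrite [X in _ <= \int[mu]_(t in X) _]U Rintegral_setU//.
- rewrite lerDl; apply: Rintegral_ge0 => x _.
  by rewrite mulr_ge0 ?powR_ge0 ?expR_ge0.
- exact: measurableD.
- by rewrite -U.
- by apply/disj_setPS => x /= [? [_]].
Qed.

Lemma is_derive_under_integral (D : set R) (f df : R -> R -> R) (a u v : R)
    (g : R -> R) :
  measurable D -> u < a < v ->
  (forall x, u < x < v -> integ D (f x)) ->
  (forall x y, u < x < v -> D y -> is_derive x 1 (f ^~ y) (df x y)) ->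
  integ D g ->
  (forall x y, u < x < v -> D y -> `|df x y| <= g y) ->
  is_derive a 1 (fun x => \int[mu]_(y in D) f x y) (\int[mu]_(y in D) df a y).
Proof.
move=> mD auv intf ddf ig dfg.
have E x y : u < x < v -> D y -> partial1of2 f x y = df x y.
  by move=> xuv Dy; rewrite /partial1of2; exact: is_derive_derive1 (ddf _ _ xuv Dy).
have ig' : integ D (fun y => `|g y|) by exact: (integrable_norm (mu := mu)).
have I x : `]u, v[%classic x -> u < x < v by rewrite /= in_itv.
have Ia : `]u, v[%classic a by rewrite /= in_itv.
have H1 x : `]u, v[%classic x -> integ D (f x) by move/I; exact: intf.
have H2 x y : `]u, v[%classic x -> D y -> derivable (f ^~ y) x 1.
  by move=> /I xuv Dy; exact: is_derive_derivable (ddf _ _ xuv Dy).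
have H3 x y : `]u, v[%classic x -> D y -> `|partial1of2 f x y| <= `|g y|.
  by move=> /I xuv Dy; rewrite E// (le_trans (dfg _ _ xuv Dy))// ler_norm.
have H4 y : 0 <= `|g y| by [].
apply: DeriveDef.
  exact: (@derivable_under_integral R _ (measurableTypeR R) mu f D mD a u v Ia H1 H2 _ H4 ig' H3).
rewrite -derive1E.
rewrite (@differentiation_under_integral R _ (measurableTypeR R) mu f D mD a u v Ia H1 H2 _ H4 ig' H3).
by apply: eq_Rint => y Dy; rewrite E.
Qed.

Lemma is_derive_comp_affine (f : R -> R) (k c x d : R) :
  is_derive (k * x + c) 1 f d -> is_derive x 1 (fun z => f (k * z + c)) (k * d).
Proof.
move=> h.
have ha : is_derive x 1 (fun z : R => k * z + c) k.
  have h1 := is_deriveD (is_deriveZ k (is_derive_id x 1)) (is_derive_cst c x 1).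
  by apply: is_derive_eq h1 _; rewrite addr0 /GRing.scale/= mulr1.
have hc := @is_derive1_comp R f (fun z => k * z + c) x d k h ha.
by apply: is_derive_eq hc _; rewrite mulrC.
Qed.

Lemma is_derive_expRM (k x : R) :
  is_derive x 1 (fun z => expR (k * z)) (k * expR (k * x)).
Proof.
have := @is_derive_comp_affine expR k 0 x (expR (k * x)).
rewrite addr0 => /(_ (is_derive_expR _)) h.
by rewrite (_ : (fun z => _) = (fun z => expR (k * z + 0)))//; apply/funext => z; rewrite addr0.
Qed.

(* Differentiate [\int t^(z-1) e^(-kt) dt = k^(-z) Gamma z] at [k = 1]. *)
Lemma GammaS (z : R) : 0 < z -> Gamma (z + 1) = z * Gamma z.
Proof.
move=> z0.
have z10 : 0 < z + 1 by rewrite addr_gt0.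
pose f (k t : R) := t `^ (z - 1) * expR (- (k * t)).
pose df (k t : R) := - (t `^ (z + 1 - 1) * expR (- (k * t))).
have h2 : 0 < 2^-1 :> R by [].
have D1 := @is_derive_under_integral `]0, +oo[ f df 1 2^-1 2
  (fun t => t `^ (z + 1 - 1) * expR (- (2^-1 * t))).
have D1' : is_derive (1 : R) 1 (fun k : R => \int[mu]_(t in `]0, +oo[) f k t) (- Gamma (z + 1)).
  apply: is_derive_eq (D1 _ _ _ _ _ _) _.
  - exact: measurable_itv.
  - by rewrite invf_lt1// ltr1n.
  - move=> k /andP[k0 _]; have [] := Gamma_scale z0 (lt_trans h2 k0); by [].
  - move=> k t /andP[k0 _]; rewrite /= in_itv/= andbT => t0.
    have h := is_deriveZ (t `^ (z - 1)) (is_derive_expRM (- t) k).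
    have E : (f ^~ t) = t `^ (z - 1) \*: (fun z => expR (- t * z)).
      by apply/funext => x; rewrite /f/= /GRing.scale/= mulNr mulrC [t * x]mulrC mulrC.
    rewrite E; apply: is_derive_eq h _.
    have pw : t `^ (z + 1 - 1) = t `^ (z - 1) * t.
      by rewrite addrAC (gt0_powRD (z - 1) 1 t0) powRr1// ltW.
    by rewrite /df pw /GRing.scale/= [k * t]mulrC !mulNr mulrN mulrA.
  - by have [] := Gamma_scale z10 h2.
  - move=> k t /andP[k0 k2]; rewrite /= in_itv/= andbT => t0.
    rewrite /df normrN ger0_norm ?mulr_ge0 ?powR_ge0 ?expR_ge0//.
    rewrite ler_wpM2l ?powR_ge0// ler_expR lerN2 ler_pM2r// ltW//.
  - rewrite /df (eq_Rint (g := fun t => (-1) * (t `^ (z + 1 - 1) * expR (- t)))); last first.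
      by move=> t _; rewrite mul1r mulN1r.
    by rewrite RintegralZl// ?mulN1r//; exact: integrable_Gamma.
have D2 : is_derive (1 : R) 1 (fun k : R => k `^ (- z) * Gamma z) (- (z * Gamma z)).
  have h := is_deriveZ (Gamma z) (is_derive1_powR (- z) (@ltr01 R)).
  rewrite (_ : (fun k => _) = Gamma z \*: (@powR R ^~ (- z))); last first.
    by apply/funext => k; rewrite /GRing.scale/= mulrC.
  by apply: is_derive_eq h _; rewrite powR1 mulr1 /GRing.scale/= mulrN mulrC.
have : - Gamma (z + 1) = - (z * Gamma z).
  rewrite -(is_derive_derive1 D1') -(is_derive_derive1 D2) !derive1E.
  apply: near_eq_derive => //; near=> k.
  have k0 : 0 < k by near: k; exact: lt_nbhsr.
  by have [_ <-] := Gamma_scale z0 k0.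
by move=> /oppr_inj.
Unshelve. all: by end_near. Qed.

(** Passing from k to k + 1 divides 1/Gamma by k + nu + 1, which is at least 1/e from k = K on; the
    constant absorbs the terms up to K. This is what gives the Bessel series an arbitrarily small
    exponential type. *)
Lemma invGamma_le (nu e : R) : -1 < nu -> 0 < e ->
  exists2 C : R, 0 < C & forall k : nat, (Gamma (k%:R + nu + 1))^-1 <= C * e ^+ k.
Proof.
move=> nu1 e0.
have g0 k : 0 < k%:R + nu + 1.
  by rewrite -addrA ltr_wpDl// -ltrBlDr sub0r.
have G0 k : 0 < Gamma (k%:R + nu + 1) by exact: Gamma_gt0.
have GS k : Gamma (k.+1%:R + nu + 1) = (k%:R + nu + 1) * Gamma (k%:R + nu + 1).
  by rewrite -(GammaS (g0 k)); congr Gamma; rewrite -natr1; ring.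
pose K := (Num.truncn (e^-1)).+1.
have KP k : (K <= k)%N -> e^-1 <= k%:R + nu + 1.
  move=> Kk; apply: (@le_trans _ _ K%:R).
    by rewrite ltW// truncnS_gt.
  rewrite -addrA (@le_trans _ _ k%:R)// ?ler_nat// lerDl ltW// -ltrBlDr sub0r//.
pose C := \sum_(i < K.+1) (Gamma (i%:R + nu + 1))^-1 * e ^- i.
have ti (i : nat) : 0 < (Gamma (i%:R + nu + 1))^-1 * e ^- i.
  by rewrite mulr_gt0// invr_gt0// exprn_gt0.
have Ci (i : nat) : (i <= K)%N -> (Gamma (i%:R + nu + 1))^-1 * e ^- i <= C.
  move=> iK; rewrite /C (bigD1 (Ordinal (iK : (i < K.+1)%N)))//= lerDl sumr_ge0// => j _.
  exact: ltW.
exists C; first by apply: lt_le_trans (Ci 0%N _).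
elim => [|k IH].
  by rewrite expr0; have := Ci 0%N isT; rewrite expr0 invr1 !mulr1.
have [kK|Kk] := leqP k.+1 K.
  by have := Ci _ kK; rewrite ler_pdivrMr// exprn_gt0.
rewrite GS invfM exprS mulrCA.
apply: ler_pM => //.
- by rewrite invr_ge0 ltW.
- by rewrite invr_ge0 ltW.
- by rewrite invf_ple ?posrE//; exact: KP.
Qed.

End Gamma.

(** * Power series of exponential type, multiplied by exponentials *)

Section ExponentialType.
Context {R : realType}.
Implicit Types (c d : nat -> R) (A B X t m a u : R).

Definition psum c (u : R) : R := limn (pseries c u).

(* Exponential type X: [|psum c u| <= A * expR (X * |u|)]. *)
Definition expbd (A X : R) c := forall k, `|c k| <= A * (X ^+ k / k`!%:R).

Lemma expbd_ge0 A X c : expbd A X c -> 0 <= A.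
Proof.
move=> /(_ 0%N); rewrite expr0 fact0 divr1 mulr1; exact: le_trans.
Qed.

Lemma expbd_le A B X c : 0 <= X -> A <= B -> expbd A X c -> expbd B X c.
Proof.
move=> X0 AB h k; apply: le_trans (h k) _.
by apply: ler_wpM2r => //; rewrite divr_ge0// exprn_ge0.
Qed.

Section bounded.
Variables (A X : R) (c : nat -> R).
Hypotheses (X0 : 0 <= X) (cb : expbd A X c).
Let A0 : 0 <= A. Proof. exact: expbd_ge0 cb. Qed.

Lemma expbd_term (u : R) k : `|c k * u ^+ k| <= A * exp_coeff (X * `|u|) k.
Proof.
rewrite /exp_coeff/= normrM normrX exprMn.
apply: le_trans (ler_wpM2r _ (cb k)) _; first by rewrite exprn_ge0.
by apply: eq_ler; ring.
Qed.

Let cvgA (u : R) : cvgn (series (fun k => A * exp_coeff (X * `|u|) k)).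
Proof.
have := @is_cvg_seriesZ _ (exp_coeff (X * `|u|)) A (is_cvg_series_exp_coeff _).
by [].
Qed.

Lemma psum_normed_cvg (u : R) : cvgn [normed series (fun k => c k * u ^+ k)].
Proof.
rewrite /normed_series_of /=.
apply: (@series_le_cvg R (fun k => `|c k * u ^+ k|) _ _ _ _ (@cvgA u)) => //.
- move=> k; apply: mulr_ge0 => //; rewrite /exp_coeff/= divr_ge0// exprn_ge0// mulr_ge0//.
- exact: expbd_term.
Qed.

Lemma psum_cvg (u : R) : cvgn (pseries c u).
Proof. by apply: normed_cvg; exact: psum_normed_cvg. Qed.

Lemma psum_le (u : R) : `|psum c u| <= A * expR (X * `|u|).
Proof.
apply: le_trans (lim_series_norm (@psum_normed_cvg u)) _.
rewrite [leRHS](_ : _ = limn (series (fun k => A * exp_coeff (X * `|u|) k))).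
  apply: lim_series_le; [exact: (@psum_normed_cvg u)|exact: cvgA|exact: expbd_term].
apply/esym/cvg_lim => //.
have h := @is_cvg_series_exp_coeff R (X * `|u|).
rewrite (_ : series _ = (fun n => A * series (exp_coeff (X * `|u|)) n)).
  by apply: cvgMl_tmp; exact: h.
by apply/funext => n; rewrite /series/= mulr_sumr.
Qed.

Lemma expbd_diffs : expbd (A * X) X (pseries_diffs c).
Proof.
move=> k; rewrite /pseries_diffs normrM ger0_norm//.
have := ler_wpM2l (ler0n R k.+1) (cb k.+1) => /le_trans; apply.
rewrite factS natrM exprS le_eqVlt; apply/orP; left; apply/eqP.
have a0 : k.+1%:R != 0 :> R by rewrite pnatr_eq0.
have b0 : k`!%:R != 0 :> R by rewrite pnatr_eq0 -lt0n fact_gt0.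
by move: a0 b0; move: k.+1%:R k`!%:R => a b a0 b0; field; rewrite b0 a0.
Qed.

End bounded.

Lemma expbd_add A B X c d : expbd A X c -> expbd B X d ->
  expbd (A + B) X (fun k => c k + d k).
Proof.
move=> hc hd k; rewrite mulrDl; exact: le_trans (ler_normD _ _) (lerD (hc k) (hd k)).
Qed.

Lemma expbd_scale A X c a : expbd A X c -> expbd (`|a| * A) X (fun k => c k * a).
Proof.
by move=> hc k; rewrite normrM mulrC -mulrA ler_wpM2l.
Qed.

Lemma psumD A B X c d a u : 0 <= X -> expbd A X c -> expbd B X d ->
  psum (fun k => c k + d k * a) u = psum c u + psum d u * a.
Proof.
move=> X0 hc hd; apply/cvg_lim => //.
have -> : pseries (fun k => c k + d k * a) u =
    (fun n => pseries c u n + pseries d u n * a).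
  apply/funext => n; rewrite /pseries /series/= mulr_suml -big_split/=.
  by apply: eq_bigr => i _; ring.
apply: cvgD; first exact: (psum_cvg X0 hc).
by apply: cvgMr_tmp; exact: (psum_cvg X0 hd).
Qed.

Lemma psum_scale c t u : psum (fun k => c k * t ^+ k) u = psum c (t * u).
Proof.
rewrite /psum /pseries; congr (limn (series _)); apply/funext => k.
by rewrite /= exprMn mulrA.
Qed.

Lemma is_derive_psum A X c (u : R) : 0 <= X -> expbd A X c ->
  is_derive u 1 (psum c) (psum (pseries_diffs c) u).
Proof.
move=> X0 h; have h1 := expbd_diffs h; have h2 := expbd_diffs h1.
apply: (@pseries_snd_diffs R c (`|u| + 1) u).
- exact: (psum_cvg X0 h).
- exact: (psum_cvg X0 h1).
- exact: (psum_cvg X0 h2).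
- by rewrite [ltRHS]ger0_norm ?addr_ge0// ltrDl.
Qed.

Lemma continuous_psum A X c : 0 <= X -> expbd A X c -> continuous (psum c).
Proof. by move=> X0 h u; exact: is_derive_continuous (is_derive_psum u X0 h). Qed.

Lemma measurable_psum A X c : 0 <= X -> expbd A X c -> measurable_fun setT (psum c).
Proof.
by move=> X0 h; apply: continuous_measurable_fun; exact: (continuous_psum X0 h).
Qed.

(* [psum (expdiff m j c) u * expR (m * u)] is [m ^- j] times the [j]-th derivative of
   [psum c u * expR (m * u)]. *)
Fixpoint expdiff (m : R) (j : nat) c : nat -> R :=
  if j is j'.+1 then fun k => expdiff m j' c k + pseries_diffs (expdiff m j' c) k * m^-1
  else c.

(** A derivative multiplies the bound by X, and X/|m| <= 1, so each step at most doubles it. For m =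
    0 the inverse is 0 and the step changes nothing. *)
Lemma expbd_expdiff A X c m j : 0 <= X -> X <= `|m| -> expbd A X c ->
  expbd (2 ^+ j * A) X (expdiff m j c).
Proof.
move=> X0 Xm h; elim: j => [|j IH] /=; first by rewrite expr0 mul1r.
have A0 := expbd_ge0 IH.
apply: expbd_le (expbd_add IH (expbd_scale m^-1 (expbd_diffs IH))) => //.
rewrite exprS -[leRHS]mulrA [leRHS]mulr_natl mulr2n lerD2l mulrCA ler_piMr//.
have [->|m0] := eqVneq m 0; first by rewrite invr0 normr0 mul0r.
by rewrite normfV mulrC ler_pdivrMr ?normr_gt0// mul1r.
Qed.

(** Each step adds a derivative divided by m, hence an error of order 1/|m|: for large |m|,
    differentiating against exp (m u) amounts to multiplying by m. *)
Lemma expbd_expdiff_sub A X c m j : 0 <= X -> X <= `|m| -> expbd A X c ->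
  expbd (2 ^+ j * A * X / `|m|) X (fun k => expdiff m j c k + c k * (-1)).
Proof.
move=> X0 Xm h; elim: j => [|j IH] /=.
  move=> k; rewrite mulrN1 subrr normr0 mulr_ge0// ?divr_ge0 ?exprn_ge0//.
  by rewrite expr0 mul1r mulr_ge0// (expbd_ge0 h).
have hd := expbd_expdiff j X0 Xm h.
have A0 := expbd_ge0 hd.
have := expbd_add IH (expbd_scale m^-1 (expbd_diffs hd)).
move=> h2 k; have := h2 k.
rewrite addrAC => /le_trans; apply.
rewrite le_eqVlt; apply/orP; left; apply/eqP.
by rewrite exprS normfV; ring.
Qed.

Lemma expbd_power A c t : 0 <= t -> expbd A 1 c -> expbd A t (fun k => c k * t ^+ k).
Proof.
move=> t0 h k; rewrite normrM (ger0_norm (exprn_ge0 _ t0)).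
have := ler_wpM2r (exprn_ge0 k t0) (h k) => /le_trans; apply.
by rewrite expr1n; apply: eq_ler; ring.
Qed.

(** Rescaling the argument by t rescales the rate by t. With t = theta, the differintegrals at rate
    m theta are reduced to series that depend on m alone, evaluated at points that carry theta. *)
Lemma expdiff_scale c m t j k : t != 0 ->
  expdiff (m * t) j (fun i => c i * t ^+ i) k = expdiff m j c k * t ^+ k.
Proof.
move=> t0; elim: j k => [//|j IH] k /=.
rewrite /pseries_diffs !IH exprS.
have [->|m0] := eqVneq m 0; first by rewrite mul0r invr0 !mulr0 !addr0.
by field; rewrite t0 m0.
Qed.

Lemma is_derive_psum_exp A X c m j (u : R) : 0 <= X -> X <= `|m| -> m != 0 ->
  expbd A X c ->
  is_derive u 1 (fun z => psum (expdiff m j c) z * expR (m * z))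
    (m * (psum (expdiff m j.+1 c) u * expR (m * u))).
Proof.
move=> X0 Xm m0 h.
have hd := expbd_expdiff j X0 Xm h.
have h1 := is_derive_psum u X0 hd.
have h2 := is_derive_expRM m u.
have h3 := is_deriveM h1 h2.
apply: is_derive_eq h3 _.
rewrite /= (psumD _ _ X0 hd (expbd_diffs hd)) /GRing.scale/=.
by field.
Qed.

(** The argument is allowed to move with n because Laplace's method evaluates the series at points
    at a distance of order 1/m from the endpoint. *)
Lemma psum_expdiff_cvg A X c j (m w : nat -> R) (u : R) : 0 <= X -> expbd A X c ->
  `|m n| @[n --> \oo] --> +oo -> w n @[n --> \oo] --> u ->
  psum (expdiff (m n) j c) (w n) @[n --> \oo] --> psum c u.
Proof.
move=> X0 h hm hw.
have A0 := expbd_ge0 h.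
have c1 : psum c (w n) @[n --> \oo] --> psum c u.
  by apply: continuous_cvg => //; exact: (continuous_psum X0 h).
rewrite -[psum c u]add0r.
have -> : (fun n => psum (expdiff (m n) j c) (w n)) =
  (fun n => (psum (expdiff (m n) j c) (w n) - psum c (w n)) + psum c (w n)).
  by apply/funext => n; rewrite subrK.
apply: cvgD c1.
have c2 : 2 ^+ j * A * X * expR (X * `|w n|) / `|m n| @[n --> \oo] --> (0 : R).
  rewrite -(mulr0 (2 ^+ j * A * X * expR (X * `|u|))).
  apply: cvgM.
    apply: cvgMl_tmp; apply: continuous_cvg; first exact: continuous_expR.
    by apply: cvgMl_tmp; apply: cvg_norm.
  by apply/gtr0_cvgV0 => //; near=> n; near: n; exact: (cvgry_gt hm).
apply: norm_cvg0.
apply: (@squeeze_cvgr _ _ _ _ (cst 0) _ _ _ _ _ c2); last exact: cvg_cst.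
near=> n; rewrite normr_ge0/=.
have Xm : X <= `|m n| by near: n; exact: (cvgry_ge hm).
have hd := expbd_expdiff j X0 Xm h.
rewrite -[_ - _]/(_ + - _) -[- psum c (w n)]mulrN1 -(psumD _ _ X0 hd h).
apply: le_trans (psum_le X0 (expbd_expdiff_sub j X0 Xm h) _) _.
by rewrite mulrAC.
Unshelve. all: by end_near. Qed.

End ExponentialType.

(** * Right differintegrals of a series times a decaying exponential *)

Section RightDerivative.
Context {R : realType}.
Implicit Types (c : nat -> R) (y z : R).

Lemma RLorder_gt (g : R) : g < (RLorder g)%:R.
Proof. by have := truncnS_gt (g + 1); rewrite -natr1 ltrD2r. Qed.

Lemma derive1n_pos (F : R -> R) (G : nat -> R -> R) :
  (forall z, 0 < z -> F z = G 0%N z) ->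
  (forall j (z : R), 0 < z -> is_derive z 1 (G j) (G j.+1 z)) ->
  forall n z, 0 < z -> derive1n n F z = G n z.
Proof.
move=> F0 dG; elim => [|n IH] z z0; first exact: F0.
rewrite derive1nS derive1E -(is_derive_derive1 (dG n z z0)) derive1E.
apply: near_eq_derive => //; near=> y.
by apply: IH; near: y; exact: lt_nbhsr.
Unshelve. all: by end_near. Qed.

Lemma measurable_shift (z : R) : measurable_fun setT (fun w : R => z + w).
Proof.
apply: continuous_measurable_fun => x; apply: cvgD; [exact: cvg_cst|exact: cvg_id].
Qed.

Section fixed.
Variables (A X r al : R) (c : nat -> R).
Hypotheses (X0 : 0 <= X) (cb : expbd A X c) (Xr : X < r) (al0 : 0 < al).
Let r0 : 0 < r. Proof. exact: le_lt_trans Xr. Qed.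
Let Xr' : X <= `|- r|. Proof. by rewrite normrN gtr0_norm// ltW. Qed.

Lemma measurable_RLright_integrand (z : R) (d : nat -> R) (B : R) : expbd B X d ->
  measurable_fun setT (fun w => w `^ (al - 1) * (psum d (z + w) * expR (- r * (z + w)))).
Proof.
move=> hd; apply: measurable_funM; first exact: measurable_powR.
apply: measurable_funM.
  apply: measurableT_comp; last exact: measurable_shift.
  exact: (measurable_psum X0 hd).
apply: measurableT_comp => //; apply: measurable_funM => //; exact: measurable_shift.
Qed.

(** The rate r exceeds the type X, so the product decays like exp (-(r - X)(z + w)), and the part in
    z is at most 1. *)
Lemma RLright_integrand_le (z w : R) (d : nat -> R) (B : R) : expbd B X d ->
  0 <= z -> 0 < w ->
  `|w `^ (al - 1) * (psum d (z + w) * expR (- r * (z + w)))| <=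
  B * (w `^ (al - 1) * expR (- ((r - X) * w))).
Proof.
move=> hd z0 w0; have B0 := expbd_ge0 hd.
rewrite normrM (ger0_norm (powR_ge0 _ _)) mulrCA ler_wpM2l ?powR_ge0//.
rewrite normrM (ger0_norm (expR_ge0 _)).
apply: le_trans (ler_wpM2r (expR_ge0 _) (psum_le X0 hd _)) _.
rewrite ger0_norm ?addr_ge0 ?(ltW w0)// -mulrA -expRD ler_wpM2l// ler_expR.
have : 0 <= (r - X) * z by rewrite mulr_ge0// subr_ge0 ltW.
by lra.
Qed.

Lemma integrable_RLright_integrand (z : R) (d : nat -> R) (B : R) : expbd B X d ->
  0 <= z ->
  integ `]0, +oo[ (fun w => w `^ (al - 1) * (psum d (z + w) * expR (- r * (z + w)))).
Proof.
move=> hd z0.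
have rX : 0 < r - X by rewrite subr_gt0.
apply: (@integrable_dom _ _ _ (fun w => B * (w `^ (al - 1) * expR (- ((r - X) * w))))) => //.
- by apply: measurable_funTS; exact: measurable_RLright_integrand hd.
- by apply: integrableZ => //; have [] := Gamma_scale al0 rX.
- by move=> w; rewrite /= in_itv/= andbT => w0; exact: RLright_integrand_le.
Qed.

Let W j (z : R) := \int[mu]_(w in `]0, +oo[)
  (w `^ (al - 1) * (psum (expdiff (- r) j c) (z + w) * expR (- r * (z + w)))).

(** In the variable w = y - z neither the singular weight nor the domain depends on z, so the
    derivative falls on the smooth factor only. *)
Lemma is_derive_RLright j (z : R) : 0 < z -> is_derive z 1 (W j) (- r * W j.+1 z).
Proof.
move=> z0.
have rn0 : - r != 0 by rewrite oppr_eq0 gt_eqF.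
have hj := expbd_expdiff j X0 Xr' cb.
have hj1 := expbd_expdiff j.+1 X0 Xr' cb.
have rX : 0 < r - X by rewrite subr_gt0.
pose f (z w : R) := w `^ (al - 1) * (psum (expdiff (- r) j c) (z + w) * expR (- r * (z + w))).
pose df (z w : R) := - r * (w `^ (al - 1) * (psum (expdiff (- r) j.+1 c) (z + w) * expR (- r * (z + w)))).
have D1 := @is_derive_under_integral R `]0, +oo[ f df z 0 (z + 1)
  (fun w => r * (2 ^+ j.+1 * A * (w `^ (al - 1) * expR (- ((r - X) * w))))).
apply: is_derive_eq (D1 _ _ _ _ _ _) _.
- exact: measurable_itv.
- by rewrite z0 /= ltrDl ltr01.
- by move=> x /andP[x0 _]; apply: integrable_RLright_integrand hj _; exact: ltW.
- move=> x w /andP[x0 _]; rewrite /= in_itv/= andbT => w0.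
  have h := is_derive_psum_exp j (1 * x + w) X0 Xr' rn0 cb.
  have h2 := is_deriveZ (w `^ (al - 1)) (is_derive_comp_affine h).
  rewrite (_ : f ^~ w = w `^ (al - 1) \*: (fun z => psum (expdiff (- r) j c) (1 * z + w) * expR (- r * (1 * z + w)))); last first.
    by apply/funext => y; rewrite /f/= mul1r.
  by apply: is_derive_eq h2 _; rewrite /df /GRing.scale/= !mul1r mulrCA.
- apply: integrableZ => //; apply: integrableZ => //.
  by have [] := Gamma_scale al0 rX.
- move=> x w /andP[x0 _]; rewrite /= in_itv/= andbT => w0.
  rewrite /df normrM normrN (gtr0_norm r0) ler_pM2l//.
  by apply: RLright_integrand_le => //; exact: ltW.
- rewrite /df RintegralZl//; apply: integrable_RLright_integrand hj1 _; exact: ltW.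
Qed.

Lemma RLright_integral (f : R -> R) (z : R) : 0 < z ->
  (forall y, 0 < y -> f y = psum c y * expR (- r * y)) ->
  \int[mu]_(y in `]z, +oo[) ((y - z) `^ (al - 1) * f y) = W 0 z.
Proof.
move=> z0 fE.
have E0 : 1 != 0 :> R by rewrite oner_eq0.
pose g (y : R) := (y - z) `^ (al - 1) * (psum c y * expR (- r * y)).
have gE w : g (affine 1 z w) = w `^ (al - 1) * (psum c (z + w) * expR (- r * (z + w))).
  by rewrite /g /affine mul1r addrK (addrC w).
rewrite (eq_Rint (g := g)); last first.
  by move=> y; rewrite /= in_itv/= andbT => zy; rewrite fE// (lt_trans z0).
have := @integral_affine R 1 z `]z, +oo[%classic g E0.
rewrite (affine_itvoy _ _ ltr01) subrr mul0r normr1 mul1r => /(_ _ _ _)[].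
- exact: measurable_itv.
- apply: measurable_funTS; apply: measurable_funM.
    apply: (measurableT_comp (f := fun x => x `^ (al - 1))); first exact: measurable_powR.
    by apply: measurable_funB.
  apply: measurable_funM; first exact: (measurable_psum X0 cb).
  by apply: measurableT_comp => //; exact: measurable_funM.
- apply: integrable_eq (integrable_RLright_integrand cb (ltW z0)) => //.
  by move=> w _; rewrite -gE.
- by move=> _ ->; apply: eq_Rint => w _; rewrite gE.
Qed.

(** The substitution w = v / r makes the exponential weight independent of r and moves r into the
    argument z + v / r, which tends to z. *)
Lemma RLright_rescale (z : R) (d : nat -> R) (B : R) : expbd B X d -> 0 <= z ->
  integ `]0, +oo[ (fun v => v `^ (al - 1) * (expR (- v) * psum d (z + r^-1 * v))) /\
  \int[mu]_(w in `]0, +oo[) (w `^ (al - 1) * (psum d (z + w) * expR (- r * (z + w)))) =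
  r `^ (- al) * expR (- (r * z)) *
  \int[mu]_(v in `]0, +oo[) (v `^ (al - 1) * (expR (- v) * psum d (z + r^-1 * v))).
Proof.
move=> hd z0.
have rV0 : 0 < r^-1 by rewrite invr_gt0.
pose g w := w `^ (al - 1) * (psum d (z + w) * expR (- r * (z + w))).
pose h v := v `^ (al - 1) * (expR (- v) * psum d (z + r^-1 * v)).
have ig := integrable_RLright_integrand hd z0.
pose k := r `^ (1 - al) * expR (- (r * z)).
have k0 : 0 < k by rewrite mulr_gt0 ?powR_gt0 ?expR_gt0.
have gE v : 0 < v -> h v = k^-1 * g (affine r^-1 0 v).
  move=> v0; rewrite /g /h /affine addr0 powRM ?(ltW v0) ?(ltW rV0)//.
  rewrite -powR_inv1 ?(ltW r0)// -powRrM mulN1r opprB.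
  rewrite powR_inv1 ?(ltW r0)// mulrDr mulNr expRD mulNr mulVKf ?gt_eqF//.
  have := powR_gt0 (1 - al) r0; have := expR_gt0 (- (r * z)).
  by rewrite /k => e0 p0; field; rewrite !gt_eqF.
have mh : measurable_fun setT h.
  apply: measurable_funM; first exact: measurable_powR.
  apply: measurable_funM; first by apply: measurableT_comp.
  apply: (measurableT_comp (measurable_psum X0 hd)).
  by apply: measurable_funD => //; apply: measurable_funM.
have mg := measurable_RLright_integrand z hd.
have iga : integ `]0, +oo[ (g \o affine r^-1 0).
  have rn0 : r != 0 by rewrite gt_eqF.
  have := @integral_affine R r 0 `]0, +oo[%classic (g \o affine r^-1 0) rn0.
  rewrite affine_itvoy// subrr mul0r => /(_ _ _ _)[].
  - exact: measurable_itv.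
  - apply: measurable_funTS; apply: (measurableT_comp mg); exact: measurable_affine.
  - apply: integrable_eq ig => //.
    by move=> w _; rewrite /g /affine /= !addr0 mulKf.
  - by [].
have ih : integ `]0, +oo[ h.
  apply: integrable_eq (integrableZ k^-1 _ iga) => //.
  by move=> v; rewrite /= in_itv/= andbT => v0; rewrite gE.
split => //.
have rn0 : r^-1 != 0 by rewrite gt_eqF.
have := @integral_affine R r^-1 0 `]0, +oo[%classic g rn0.
rewrite affine_itvoy// subrr mul0r => /(_ _ _ _)[|||_ ->].
- exact: measurable_itv.
- exact: measurable_funTS.
- exact: iga.
rewrite (eq_Rint (f := h) (g := fun v => k^-1 * (g \o affine r^-1 0) v)); last first.
  by move=> v; rewrite /= in_itv/= andbT => v0; rewrite gE.
rewrite RintegralZl// mulrA; congr (_ * _).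
rewrite (gtr0_norm rV0) /k -powR_inv1 ?(ltW r0)//.
have -> : r `^ (- al) = r `^ (-1) * r `^ (1 - al).
  by rewrite -gt0_powRD// addrA addNr sub0r.
have := powR_gt0 (1 - al) r0; have := expR_gt0 (- (r * z)).
by move=> e0 p0; field; rewrite !gt_eqF.
Qed.

End fixed.

Lemma RLright_exp (A X r g : R) (c : nat -> R) (f : R -> R) (z : R) :
  0 <= X -> expbd A X c -> X < r -> 0 < z ->
  (forall y, 0 < y -> f y = psum c y * expR (- r * y)) ->
  let n := RLorder g in
  RLright g f z = (Gamma (n%:R - g))^-1 * r `^ g * expR (- (r * z)) *
   \int[mu]_(v in `]0, +oo[) (v `^ (n%:R - g - 1) *
      (expR (- v) * psum (expdiff (- r) n c) (z + r^-1 * v))).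
Proof.
move=> X0 cb Xr z0 fE n; rewrite /RLright -/n.
have al0 : 0 < n%:R - g by rewrite subr_gt0 RLorder_gt.
have r0 : 0 < r by exact: le_lt_trans Xr.
have Xr' : X <= `|- r| by rewrite normrN gtr0_norm// ltW.
pose G j (z : R) := (- r) ^+ j * \int[mu]_(w in `]0, +oo[)
  (w `^ (n%:R - g - 1) * (psum (expdiff (- r) j c) (z + w) * expR (- r * (z + w)))).
have dG j (y : R) : 0 < y -> is_derive y 1 (G j) (G j.+1 y).
  move=> y0.
  have h := is_deriveZ ((- r) ^+ j) (is_derive_RLright X0 cb Xr al0 j y0).
  by apply: is_derive_eq h _; rewrite /G /GRing.scale/= exprSr mulrA.
have -> : derive1n n (fun z1 => \int[mu]_(y in `]z1, +oo[)
    ((y - z1) `^ (n%:R - g - 1) * f y)) z = G n z.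
  apply: derive1n_pos => // y y0.
  by rewrite /G expr0 mul1r (RLright_integral X0 cb Xr al0 y0 fE).
rewrite /G.
have [_ ->] := RLright_rescale X0 Xr al0 (expbd_expdiff n X0 Xr' cb) (ltW z0).
rewrite !mulrA; congr (_ * _); congr (_ * _).
(* The n derivatives contribute (-1)^n (-r)^n = r^n and the substitution r^(-(n - g)), together
   r^g. *)
rewrite -!mulrA; congr (_ * _); rewrite mulrA -exprMn mulN1r opprK.
by rewrite -powR_mulrn ?ltW// -gt0_powRD// opprB addrCA subrr addr0.
Qed.

End RightDerivative.

(** * Left differintegrals of a power times a series times a growing exponential *)

Section LeftDerivative.
Context {R : realType}.
Implicit Types (c : nat -> R) (y z : R).

Lemma measurable_onem_powR (q : R) : measurable_fun setT (fun t : R => (1 - t) `^ q).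
Proof.
apply: (measurableT_comp (f := fun x => x `^ q)); first exact: measurable_powR.
by apply: measurable_funB.
Qed.

Lemma integral_onem (f : R -> R) : measurable_fun setT f -> integ `]0, 1[ f ->
  integ `]0, 1[ (fun t => f (1 - t)) /\
  \int[mu]_(t in `]0, 1[) f (1 - t) = \int[mu]_(t in `]0, 1[) f t.
Proof.
move=> mf if_.
have n1 : -1 != 0 :> R by rewrite oppr_eq0 oner_eq0.
have := @integral_affine R (-1) 1 `]0, 1[%classic (fun t => f (1 - t)) n1.
rewrite affine_itvoo_neg// subrr mul0r sub0r divrr ?unitfE// normrN normr1 mul1r.
have E t : 1 - affine (-1) 1 t = t by rewrite /affine mulN1r opprD opprK addrCA subrr addr0.
move=> /(_ _ _ _)[].
- exact: measurable_itv.
- by apply: measurable_funTS; apply: measurableT_comp => //; exact: measurable_funB.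
- by apply: integrable_eq if_ => // t _ /=; rewrite E.
move=> h ->; split => //.
by apply: eq_Rint => t _; rewrite E.
Qed.

Lemma powR_le_itv_half (q : R) : exists2 C : R, 1 <= C & forall t, 2^-1 <= t <= 1 -> t `^ q <= C.
Proof.
exists (1 + 2^-1 `^ q); first by rewrite lerDl powR_ge0.
move=> t /andP[t1 t2].
have t0 : 0 < t by apply: lt_le_trans t1.
have [q0|q0] := leP 0 q.
  apply: (@le_trans _ _ 1); last by rewrite lerDl powR_ge0.
  by rewrite -[leRHS](powRr0 t) ger_powR// t0.
apply: (@le_trans _ _ (2^-1 `^ q)); last by rewrite lerDr.
rewrite -[q]opprK powRN [leRHS]powRN lef_pV2 ?posrE ?powR_gt0//.
by apply: ge0_ler_powR; rewrite ?nnegrE ?(ltW t0)// oppr_ge0 ltW.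
Qed.

Section beta.
Variables (al p : R).
Hypotheses (al0 : 0 < al) (p1 : -1 < p).

Lemma integrable_onem_powR : integ `]0, 1[ (fun t => (1 - t) `^ (al - 1)).
Proof.
have a1 : -1 < al - 1 by rewrite ltrBrDr addNr.
by have [] := integral_onem (measurable_powR (al - 1)) (integrable_powR01 a1).
Qed.

Lemma integrable_beta : integ `]0, 1[ (fun t => (1 - t) `^ (al - 1) * t `^ p).
Proof.
have [C1 C11 h1] := powR_le_itv_half (al - 1).
have [C2 C21 h2] := powR_le_itv_half p.
apply: (@integrable_dom _ _ _ (fun t => C1 * t `^ p + C2 * (1 - t) `^ (al - 1))) => //.
- by apply: measurable_funTS; apply: measurable_funM; [exact: measurable_onem_powR|exact: measurable_powR].
- by apply: integrable_add => //; apply: integrableZ => //; [exact: integrable_powR01|exact: integrable_onem_powR].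
- move=> t; rewrite /= in_itv/= => /andP[t0 t1].
  rewrite ger0_norm ?mulr_ge0 ?powR_ge0//.
  have [th|th] := leP t 2^-1.
    apply: ler_wpDr; first by rewrite mulr_ge0 ?powR_ge0// (le_trans _ C21).
    by rewrite ler_wpM2r ?powR_ge0// h1//; apply/andP; split; lra.
  apply: ler_wpDl; first by rewrite mulr_ge0 ?powR_ge0// (le_trans _ C11).
  by rewrite mulrC ler_wpM2r ?powR_ge0// h2//; apply/andP; split; lra.
Qed.

Lemma measurable_beta_exp (r : R) :
  measurable_fun setT (fun t : R => (1 - t) `^ (al - 1) * (t `^ p * expR (- (r * (1 - t))))).
Proof.
apply: measurable_funM; first exact: measurable_onem_powR.
apply: measurable_funM; first exact: measurable_powR.
apply: measurableT_comp => //; apply: measurableT_comp => //; apply: measurable_funM => //.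
exact: measurable_funB.
Qed.

(** For t <= 1/2 the exponential is at most exp (-r/2), which beats (1 + r)^al by [powR_le_exp] with
    rate 1/2; this gives C3. For t >= 1/2 the power t^p is bounded and a Gamma integral of rate 1 +
    r remains; replacing r by 1 + r costs exp (1 - t) <= e, whence C4. With 1 + r in place of r the
    bound stays finite as r tends to 0. *)
Lemma beta_exp_le : exists2 C : R, 0 < C & forall r : R, 0 <= r ->
  integ `]0, 1[ (fun t => (1 - t) `^ (al - 1) * (t `^ p * expR (- (r * (1 - t))))) /\
  \int[mu]_(t in `]0, 1[) ((1 - t) `^ (al - 1) * (t `^ p * expR (- (r * (1 - t))))) <=
  C * (1 + r) `^ (- al).
Proof.
have [C1 C11 h1] := powR_le_itv_half p.
have [C2 C20 h2] := @powR_le_exp R al 2^-1 (ltW al0) ltac:(by []).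
have C10 : 0 < C1 by exact: lt_le_trans C11.
pose B := \int[mu]_(t in `]0, 1[) ((1 - t) `^ (al - 1) * t `^ p).
have B0 : 0 <= B by apply: Rintegral_ge0 => t _; rewrite mulr_ge0 ?powR_ge0.
pose C3 := expR 2^-1 * C2.
have C30 : 0 < C3 by rewrite mulr_gt0 ?expR_gt0.
pose C4 := C1 * expR 1.
have C40 : 0 < C4 by rewrite mulr_gt0 ?expR_gt0.
exists (C3 * B + C4 * Gamma al).
  by rewrite ltr_wpDl ?mulr_ge0 ?mulr_gt0 ?Gamma_gt0// ltW.
move=> r r0; have r10 : 0 < 1 + r by rewrite ltr_wpDr.
pose g t := C3 * (1 + r) `^ (- al) * ((1 - t) `^ (al - 1) * t `^ p) +
            C4 * ((1 - t) `^ (al - 1) * expR (- ((1 + r) * (1 - t)))).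
have [iG EG] := Gamma_scale al0 r10.
have iG1 : integ `]0, 1[ (fun t => t `^ (al - 1) * expR (- ((1 + r) * t))).
  by apply: integrableS iG => //; apply: subset_itvl; rewrite bnd_simp.
have mG1 : measurable_fun setT (fun t : R => t `^ (al - 1) * expR (- ((1 + r) * t))).
  apply: measurable_funM; first exact: measurable_powR.
  by do 2 apply: measurableT_comp => //.
have [iG2 EG2] := integral_onem mG1 iG1.
have ig : integ `]0, 1[ g.
  by apply: integrable_add => //; apply: integrableZ => //; exact: integrable_beta.
have fg t : `]0, 1[%classic t ->
    `|(1 - t) `^ (al - 1) * (t `^ p * expR (- (r * (1 - t))))| <= g t.
  rewrite /= in_itv/= => /andP[t0 t1].
  rewrite ger0_norm ?mulr_ge0 ?powR_ge0 ?expR_ge0//.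
  have [th|th] := leP t 2^-1.
    apply: ler_wpDr.
      by rewrite !mulr_ge0 ?powR_ge0 ?expR_ge0// ltW.
    rewrite mulrA mulrC ler_wpM2r ?mulr_ge0 ?powR_ge0//.
    rewrite powRN ler_pdivlMr ?powR_gt0// mulrC.
    apply: le_trans (ler_wpM2r (expR_ge0 _) (h2 _ (ltW r10))) _.
    rewrite -mulrA -expRD /C3 mulrC ler_wpM2r ?(ltW C20)// ler_expR.
    have rt : r * t <= r * 2^-1 by rewrite ler_wpM2l.
    by clear -rt; lra.
  apply: ler_wpDl.
    by rewrite !mulr_ge0 ?powR_ge0// ltW.
  rewrite [leRHS]mulrCA ler_wpM2l ?powR_ge0// /C4 -mulrA.
  apply: ler_pM; [exact: powR_ge0|exact: expR_ge0|by apply: h1; rewrite !ltW|].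
  by clear -t0; rewrite -expRD ler_expR; lra.
have mf : measurable_fun (`]0, 1[%classic : set R)
    (fun t => (1 - t) `^ (al - 1) * (t `^ p * expR (- (r * (1 - t))))).
  by apply: measurable_funTS; exact: measurable_beta_exp.
split; first exact: integrable_dom ig fg.
apply: le_trans (ler_norm _) _.
apply: le_trans (normr_Rintegral_dom _ mf ig fg) _ => //.
rewrite /g RintegralD//; last 2 first.
- by apply: integrableZ => //; exact: integrable_beta.
- by apply: integrableZ.
rewrite !RintegralZl//; last exact: integrable_beta.
rewrite -/B EG2 mulrDl lerD//; first by rewrite mulrAC.
rewrite -mulrA ler_wpM2l ?(ltW C40)// mulrC -EG.
have U : `]0, +oo[%classic = `]0, 1[%classic `|` (`]0, +oo[%classic `\` `]0, 1[%classic) :> set R.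
  by rewrite setDUK//; apply: subset_itv; rewrite bnd_simp.
rewrite [X in _ <= \int[mu]_(t in X) _]U Rintegral_setU//.
- rewrite lerDl; apply: Rintegral_ge0 => x _.
  by rewrite mulr_ge0 ?powR_ge0 ?expR_ge0.
- exact: measurableD.
- by rewrite -U.
- by apply/disj_setPS => x /= [? [_]].
Qed.

End beta.

Section fixed.
Variables (A X r al nu : R) (c : nat -> R).
Hypotheses (X0 : 0 <= X) (cb : expbd A X c) (Xr : X <= r) (r0 : 0 < r).
Hypotheses (al0 : 0 < al) (nu1 : -1 < nu).
Let Xr' : X <= `|r|. Proof. by rewrite gtr0_norm// ltW. Qed.
Let nuj1 (j : nat) : -1 < nu + j%:R. Proof. by rewrite ltr_wpDr. Qed.

(** In the variable t = y / z the domain is fixed, and every derivative in z brings down a factor r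
    t; this is why the exponent of t grows with j and why the derivative of the j-th term is r times
    the next one. *)
Definition RLleft_term j (z : R) := \int[mu]_(t in `]0, 1[)
  ((1 - t) `^ (al - 1) * (t `^ (nu + j%:R) * (psum (expdiff r j c) (z * t) * expR (r * (z * t))))).

Lemma measurable_RLleft_integrand (z p : R) (d : nat -> R) (B : R) : expbd B X d ->
  measurable_fun setT (fun t : R => (1 - t) `^ (al - 1) *
     (t `^ p * (psum d (z * t) * expR (r * (z * t))))).
Proof.
move=> hd; apply: measurable_funM; first exact: measurable_onem_powR.
apply: measurable_funM; first exact: measurable_powR.
apply: measurable_funM.
  by apply: (measurableT_comp (measurable_psum X0 hd)); exact: measurable_funM.
by apply: measurableT_comp => //; apply: measurable_funM => //; exact: measurable_funM.
Qed.

Lemma RLleft_integrand_le (z p t : R) (d : nat -> R) (B : R) : expbd B X d ->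
  0 <= z -> 0 < t < 1 ->
  `|(1 - t) `^ (al - 1) * (t `^ p * (psum d (z * t) * expR (r * (z * t))))| <=
  B * expR ((X + r) * z) * ((1 - t) `^ (al - 1) * t `^ p).
Proof.
move=> hd z0 /andP[t0 t1]; have B0 := expbd_ge0 hd.
rewrite mulrA normrM [X in X * _]ger0_norm ?mulr_ge0 ?powR_ge0// mulrC.
rewrite ler_wpM2r ?mulr_ge0 ?powR_ge0//.
rewrite normrM (ger0_norm (expR_ge0 _)).
apply: le_trans (ler_wpM2r (expR_ge0 _) (psum_le X0 hd _)) _.
rewrite -mulrA -expRD ler_wpM2l// ler_expR ger0_norm; last by rewrite mulr_ge0// ltW.
rewrite -mulrDl ler_wpM2l//; first by rewrite addr_ge0// ltW.
by rewrite ler_piMr// ltW.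
Qed.

Lemma integrable_RLleft_integrand (z p : R) (d : nat -> R) (B : R) : expbd B X d ->
  -1 < p -> 0 <= z ->
  integ `]0, 1[ (fun t => (1 - t) `^ (al - 1) *
     (t `^ p * (psum d (z * t) * expR (r * (z * t))))).
Proof.
move=> hd p1 z0.
apply: (@integrable_dom _ _ _ (fun t => B * expR ((X + r) * z) * ((1 - t) `^ (al - 1) * t `^ p))) => //.
- by apply: measurable_funTS; exact: measurable_RLleft_integrand hd.
- by apply: integrableZ => //; exact: integrable_beta.
- by move=> t; rewrite /= in_itv/= => t01; exact: RLleft_integrand_le.
Qed.

Lemma is_derive_RLleft_term j (z : R) : 0 < z ->
  is_derive z 1 (RLleft_term j) (r * RLleft_term j.+1 z).
Proof.
move=> z0.
have rn0 : r != 0 by rewrite gt_eqF.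
have hj := expbd_expdiff j X0 Xr' cb.
have hj1 := expbd_expdiff j.+1 X0 Xr' cb.
have B0 := expbd_ge0 hj1.
pose f (z t : R) := (1 - t) `^ (al - 1) * (t `^ (nu + j%:R) *
  (psum (expdiff r j c) (z * t) * expR (r * (z * t)))).
pose df (z t : R) := r * ((1 - t) `^ (al - 1) * (t `^ (nu + j.+1%:R) *
  (psum (expdiff r j.+1 c) (z * t) * expR (r * (z * t))))).
have D1 := @is_derive_under_integral R `]0, 1[ f df z 0 (z + 1)
  (fun t => r * (2 ^+ j.+1 * A * expR ((X + r) * (z + 1)) * ((1 - t) `^ (al - 1) * t `^ (nu + j.+1%:R)))).
apply: is_derive_eq (D1 _ _ _ _ _ _) _.
- exact: measurable_itv.
- by rewrite z0 /= ltrDl ltr01.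
- by move=> x /andP[x0 _]; apply: integrable_RLleft_integrand hj _ _ => //; exact: ltW.
- move=> x t /andP[x0 _]; rewrite /= in_itv/= => /andP[t0 t1].
  have h := is_derive_psum_exp j (t * x + 0) X0 Xr' rn0 cb.
  have h2 := is_deriveZ ((1 - t) `^ (al - 1) * t `^ (nu + j%:R)) (is_derive_comp_affine h).
  rewrite (_ : f ^~ t = ((1 - t) `^ (al - 1) * t `^ (nu + j%:R)) \*:
      (fun z => psum (expdiff r j c) (t * z + 0) * expR (r * (t * z + 0)))); last first.
    by apply/funext => y; rewrite /f/= addr0 [t * y]mulrC mulrA.
  apply: is_derive_eq h2 _; rewrite /df /GRing.scale/= addr0 [t * x]mulrC.
  have -> : t `^ (nu + j.+1%:R) = t `^ (nu + j%:R) * t.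
    by rewrite -natr1 addrA (gt0_powRD _ 1 t0) powRr1// ltW.
  by ring.
- by apply: integrableZ => //; apply: integrableZ => //; exact: integrable_beta.
- move=> x t /andP[x0 xz]; rewrite /= in_itv/= => t01.
  rewrite /df normrM (gtr0_norm r0) ler_pM2l//.
  apply: le_trans (RLleft_integrand_le _ hj1 (ltW x0) t01) _.
  rewrite ler_wpM2r ?mulr_ge0 ?powR_ge0// ler_wpM2l// ler_expR.
  by rewrite ler_wpM2l ?(ltW xz)// addr_ge0// ltW.
- by rewrite /df RintegralZl//; apply: integrable_RLleft_integrand hj1 _ _ => //; exact: ltW.
Qed.

Lemma RLleft_integral (f : R -> R) (z : R) : 0 < z ->
  (forall y, 0 < y -> f y = y `^ nu * (psum c y * expR (r * y))) ->
  \int[mu]_(y in `]0, z[) ((z - y) `^ (al - 1) * f y) = z `^ (al + nu) * RLleft_term 0 z.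
Proof.
move=> z0 fE.
have E0 : z != 0 :> R by rewrite gt_eqF.
pose g (y : R) := (z - y) `^ (al - 1) * (y `^ nu * (psum c y * expR (r * y))).
pose h (t : R) := (1 - t) `^ (al - 1) * (t `^ (nu + 0%:R) * (psum c (z * t) * expR (r * (z * t)))).
have ih : integ `]0, 1[ h by apply: integrable_RLleft_integrand cb _ _ => //; exact: ltW.
have gE t : 0 < t < 1 -> g (affine z 0 t) = z `^ (al - 1 + nu) * h t.
  move=> /andP[t0 t1]; rewrite /g /h /affine !addr0 -[X in (X - _)]mulr1 -mulrBr.
  by rewrite (gt0_powRD _ _ z0) !powRM ?(ltW t0) ?(ltW z0) ?subr_ge0 ?(ltW t1)//; ring.
rewrite (eq_Rint (g := g)); last first.
  by move=> y; rewrite /= in_itv/= => /andP[y0 _]; rewrite fE.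
have := @integral_affine R z 0 `]0, z[%classic g E0.
rewrite affine_itvoo// !subr0 mul0r divff// gtr0_norm// => /(_ _ _ _)[].
- exact: measurable_itv.
- apply: measurable_funTS; apply: measurable_funM.
    apply: (measurableT_comp (f := fun x => x `^ (al - 1))); first exact: measurable_powR.
    by apply: measurable_funB.
  apply: measurable_funM; first exact: measurable_powR.
  apply: measurable_funM; first exact: (measurable_psum X0 cb).
  by apply: measurableT_comp => //; exact: measurable_funM.
- apply: integrable_eq (integrableZ (z `^ (al - 1 + nu)) _ ih) => //.
  by move=> t; rewrite /= in_itv/= => t01; rewrite gE.
move=> _ ->.
rewrite (eq_Rint (g := fun t => z `^ (al - 1 + nu) * h t)); last first.
  by move=> t; rewrite /= in_itv/= => t01; rewrite gE.
rewrite RintegralZl// mulrA; congr (_ * _).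
by rewrite -{1}(powRr1 (ltW z0)) -gt0_powRD//; congr (_ `^ _); ring.
Qed.

End fixed.

(* The coefficients of
   [(d/dz)^n (z^q L_0(z)) = \sum_j RLcoef q n j z^(q-n+j) r^j L_j(z)]
   when [L_j' = r L_(j+1)]. *)
Fixpoint RLcoef (q : R) (n : nat) : nat -> R :=
  if n is n'.+1 then fun j => (q - n'%:R + j%:R) * RLcoef q n' j +
                              (if j is j'.+1 then RLcoef q n' j' else 0)
  else fun j => (j == 0%N)%:R.

Lemma RLcoef_gt q n j : (n < j)%N -> RLcoef q n j = 0.
Proof.
elim: n j => [|n IH] [|j]//= nj.
by rewrite !IH ?mulr0 ?addr0// ltnW.
Qed.

Lemma RLcoef_diag q n : RLcoef q n n = 1.
Proof. by elim: n => [|n IH] //=; rewrite IH RLcoef_gt// mulr0 add0r. Qed.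

Lemma is_derive_powR_sum (q r : R) (L : nat -> R -> R) (n : nat) (z : R) : 0 < z ->
  (forall j, is_derive z 1 (L j) (r * L j.+1 z)) ->
  is_derive z 1
    (fun y => \sum_(j < n.+1) RLcoef q n j * (y `^ (q - n%:R + j%:R) * (r ^+ j * L j y)))
    (\sum_(j < n.+2) RLcoef q n.+1 j * (z `^ (q - n.+1%:R + j%:R) * (r ^+ j * L j z))).
Proof.
move=> z0 dL.
pose d (j : nat) := RLcoef q n j * ((q - n%:R + j%:R) * z `^ (q - n%:R + j%:R - 1) * (r ^+ j * L j z)
  + z `^ (q - n%:R + j%:R) * (r ^+ j.+1 * L j.+1 z)).
have D (j : 'I_n.+1) : is_derive z 1
   (fun y => RLcoef q n j * (y `^ (q - n%:R + j%:R) * (r ^+ j * L j y))) (d j).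
  have h1 := is_derive1_powR (q - n%:R + j%:R) z0.
  have h2 := is_deriveZ (r ^+ j) (dL j).
  have h3 := is_deriveZ (RLcoef q n j) (is_deriveM h1 h2).
  apply: is_derive_eq h3 _; rewrite /d exprS.
  change (RLcoef q n j * (z `^ (q - n%:R + j%:R) * (r ^+ j * (r * L j.+1 z)) +
    (r ^+ j * L j z) * ((q - n%:R + j%:R) * z `^ (q - n%:R + j%:R - 1))) =
    RLcoef q n j * ((q - n%:R + j%:R) * z `^ (q - n%:R + j%:R - 1) * (r ^+ j * L j z)
     + z `^ (q - n%:R + j%:R) * (r * r ^+ j * L j.+1 z))).
  by ring.
have := is_derive_sum D.
rewrite (_ : \sum_(i < n.+1) _ = (fun y => \sum_(j < n.+1) RLcoef q n j * (y `^ (q - n%:R + j%:R) * (r ^+ j * L j y)))); last first.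
  by apply/funext => y; rewrite fct_sumE.
move=> h; apply: is_derive_eq h _.
rewrite /d; under eq_bigr do rewrite mulrDr.
rewrite big_split/=.
under [RHS]eq_bigr do rewrite mulrDl.
rewrite [RHS]big_split/=; congr (_ + _).
  rewrite [RHS]big_ord_recr/= RLcoef_gt// mulr0 mul0r addr0.
  apply: eq_bigr => i _.
  rewrite (_ : q - n.+1%:R + i%:R = q - n%:R + i%:R - 1); last by rewrite -natr1; ring.
  by ring.
rewrite [RHS]big_ord_recl/= mul0r add0r; apply: eq_bigr => i _.
rewrite (_ : bump 0 i = i.+1)//=.
by congr (_ * (_ `^ _ * _)); rewrite -!natr1; ring.
Qed.

Lemma RLleft_exp (A X r g nu : R) (c : nat -> R) (f : R -> R) :
  0 <= X -> expbd A X c -> X <= r -> 0 < r -> -1 < nu ->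
  (forall y, 0 < y -> f y = y `^ nu * (psum c y * expR (r * y))) ->
  let n := RLorder g in let al := n%:R - g in
  RLleft g f 1 = (Gamma al)^-1 *
    \sum_(j < n.+1) RLcoef (al + nu) n j * (r ^+ j * RLleft_term r al nu c j 1).
Proof.
move=> X0 cb Xr r0 nu1 fE n al; rewrite /RLleft -/n -/al.
have al0 : 0 < al by rewrite subr_gt0 RLorder_gt.
pose L := RLleft_term r al nu c.
pose G m (z : R) := \sum_(j < m.+1) RLcoef (al + nu) m j *
  (z `^ (al + nu - m%:R + j%:R) * (r ^+ j * L j z)).
congr (_ * _).
have dG j (y : R) : 0 < y -> is_derive y 1 (G j) (G j.+1 y).
  move=> y0; apply: is_derive_powR_sum => // i.
  exact: (is_derive_RLleft_term X0 cb Xr r0 al0 nu1 i y0).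
have -> : derive1n n (fun z => \int[mu]_(y in `]0, z[)
    ((z - y) `^ (al - 1) * f y)) 1 = G n 1.
  apply: derive1n_pos => // y y0.
  rewrite /G big_ord1/= mul1r expr0 mul1r !subr0 addr0.
  by rewrite (RLleft_integral X0 cb r0 al0 nu1 y0 fE).
by apply: eq_bigr => j _; rewrite powR1 mul1r.
Qed.

End LeftDerivative.

(** * The Bessel series and its right differintegrals *)

Section BesselSeries.
Context {R : realType}.
Variable nu : R.
Hypothesis nu1 : -1 < nu.

Definition besselc (k : nat) : R := (-1) ^+ k / (k`!%:R * Gamma (k%:R + nu + 1)).

Definition besselcx (x : R) (k : nat) : R := besselc k * x ^+ k.

Lemma Gamma_besselc_gt0 (k : nat) : 0 < Gamma (k%:R + nu + 1).
Proof. by apply: Gamma_gt0; rewrite -addrA ltr_wpDl// -ltrBlDr sub0r. Qed.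

Lemma expbd_besselc (X : R) : 0 < X -> exists A, expbd A X besselc.
Proof.
move=> X0; have [C C0 h] := invGamma_le nu1 X0.
exists C => k; rewrite /besselc normrM normrX normrN1 expr1n mul1r normfV normrM.
rewrite ger0_norm// (gtr0_norm (Gamma_besselc_gt0 k)) invfM mulrA mulrC.
by rewrite ler_wpM2r ?invr_ge0.
Qed.

Lemma expbd_besselcx (x X : R) : 0 < x -> 0 < X -> exists A, expbd A X (besselcx x).
Proof.
move=> x0 X0; have [A h] := expbd_besselc (divr_gt0 X0 x0).
exists A => k; rewrite /besselcx normrM (gtr0_norm (exprn_gt0 k x0)).
apply: le_trans (ler_wpM2r (exprn_ge0 k (ltW x0)) (h k)) _.
rewrite expr_div_n -!mulrA ler_wpM2l ?(expbd_ge0 h)// le_eqVlt; apply/orP; left; apply/eqP.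
have : x ^+ k != 0 by rewrite expf_neq0// gt_eqF.
have : k`!%:R != 0 :> R by rewrite pnatr_eq0 -lt0n fact_gt0.
move: (x ^+ k) (X ^+ k) k`!%:R => u v w u0 w0.
by field; rewrite u0 w0.
Qed.

(* [besselJ nu (2 sqrt u) = u^(nu/2) besselG u], with [besselG] entire of
   exponential type [e] for every [e > 0]. *)
Definition besselG (u : R) : R := psum besselc u.

Lemma psum_besselcx (x u : R) : psum (besselcx x) u = besselG (x * u).
Proof. exact: psum_scale. Qed.

Lemma besselJE (z : R) : 0 < z -> besselJ nu z = (z / 2) `^ nu * besselG ((z / 2) ^+ 2).
Proof.
move=> z0; have z20 : 0 < z / 2 by rewrite divr_gt0.
have [A h] := expbd_besselc (@ltr01 R).
apply/cvg_lim => //.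
rewrite (_ : series _ = (fun n => (z / 2) `^ nu * pseries besselc ((z / 2) ^+ 2) n)).
  by apply: cvgMl_tmp; exact: (psum_cvg (@ler01 R) h).
apply/funext => n; rewrite /pseries /series/= mulr_sumr; apply: eq_bigr => k _.
rewrite (gt0_powRD _ nu z20) powR_mulrn ?(ltW z20)// -mul2n exprM /besselc.
by rewrite [RHS]mulrC -[RHS]mulrA.
Qed.

Lemma besselJ_sqrt (u : R) : 0 < u -> besselJ nu (2 * Num.sqrt u) = u `^ (nu / 2) * besselG u.
Proof.
move=> u0; have su : 0 < Num.sqrt u by rewrite sqrtr_gt0.
rewrite besselJE ?mulr_gt0// mulrAC divff// mul1r sqr_sqrtr ?ltW//.
by rewrite -powR12_sqrt ?ltW// -powRrM [2^-1 * nu]mulrC.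
Qed.

Lemma measurable_besselG : measurable_fun setT besselG.
Proof. by have [A h] := expbd_besselc (@ltr01 R); exact: (measurable_psum ler01 h). Qed.

Section Jhat_red.
Variable g : R.
Local Notation n := (RLorder g).
Local Notation al := ((RLorder g)%:R - g).

Lemma RLorder_sub_gt0 : 0 < al.
Proof. by rewrite subr_gt0 RLorder_gt. Qed.

(* [JhatD nu g] without the factor that carries its growth, for [m = - 2 s]; similarly
   [JhatI_red] and [Jtilde_red] (with [m = 2 s]) below. *)
Definition Jhat_red (m x u : R) : R := (Gamma al)^-1 *
  \int[mu]_(v in `]0, +oo[)
    (v `^ (al - 1) * (expR (- v) * psum (expdiff (- m) n (besselcx x)) (u + m^-1 * v))).

Lemma JhatDE (theta xi x s m : R) : 0 < theta -> 0 < xi -> 0 < x ->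
  1 < m -> m = - (2 * s) ->
  JhatD nu g theta xi x s =
  (m * theta) `^ g * expR (- (m * theta * xi)) * Jhat_red m x (theta * xi).
Proof.
move=> t0 xi0 x0 m1 mE; have m0 : 0 < m by apply: lt_trans m1.
have [A h] := expbd_besselcx x0 (@ltr01 R).
(* A bound of type 1 scales to type theta, which stays below the rate m theta for all theta at once
   as soon as m > 1. *)
have hr : expbd A theta (fun k => besselcx x k * theta ^+ k) by apply: expbd_power => //; exact: ltW.
have tr : theta < m * theta by rewrite ltr_pMl.
rewrite /JhatD (RLright_exp g (ltW t0) hr tr xi0); last first.
  move=> y y0; rewrite /Jhat; have u0 : 0 < theta * y * x by rewrite !mulr_gt0.
  (* The prefactor of [Jhat] cancels the fractional power in J_nu and leaves an entire function. *)
  rewrite besselJ_sqrt// mulrA -(gt0_powRD _ _ u0) addNr powRr0 mul1r.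
  rewrite psum_scale psum_besselcx; congr (besselG _ * expR _); first by ring.
  by rewrite mE; ring.
rewrite /Jhat_red [RHS]mulrCA -!mulrA; congr (_ * (_ * (_ * _))).
apply: eq_Rint => v _; congr (_ * (_ * _)).
rewrite -mulNr (_ : expdiff _ _ _ = (fun k => expdiff (- m) n (besselcx x) k * theta ^+ k)); last first.
  by apply/funext => k; rewrite expdiff_scale// gt_eqF.
by rewrite psum_scale; congr (psum _ _); field; rewrite !gt_eqF.
Qed.

Lemma measurable_Jhat_red_integrand (m x : R) : 0 < x -> 1 <= m ->
  measurable_fun setT (fun p : R * R =>
    p.2 `^ (al - 1) * (expR (- p.2) * psum (expdiff (- m) n (besselcx x)) (p.1 + m^-1 * p.2))).
Proof.
move=> x0 m1; have [A h] := expbd_besselcx x0 (@ltr01 R).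
have hd : expbd (2 ^+ n * A) 1 (expdiff (- m) n (besselcx x)).
  by apply: expbd_expdiff => //; rewrite normrN ger0_norm// (le_trans _ m1).
apply: measurable_funM.
  apply: (measurableT_comp (f := fun v => v `^ (al - 1))); first exact: measurable_powR.
  exact: measurable_snd.
apply: measurable_funM.
  by apply: measurableT_comp => //; apply: measurableT_comp.
apply: (measurableT_comp (measurable_psum ler01 hd)).
by apply: measurable_funD => //; exact: measurable_funM.
Qed.

Lemma measurable_Jhat_red (m x : R) : 0 < x -> 1 <= m -> measurable_fun setT (Jhat_red m x).
Proof.
move=> x0 m1; apply: measurable_funM => //.
exact: (@measurable_Rintegral_param R `]0, +oo[%classic _ _ (measurable_Jhat_red_integrand x0 m1)).
Qed.

(** From m >= 2 on, the growth exp (v/m) of the series uses up at most half of the decay exp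
    (-v). *)
Lemma Jhat_red_integrand_le (x : R) : 0 < x -> exists2 C, 0 < C & forall m u v : R,
  2 <= m -> 0 <= u -> 0 < v ->
  `|v `^ (al - 1) * (expR (- v) * psum (expdiff (- m) n (besselcx x)) (u + m^-1 * v))| <=
  C * expR u * (v `^ (al - 1) * expR (- (2^-1 * v))).
Proof.
move=> x0; have [A h] := expbd_besselcx x0 (@ltr01 R).
have A0 := expbd_ge0 h.
exists (2 ^+ n * A + 1).
  by rewrite ltr_wpDl// mulr_ge0// exprn_ge0.
move=> m u v m2 u0 v0; have m0 : 0 < m by apply: lt_le_trans m2.
have hd : expbd (2 ^+ n * A) 1 (expdiff (- m) n (besselcx x)).
  by apply: expbd_expdiff => //; rewrite normrN ger0_norm; lra.
rewrite normrM (ger0_norm (powR_ge0 _ _)) [leRHS]mulrCA ler_wpM2l ?powR_ge0//.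
rewrite normrM (ger0_norm (expR_ge0 _)) mulrC.
apply: le_trans (ler_wpM2r (expR_ge0 _) (psum_le ler01 hd _)) _.
have uv0 : 0 <= u + m^-1 * v by rewrite addr_ge0// mulr_ge0 ?invr_ge0 ?ltW.
rewrite mul1r (ger0_norm uv0) -[leLHS]mulrA -expRD -[leRHS]mulrA -expRD.
apply: ler_pM; rewrite ?expR_ge0 ?mulr_ge0 ?exprn_ge0//.
  by rewrite lerDl.
rewrite ler_expR.
have : m^-1 * v <= 2^-1 * v by rewrite ler_wpM2r ?(ltW v0)// lef_pV2 ?posrE.
by lra.
Qed.

Lemma Jhat_red_le (x : R) : 0 < x -> exists2 C, 0 < C & forall m u : R,
  2 <= m -> 0 <= u -> `|Jhat_red m x u| <= C * expR u.
Proof.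
move=> x0; have [C C0 hC] := Jhat_red_integrand_le x0.
have al0 := RLorder_sub_gt0.
have [iG EG] := Gamma_scale al0 (ltac:(by []) : 0 < 2^-1 :> R).
pose B := \int[mu]_(v in `]0, +oo[) (v `^ (al - 1) * expR (- (2^-1 * v))).
have B0 : 0 <= B by apply: Rintegral_ge0 => v _; rewrite mulr_ge0 ?powR_ge0 ?expR_ge0.
have G0 := Gamma_gt0 al0.
exists ((Gamma al)^-1 * C * (B + 1)); first by rewrite !mulr_gt0 ?invr_gt0// ltr_wpDl.
move=> m u m2 u0; have m1 : 1 <= m by apply: le_trans m2; rewrite ler1n.
rewrite /Jhat_red normrM [`|_^-1|]gtr0_norm ?invr_gt0// -!mulrA ler_wpM2l ?invr_ge0 ?(ltW G0)//.
apply: le_trans (@normr_Rintegral_dom _ _ _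
  (fun v => C * expR u * (v `^ (al - 1) * expR (- (2^-1 * v)))) _ _ _ _) _ => //.
- apply: measurable_funTS.
  apply: (measurableT_comp (measurable_Jhat_red_integrand x0 m1) (measurable_pair1 u)).
- by apply: integrableZ.
- by move=> v; rewrite /= in_itv/= andbT => v0; exact: hC.
rewrite RintegralZl// -/B mulrAC -mulrA ler_wpM2l ?(ltW C0)// ler_wpM2r ?expR_ge0//.
by rewrite lerDl.
Qed.

(** The integrand tends to a constant multiple of the Gamma density, whose integral cancels the
    prefactor 1/Gamma. The point [w i] moves because the inner integral over xi needs it at theta +
    v/m. *)
Lemma Jhat_red_cvg (x u : R) (m w : nat -> R) : 0 < x ->
  m i @[i --> \oo] --> +oo -> w i @[i --> \oo] --> u -> (forall i, 0 <= w i) ->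
  Jhat_red (m i) x (w i) @[i --> \oo] --> besselG (x * u).
Proof.
move=> x0 hm hw w0; have [C C0 hC] := Jhat_red_integrand_le x0.
have [A h] := expbd_besselcx x0 (@ltr01 R).
have al0 := RLorder_sub_gt0.
have [iG EG] := Gamma_scale al0 (ltac:(by []) : 0 < 2^-1 :> R).
have hmV : (m i)^-1 @[i --> \oo] --> (0 : R).
  by apply/gtr0_cvgV0 => //; near=> i; near: i; exact: (cvgry_gt hm).
pose f_ i v := v `^ (al - 1) * (expR (- v) * psum (expdiff (- m i) n (besselcx x)) (w i + (m i)^-1 * v)).
pose f v := v `^ (al - 1) * (expR (- v) * psum (besselcx x) u).
have mD : measurable (`]0, +oo[%classic : set R) by exact: measurable_itv.
have H1 : \forall i \near \oo, measurable_fun (`]0, +oo[%classic : set R) (f_ i).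
  near=> i; have m1 : 1 <= m i by near: i; exact: (cvgry_ge hm).
  apply: measurable_funTS.
  exact: (measurableT_comp (measurable_Jhat_red_integrand x0 m1) (measurable_pair1 (w i))).
have H2 v : `]0, +oo[%classic v -> f_ i v @[i --> \oo] --> f v.
  move=> _; apply: cvgMl_tmp; apply: cvgMl_tmp.
  apply: (psum_expdiff_cvg n ler01 h).
    rewrite (_ : (fun i => `|- m i|) = (fun i => `|m i|)); last by apply/funext => i; rewrite normrN.
    by apply: ger_cvgy hm; near=> i; exact: ler_norm.
  rewrite -[u]addr0 -(mul0r v); apply: cvgD => //; exact: cvgMr_tmp.
have H3 := integrableZ (C * expR (u + 1)) mD iG.
have H4 : \forall i \near \oo, forall v, `]0, +oo[%classic v ->
    `|f_ i v| <= C * expR (u + 1) * (v `^ (al - 1) * expR (- (2^-1 * v))).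
  near=> i => v; rewrite /= in_itv/= andbT => v0.
  apply: le_trans (hC _ _ _ _ (w0 i) v0) _.
    by near: i; exact: (cvgry_ge hm).
  rewrite ler_wpM2r ?mulr_ge0 ?powR_ge0 ?expR_ge0// ler_wpM2l ?(ltW C0)// ler_expR.
  near: i; apply: (cvgr_le u) => //; by rewrite ltrDl.
have [_ H] := Rintegral_dominated_cvg mD H1 H2 H3 H4.
rewrite -psum_besselcx -[X in _ --> X](mulKf (lt0r_neq0 (Gamma_gt0 al0))).
rewrite /Jhat_red; apply: cvgMl_tmp.
move: H; rewrite (eq_Rint (f := f)
    (g := fun v => psum (besselcx x) u * (v `^ (al - 1) * expR (- v)))); last first.
  by move=> v _; rewrite /f; ring.
rewrite RintegralZl//; last exact: integrable_Gamma.
by rewrite [Gamma _ * _]mulrC.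
Unshelve. all: by end_near. Qed.

End Jhat_red.

End BesselSeries.

(** * The inner integral over xi *)

Section InnerIntegral.
Context {R : realType}.
Variables nu kappa : R.
Hypotheses (nu1 : -1 < nu) (kappa_lt : kappa < 2 * (nu + 1)).
Local Notation a := (nu - kappa / 2).
Local Notation b := (nu - kappa).

Let a1 : -1 < a. Proof. by have := kappa_lt; lra. Qed.

(** 1 + v/r is (1 + r)/r times (r + v)/(1 + r), and the latter is a weighted mean of 1 and v. It is
    therefore at most 1 + v, which serves for q >= 0, and at least min (1, v), which gives the bound
    1 + v^q for q < 0. For -1 < q the function v^q is integrable at 0. *)
Lemma powR_shift_le (q : R) : -1 < q -> exists K : R -> R,
  [/\ measurable_fun setT K, forall v, 0 <= K v,
      integ `]0, +oo[ (fun v => K v * expR (- (2^-1 * v))) &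
      forall r v : R, 0 < r -> 0 < v -> (1 + v / r) `^ q <= ((1 + r) / r) `^ q * K v].
Proof.
move=> q1.
have E (r v : R) : 0 < r -> 0 < v ->
    (1 + v / r) `^ q = ((1 + r) / r) `^ q * ((r + v) / (1 + r)) `^ q.
  move=> r0 v0; rewrite -powRM ?divr_ge0 ?addr_ge0 ?ltW//.
  by congr (_ `^ q); field; rewrite !gt_eqF// addr_gt0.
have h20 : 0 < 2^-1 :> R by [].
have [q0|q0] := leP 0 q.
- exists (fun v => (1 + `|v|) `^ q); split.
  + apply: (measurableT_comp (f := fun x : R => x `^ q)); first exact: measurable_powR.
    by apply: measurable_funD.
  + by move=> v; rewrite powR_ge0.
  + have [C C0 hC] := @powR_le_exp R q 4^-1 q0 ltac:(by []).
    have h40 : 0 < 4^-1 :> R by [].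
    apply: (@integrable_dom _ _ _ (fun v => C * expR 4^-1 * expR (- (4^-1 * v)))) => //.
    * apply: measurable_funTS; apply: measurable_funM; last by do 2 apply: measurableT_comp => //.
      apply: (measurableT_comp (f := fun x : R => x `^ q)); first exact: measurable_powR.
      by apply: measurable_funD.
    * by apply: integrableZ => //; exact: integrable_expR_itv0y.
    * move=> v; rewrite /= in_itv/= andbT => v0.
      rewrite ger0_norm ?mulr_ge0 ?powR_ge0 ?expR_ge0// (gtr0_norm v0).
      have v10 : 0 <= 1 + v by rewrite addr_ge0// ltW.
      apply: le_trans (ler_wpM2r (expR_ge0 _) (hC _ v10)) _.
      rewrite -[leLHS]mulrA -[leRHS]mulrA -!expRD ler_wpM2l ?(ltW C0)// ler_expR; lra.
  + move=> r v r0 v0; rewrite E// ler_wpM2l ?powR_ge0// (gtr0_norm v0).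
    have r10 : 0 < 1 + r by rewrite addr_gt0.
    apply: ge0_ler_powR => //; rewrite ?nnegrE ?divr_ge0 ?addr_ge0 ?(ltW r0) ?(ltW v0)//.
    rewrite ler_pdivrMr//.
    have : 0 < v * r by rewrite mulr_gt0.
    by lra.
- exists (fun v => 1 + v `^ q); split.
  + by apply: measurable_funD => //; exact: measurable_powR.
  + by move=> v; rewrite addr_ge0// powR_ge0.
  + have q10 : 0 < q + 1 by lra.
    have [i1 _] := Gamma_scale q10 h20.
    have i2 := @integrable_expR_itv0y R 2^-1 h20.
    apply: integrable_eq (integrable_add _ i2 i1) => //.
    by move=> v _; rewrite addrK mulrDl mul1r.
  + move=> r v r0 v0; rewrite E// ler_wpM2l ?powR_ge0//.
    have r10 : 0 < 1 + r by rewrite addr_gt0.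
    have pos : 0 < (r + v) / (1 + r) by rewrite divr_gt0// addr_gt0.
    have [v1|v1] := leP 1 v.
      apply: (@le_trans _ _ 1); last by rewrite lerDl powR_ge0.
      rewrite -[leRHS](powRr0 ((r + v) / (1 + r))) ler_powR//; last exact: ltW.
      by rewrite ler_pdivlMr//; lra.
    apply: (@le_trans _ _ (v `^ q)); last by rewrite lerDr.
    rewrite -[q]opprK powRN [leRHS]powRN lef_pV2 ?posrE ?powR_gt0//.
    apply: ge0_ler_powR; rewrite ?nnegrE ?(ltW v0) ?(ltW pos)// ?oppr_ge0 ?(ltW q0)//.
    rewrite ler_pdivlMr//.
    have : 0 <= r * (1 - v) by rewrite mulr_ge0 ?ltW ?subr_gt0.
    by lra.
Qed.

Lemma cvg_powR (q l : R) (u : nat -> R) : 0 < l ->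
  u i @[i --> \oo] --> l -> u i `^ q @[i --> \oo] --> l `^ q.
Proof.
move=> l0 ul; apply: (@cvg_comp _ _ _ u (fun z => z `^ q) _ _ _ ul).
exact: (is_derive_continuous (is_derive1_powR q l0)).
Qed.

(** The integral left after the substitution xi = 1 + v / (m theta). The inverse is written as a
    power because the measurability in theta is obtained from that of powers. *)
Definition JhatI_red (m x theta : R) : R := \int[mu]_(v in `]0, +oo[)
  ((1 + v * (m * theta) `^ (-1)) `^ a *
   (expR (- v) * Jhat_red nu (b + 1) m x (theta + m^-1 * v))).

Lemma measurable_JhatI_red_integrand (m x : R) : 0 < x -> 1 <= m ->
  measurable_fun setT (fun p : R * R =>
   (1 + p.2 * (m * p.1) `^ (-1)) `^ a *
   (expR (- p.2) * Jhat_red nu (b + 1) m x (p.1 + m^-1 * p.2))).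
Proof.
move=> x0 m1; apply: measurable_funM.
  apply: (measurableT_comp (f := fun v => v `^ a)); first exact: measurable_powR.
  apply: measurable_funD => //; apply: measurable_funM => //.
  apply: (measurableT_comp (f := fun v => v `^ (-1))); first exact: measurable_powR.
  exact: measurable_funM.
apply: measurable_funM.
  by apply: measurableT_comp => //; apply: measurableT_comp.
apply: (measurableT_comp (measurable_Jhat_red nu1 (b + 1) x0 m1)).
by apply: measurable_funD => //; exact: measurable_funM.
Qed.

Lemma measurable_JhatI_red (m x : R) : 0 < x -> 1 <= m -> measurable_fun setT (JhatI_red m x).
Proof.
move=> x0 m1.
exact: (@measurable_Rintegral_param R `]0, +oo[%classic _ _ (measurable_JhatI_red_integrand x0 m1)).
Qed.

Lemma JhatI_red_integrand_le (x : R) : 0 < x -> exists2 C, 0 < C & exists K : R -> R,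
  [/\ forall v, 0 <= K v, integ `]0, +oo[ K & forall m theta v : R,
  2 <= m -> 0 < theta -> 0 < v ->
  `|(1 + v * (m * theta) `^ (-1)) `^ a *
   (expR (- v) * Jhat_red nu (b + 1) m x (theta + m^-1 * v))| <=
  C * expR theta * ((1 + m * theta) / (m * theta)) `^ a * K v].
Proof.
move=> x0; have [C C0 hC] := Jhat_red_le nu1 (b + 1) x0.
have [K [mK K0 iK hK]] := powR_shift_le a1.
exists C => //; exists (fun v => K v * expR (- (2^-1 * v))); split => //.
  by move=> v; rewrite mulr_ge0// expR_ge0.
move=> m theta v m2 t0 v0; have m0 : 0 < m by apply: lt_le_trans m2.
have r0 : 0 < m * theta by rewrite mulr_gt0.
rewrite normrM (ger0_norm (powR_ge0 _ _)) powR_inv1 ?(ltW r0)//.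
apply: (@le_trans _ _ (((1 + m * theta) / (m * theta)) `^ a * K v *
    (C * expR theta * expR (- (2^-1 * v))))); last first.
  by apply: eq_ler; ring.
apply: ler_pM; rewrite ?powR_ge0//; first exact: hK.
have uv0 : 0 <= theta + m^-1 * v by rewrite addr_ge0 ?mulr_ge0 ?invr_ge0 ?ltW.
rewrite normrM (ger0_norm (expR_ge0 _)) mulrC.
apply: le_trans (ler_wpM2r (expR_ge0 _) (hC _ _ m2 uv0)) _.
rewrite -[leLHS]mulrA -[leRHS]mulrA -!expRD ler_wpM2l ?(ltW C0)// ler_expR.
have : m^-1 * v <= 2^-1 * v by rewrite ler_wpM2r ?(ltW v0)// lef_pV2 ?posrE.
by lra.
Qed.

Lemma integrable_JhatI_red_integrand (m x theta : R) : 0 < x -> 2 <= m -> 0 < theta ->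
  integ `]0, +oo[ (fun v => (1 + v * (m * theta) `^ (-1)) `^ a *
   (expR (- v) * Jhat_red nu (b + 1) m x (theta + m^-1 * v))).
Proof.
move=> x0 m2 t0; have [C C0 [K [K0 iK hK]]] := JhatI_red_integrand_le x0.
have m1 : 1 <= m by apply: le_trans m2; rewrite ler1n.
apply: (@integrable_dom _ _ _ (fun v => C * expR theta * ((1 + m * theta) / (m * theta)) `^ a * K v)) => //.
- apply: measurable_funTS.
  exact: (measurableT_comp (measurable_JhatI_red_integrand x0 m1) (measurable_pair1 theta)).
- exact: integrableZ.
- by move=> v; rewrite /= in_itv/= andbT => v0; exact: hK.
Qed.

(** The power of (1 + m theta)/(m theta) is kept because for a > 0 it is unbounded near theta = 0;
    in S it has to be combined with the powers from the other factors. *)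
Lemma JhatI_red_le (x : R) : 0 < x -> exists2 C, 0 < C & forall m theta : R,
  2 <= m -> 0 < theta ->
  `|JhatI_red m x theta| <= C * expR theta * ((1 + m * theta) / (m * theta)) `^ a.
Proof.
move=> x0; have [C C0 [K [K0 iK hK]]] := JhatI_red_integrand_le x0.
pose B := \int[mu]_(v in `]0, +oo[) K v.
have B0 : 0 <= B by apply: Rintegral_ge0.
exists (C * (B + 1)); first by rewrite mulr_gt0// ltr_wpDl.
move=> m theta m2 t0; have m1 : 1 <= m by apply: le_trans m2; rewrite ler1n.
rewrite /JhatI_red; apply: le_trans (@normr_Rintegral_dom _ _ _
  (fun v => C * expR theta * ((1 + m * theta) / (m * theta)) `^ a * K v) _ _ _ _) _ => //.
- apply: measurable_funTS.
  exact: (measurableT_comp (measurable_JhatI_red_integrand x0 m1) (measurable_pair1 theta)).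
- exact: integrableZ.
- by move=> v; rewrite /= in_itv/= andbT => v0; exact: hK.
rewrite RintegralZl// -/B.
apply: (@le_trans _ _ (C * expR theta * ((1 + m * theta) / (m * theta)) `^ a * (B + 1))).
  by rewrite ler_wpM2l ?lerDl// !mulr_ge0 ?expR_ge0 ?powR_ge0// ltW.
by apply: eq_ler; ring.
Qed.

Lemma integral_expRN : \int[mu]_(v in `]0, +oo[) expR (- (v : R)) = 1.
Proof.
rewrite /Rintegral integral_itv_obnd_cbnd; last first.
  by apply/measurable_EFinP; apply: measurable_funTS; apply: measurableT_comp.
rewrite -[RHS]/(fine 1%:E) -(integral_exponential_pdf (@ltr01 R)); congr fine.
rewrite integral_mkcond; apply: eq_integral => v _; rewrite patchE.
have [v0|v0] := leP 0 v.
  rewrite mem_set; last by rewrite /= in_itv/= andbT.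
  by rewrite exponential_pdfE//= mul1r mulN1r.
rewrite memNset; last by rewrite /= in_itv/= andbT; apply/negP; rewrite -ltNge.
by rewrite lt0_exponential_pdf.
Qed.

Lemma JhatI_red_cvg (x theta : R) (m : nat -> R) : 0 < x -> 0 < theta ->
  m i @[i --> \oo] --> +oo -> JhatI_red (m i) x theta @[i --> \oo] --> besselG nu (x * theta).
Proof.
move=> x0 t0 hm; have [C C0 [K [K0 iK hK]]] := JhatI_red_integrand_le x0.
have mD : measurable (`]0, +oo[%classic : set R) by exact: measurable_itv.
have hmV : (m i)^-1 @[i --> \oo] --> (0 : R).
  by apply/gtr0_cvgV0 => //; near=> i; near: i; exact: (cvgry_gt hm).
pose f_ i v := (1 + v * (m i * theta) `^ (-1)) `^ a *
   (expR (- v) * Jhat_red nu (b + 1) (m i) x (theta + (m i)^-1 * v)).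
have H1 : \forall i \near \oo, measurable_fun (`]0, +oo[%classic : set R) (f_ i).
  near=> i; have m1 : 1 <= m i by near: i; exact: (cvgry_ge hm).
  apply: measurable_funTS.
  exact: (measurableT_comp (measurable_JhatI_red_integrand x0 m1) (measurable_pair1 theta)).
have H2 v : `]0, +oo[%classic v -> f_ i v @[i --> \oo] --> expR (- v) * besselG nu (x * theta).
  rewrite /= in_itv/= andbT => v0; rewrite -[expR _ * _]mul1r; apply: cvgM.
    have h1 : 1 + v * (m i * theta) `^ (-1) @[i --> \oo] --> 1 + v * 0.
      apply: cvgD; first exact: cvg_cst.
      apply: cvgMl_tmp.
      have : (m i)^-1 * theta^-1 @[i --> \oo] --> (0 : R).
        by rewrite -(mul0r theta^-1); exact: cvgMr_tmp.
      apply: cvg_trans; apply: near_eq_cvg; near=> i.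
      have m0 : 0 < m i by near: i; exact: (cvgry_gt hm).
      by rewrite powR_inv1 ?mulr_ge0 ?(ltW m0) ?(ltW t0)// invfM.
    have := cvg_powR (q := a) _ h1.
    by rewrite mulr0 addr0 powR1; apply.
  apply: cvgMl_tmp.
  (* The absolute value makes the points nonnegative for every i, as [Jhat_red_cvg] requires; it has
     no effect once m i > 0. *)
  pose w (i : nat) : R := `|theta + (m i)^-1 * v|.
  have hw : w i @[i --> \oo] --> theta.
    rewrite -[X in _ --> X](gtr0_norm t0); apply: cvg_norm.
    rewrite -[X in _ --> X]addr0 -(mul0r v); apply: cvgD; [exact: cvg_cst|exact: cvgMr_tmp].
  have w0 i : 0 <= w i by exact: normr_ge0.
  have := Jhat_red_cvg nu1 (b + 1) x0 hm hw w0.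
  apply: cvg_trans; apply: near_eq_cvg; near=> i.
  have m0 : 0 < m i by near: i; exact: (cvgry_gt hm).
  by rewrite /w ger0_norm// addr_ge0 ?mulr_ge0 ?invr_ge0 ?(ltW m0) ?(ltW t0) ?(ltW v0).
(* Here theta is fixed, so r = m i * theta is eventually at least 1 and (1 + r)/r lies between 1 and
   2. *)
have [D [D1 hD]] : exists D : R, 1 <= D /\ forall r, 1 <= r -> ((1 + r) / r) `^ a <= D.
  exists (1 + 2 `^ `|a|); split; first by rewrite lerDl powR_ge0.
  move=> r r1; have r0 : 0 < r by apply: lt_le_trans r1.
  apply: (@le_trans _ _ (2 `^ `|a|)); last by rewrite lerDr.
  apply: (@le_trans _ _ (((1 + r) / r) `^ `|a|)).
    by rewrite ler_powR ?ler_norm// ler_pdivlMr// mul1r; lra.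
  apply: ge0_ler_powR => //; rewrite ?nnegrE ?divr_ge0 ?addr_ge0 ?(ltW r0)//.
  by rewrite ler_pdivrMr//; lra.
have H3 := integrableZ (C * expR theta * D) mD iK.
have H4 : \forall i \near \oo, forall v, `]0, +oo[%classic v ->
    `|f_ i v| <= C * expR theta * D * K v.
  near=> i => v; rewrite /= in_itv/= andbT => v0.
  apply: le_trans (hK _ _ _ _ t0 v0) _; first by near: i; exact: (cvgry_ge hm).
  apply: ler_wpM2r; first exact: K0.
  apply: ler_wpM2l; first by rewrite mulr_ge0 ?expR_ge0// ltW.
  apply: hD.
  by rewrite -ler_pdivrMr//; near: i; exact: (cvgry_ge hm).
have [_ H] := Rintegral_dominated_cvg mD H1 H2 H3 H4.
move: H; rewrite RintegralZr//; last first.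
  apply: integrable_eq (@integrable_expR_itv0y R 1 ltr01) => // t _.
  by rewrite mul1r.
by rewrite integral_expRN mul1r.
Unshelve. all: by end_near. Qed.

(** The Jacobian 1/r of xi = 1 + v/r, with r = m theta, lowers the power r^(b+1) of the
    differintegral to r^b. *)
Lemma JhatIE (theta x s m : R) : 0 < theta -> 0 < x -> 2 <= m -> m = - (2 * s) ->
  JhatI nu kappa theta x s = (m * theta) `^ b * expR (- (m * theta)) * JhatI_red m x theta.
Proof.
move=> t0 x0 m2 mE; have m0 : 0 < m by apply: lt_le_trans m2.
have m1 : 1 < m by apply: lt_le_trans m2; rewrite ltr1n.
pose r := m * theta; have r0 : 0 < r by rewrite mulr_gt0.
have rV0 : 0 < r^-1 by rewrite invr_gt0.
have rVn0 : r^-1 != 0 by rewrite gt_eqF.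
pose g xi := xi `^ a * (r `^ (b + 1) * expR (- (r * xi)) * Jhat_red nu (b + 1) m x (theta * xi)).
rewrite /JhatI (eq_Rint (g := g)); last first.
  move=> xi; rewrite /= in_itv/= andbT => xi1.
  by rewrite (JhatDE nu1 (b + 1) t0 (lt_trans ltr01 xi1) x0 m1 mE).
have gE v : 0 < v -> g (affine r^-1 1 v) = r `^ (b + 1) * expR (- r) *
   ((1 + v * (m * theta) `^ (-1)) `^ a *
   (expR (- v) * Jhat_red nu (b + 1) m x (theta + m^-1 * v))).
  move=> v0; rewrite /g /affine -/r powR_inv1 ?(ltW r0)//.
  rewrite [r^-1 * v + 1]addrC [r^-1 * v]mulrC mulrDr mulr1 opprD expRD.
  rewrite [r * (v / r)]mulrC divfK ?gt_eqF//.
  rewrite (_ : theta * (1 + v / r) = theta + m^-1 * v); last first.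
    by rewrite /r; field; rewrite !gt_eqF.
  by ring.
have iI := integrable_JhatI_red_integrand x0 m2 t0.
have m1' := ltW m1.
have := @integral_affine R r^-1 1 `]1, +oo[%classic g rVn0.
rewrite affine_itvoy// subrr mul0r => /(_ _ _ _)[].
- exact: measurable_itv.
- apply: measurable_funTS; apply: measurable_funM; first exact: measurable_powR.
  apply: measurable_funM.
    apply: measurable_funM => //; do 2 apply: measurableT_comp => //.
  by apply: (measurableT_comp (measurable_Jhat_red nu1 (b + 1) x0 m1')); exact: measurable_funM.
- apply: integrable_eq (integrableZ (r `^ (b + 1) * expR (- r)) _ iI) => //.
  by move=> v; rewrite /= in_itv/= andbT => v0; rewrite gE.
move=> _ ->.
rewrite (eq_Rint (g := fun v => r `^ (b + 1) * expR (- r) *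
   ((1 + v * (m * theta) `^ (-1)) `^ a *
   (expR (- v) * Jhat_red nu (b + 1) m x (theta + m^-1 * v))))); last first.
  by move=> v; rewrite /= in_itv/= andbT => v0; rewrite gE.
rewrite RintegralZl// -/(JhatI_red m x theta) mulrA; congr (_ * _).
rewrite (gtr0_norm rV0) (gt0_powRD b 1 r0) powRr1 ?(ltW r0)// -/r.
by field; rewrite gt_eqF.
Qed.

End InnerIntegral.

(** * Laplace asymptotics of beta-type integrals at t = 1 *)

Section LeftAsymptotics.
Context {R : realType}.

(** [RLleft_term] at z = 1, divided by exp r and with theta moved into the argument of the series;
    the weight concentrates within a distance of order 1/r of t = 1. *)
Definition Qint (al p : R) (d : nat -> R) (theta r : R) : R := \int[mu]_(t in `]0, 1[)
  ((1 - t) `^ (al - 1) * (t `^ p * (psum d (theta * t) * expR (- (r * (1 - t)))))).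

Lemma measurable_Qint_integrand (al p B m : R) (d : nat -> R) : expbd B 1 d ->
  measurable_fun setT (fun q : R * R => (1 - q.2) `^ (al - 1) * (q.2 `^ p *
    (psum d (q.1 * q.2) * expR (- (m * q.1 * (1 - q.2)))))).
Proof.
move=> hd; apply: measurable_funM.
  by apply: (measurableT_comp (measurable_onem_powR (al - 1))).
apply: measurable_funM.
  by apply: (measurableT_comp (f := fun x : R => x `^ p)); first exact: measurable_powR.
apply: measurable_funM.
  by apply: (measurableT_comp (measurable_psum ler01 hd)); exact: measurable_funM.
do 2 apply: measurableT_comp => //.
by apply: measurable_funM; [exact: measurable_funM|exact: measurable_funB].
Qed.

Lemma measurable_Qint (al p B m : R) (d : nat -> R) : expbd B 1 d ->
  measurable_fun setT (fun theta => Qint al p d theta (m * theta)).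
Proof.
move=> hd.
exact: (@measurable_Rintegral_param R `]0, 1[%classic _ _ (measurable_Qint_integrand al p m hd)).
Qed.

Lemma measurable_Qint_integrand1 (al p B theta r : R) (d : nat -> R) : expbd B 1 d ->
  measurable_fun setT (fun t : R =>
    (1 - t) `^ (al - 1) * (t `^ p * (psum d (theta * t) * expR (- (r * (1 - t)))))).
Proof.
move=> hd; apply: measurable_funM; first exact: measurable_onem_powR.
apply: measurable_funM; first exact: measurable_powR.
apply: measurable_funM.
  by apply: (measurableT_comp (measurable_psum ler01 hd)); exact: measurable_funM.
do 2 apply: measurableT_comp => //.
by apply: measurable_funM => //; exact: measurable_funB.
Qed.

Lemma psum_le_expR1 (B u : R) (d : nat -> R) : expbd B 1 d -> 0 <= u <= 1 ->
  `|psum d u| <= B * expR 1.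
Proof.
move=> hd /andP[u0 u1]; apply: le_trans (psum_le ler01 hd _) _.
by rewrite mul1r ger0_norm// ler_wpM2l ?ler_expR// (expbd_ge0 hd).
Qed.

Lemma Qint_le (al p : R) : 0 < al -> -1 < p -> exists2 C, 0 < C &
  forall (d : nat -> R) (B theta r : R), expbd B 1 d -> 0 <= theta <= 1 -> 0 <= r ->
  integ `]0, 1[ (fun t =>
    (1 - t) `^ (al - 1) * (t `^ p * (psum d (theta * t) * expR (- (r * (1 - t)))))) /\
  `|Qint al p d theta r| <= C * B * (1 + r) `^ (- al).
Proof.
move=> al0 p1; have [C C0 hC] := beta_exp_le al0 p1.
exists (C * expR 1); first by rewrite mulr_gt0 ?expR_gt0.
move=> d B theta r hd /andP[t0 t1] r0.
have B0 := expbd_ge0 hd.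
have [ib hb] := hC _ r0.
have mD : measurable (`]0, 1[%classic : set R) by exact: measurable_itv.
pose f t := (1 - t) `^ (al - 1) * (t `^ p * (psum d (theta * t) * expR (- (r * (1 - t))))).
pose g t := B * expR 1 * ((1 - t) `^ (al - 1) * (t `^ p * expR (- (r * (1 - t))))).
have ig : integ `]0, 1[ g by exact: integrableZ.
have mf : measurable_fun (`]0, 1[%classic : set R) f.
  by apply: measurable_funTS; exact: measurable_Qint_integrand1 hd.
have fg t : `]0, 1[%classic t -> `|f t| <= g t.
  rewrite /= in_itv/= => /andP[s0 s1].
  rewrite /f /g normrM (ger0_norm (powR_ge0 _ _)) [leRHS]mulrCA ler_wpM2l ?powR_ge0//.
  rewrite normrM (ger0_norm (powR_ge0 _ _)) [leRHS]mulrCA ler_wpM2l ?powR_ge0//.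
  rewrite normrM (ger0_norm (expR_ge0 _)) ler_wpM2r ?expR_ge0//.
  apply: psum_le_expR1 => //; rewrite mulr_ge0 ?(ltW s0)//=.
  by rewrite mulr_ile1// ltW.
split; first exact: (integrable_dom mD mf ig fg).
apply: le_trans (normr_Rintegral_dom mD mf ig fg) _.
rewrite RintegralZl//.
apply: le_trans (ler_wpM2l _ hb) _; first by rewrite mulr_ge0 ?expR_ge0.
by apply: eq_ler; ring.
Qed.

(** Insert 1 = (1 - t) + t. It serves to raise a negative exponent p to p + 1 >= 0, at the price of
    a term that decays faster by a factor 1/r. *)
Lemma Qint_split (al p B theta r : R) (d : nat -> R) : 0 < al -> -1 < p ->
  expbd B 1 d -> 0 <= theta <= 1 -> 0 <= r ->
  Qint al p d theta r = Qint (al + 1) p d theta r + Qint al (p + 1) d theta r.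
Proof.
move=> al0 p1 hd t01 r0.
have mD : measurable (`]0, 1[%classic : set R) by exact: measurable_itv.
have al10 : 0 < al + 1 by rewrite addr_gt0.
have p11 : -1 < p + 1 by rewrite ltr_wpDr.
have [C1 _ h1] := Qint_le al10 p1; have [i1 _] := h1 _ _ _ _ hd t01 r0.
have [C2 _ h2] := Qint_le al0 p11; have [i2 _] := h2 _ _ _ _ hd t01 r0.
rewrite /Qint -RintegralD//; apply: eq_Rint => t; rewrite /= in_itv/= => /andP[s0 s1].
have s10 : 0 < 1 - t by rewrite subr_gt0.
rewrite (gt0_powRD p 1 s0) powRr1 ?(ltW s0)//.
rewrite (_ : al + 1 - 1 = al - 1 + 1); last by ring.
by rewrite (gt0_powRD (al - 1) 1 s10) powRr1 ?(ltW s10)//; ring.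
Qed.

(** Substitute t = 1 - v/r. The variable v then runs up to r, and an indicator extends the integral
    to a fixed domain; for 0 <= p the factor (1 - v/r)^p is at most 1, so the Gamma density
    dominates. *)
Lemma Qint_cvg (al p A theta : R) (c : nat -> R) (j : nat) (m : nat -> R) :
  0 < al -> 0 <= p -> expbd A 1 c -> 0 < theta <= 1 -> m i @[i --> \oo] --> +oo ->
  (m i * theta) `^ al * Qint al p (expdiff (m i) j c) theta (m i * theta) @[i --> \oo]
    --> Gamma al * psum c theta.
Proof.
move=> al0 p0 hc /andP[t0 t1] hm.
have mD : measurable (`]0, +oo[%classic : set R) by exact: measurable_itv.
have A0 := expbd_ge0 hc.
have hmV : (m i)^-1 @[i --> \oo] --> (0 : R).
  by apply/gtr0_cvgV0 => //; near=> i; near: i; exact: (cvgry_gt hm).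
pose r i := m i * theta.
pose h i (v : R) := v `^ (al - 1) * ((1 - (r i)^-1 * v) `^ p *
  (psum (expdiff (m i) j c) (theta * (1 - (r i)^-1 * v)) * expR (- v))).
pose f_ i v := h i v * \1_(`]0, r i[%classic) v.
have hd (i : nat) : 1 <= m i -> expbd (2 ^+ j * A) 1 (expdiff (m i) j c).
  by move=> m1; apply: expbd_expdiff => //; rewrite ger0_norm// (le_trans _ m1).
have mh i : 1 <= m i -> measurable_fun setT (h i).
  move=> m1; apply: measurable_funM; first exact: measurable_powR.
  have ma : measurable_fun setT (fun v : R => 1 - (r i)^-1 * v).
    by apply: measurable_funB => //; exact: measurable_funM.
  apply: measurable_funM.
    by apply: (measurableT_comp (f := fun x : R => x `^ p)); first exact: measurable_powR.
  apply: measurable_funM; last by apply: measurableT_comp.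
  by apply: (measurableT_comp (measurable_psum ler01 (hd _ m1))); exact: measurable_funM.
have h_le i v : 1 <= m i -> 0 < v < r i ->
    `|h i v| <= 2 ^+ j * A * expR 1 * (v `^ (al - 1) * expR (- v)).
  move=> m1 /andP[v0 vr]; have r0 : 0 < r i by exact: lt_trans vr.
  have vr1 : (r i)^-1 * v < 1 by rewrite mulrC ltr_pdivrMr// mul1r.
  have vr0 : 0 < (r i)^-1 * v by rewrite mulr_gt0 ?invr_gt0.
  have s0 : 0 < 1 - (r i)^-1 * v by rewrite subr_gt0.
  have s1 : 1 - (r i)^-1 * v <= 1 by rewrite gerBl ltW.
  rewrite /h normrM (ger0_norm (powR_ge0 _ _)) [leRHS]mulrCA ler_wpM2l ?powR_ge0//.
  rewrite normrM (ger0_norm (powR_ge0 _ _)) -[leRHS]mul1r ler_pM ?powR_ge0//.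
    by rewrite -[leRHS](powRr0 (1 - (r i)^-1 * v)) ger_powR// s0.
  rewrite normrM (ger0_norm (expR_ge0 _)) ler_wpM2r ?expR_ge0//.
  apply: (psum_le_expR1 (hd _ m1)); rewrite mulr_ge0 ?(ltW s0) ?(ltW t0)//=.
  by rewrite mulr_ile1// ltW.
have iG := integrable_Gamma al0.
have H3 := integrableZ (2 ^+ j * A * expR 1) mD iG.
have H4 : \forall i \near \oo, forall v, `]0, +oo[%classic v ->
    `|f_ i v| <= 2 ^+ j * A * expR 1 * (v `^ (al - 1) * expR (- v)).
  near=> i => v; rewrite /= in_itv/= andbT => v0.
  have m1 : 1 <= m i by near: i; exact: (cvgry_ge hm).
  rewrite /f_ indicE; case: (boolP (v \in _)) => [|_]; last first.
    rewrite mulr0 normr0 !mulr_ge0 ?exprn_ge0 ?powR_ge0 ?expR_ge0//.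
  by rewrite inE /= in_itv/= mulr1 => v01; exact: h_le.
have H1 : \forall i \near \oo, measurable_fun (`]0, +oo[%classic : set R) (f_ i).
  near=> i; have m1 : 1 <= m i by near: i; exact: (cvgry_ge hm).
  apply: measurable_funTS; apply: measurable_funM; first exact: mh.
  by apply: measurable_indic.
have H2 v : `]0, +oo[%classic v -> f_ i v @[i --> \oo] --> psum c theta * (v `^ (al - 1) * expR (- v)).
  rewrite /= in_itv/= andbT => v0.
  have rV : (r i)^-1 * v @[i --> \oo] --> (0 : R).
    rewrite -(mul0r (theta^-1 * v)).
    rewrite (_ : (fun i => _) = (fun i => (m i)^-1 * (theta^-1 * v))); last first.
      by apply/funext => i; rewrite /r invfM mulrA.
    exact: cvgMr_tmp.
  have rV1 : 1 - (r i)^-1 * v @[i --> \oo] --> (1 : R).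
    by rewrite -[X in _ --> X]subr0; apply: cvgB => //; exact: cvg_cst.
  have : h i v @[i --> \oo] --> psum c theta * (v `^ (al - 1) * expR (- v)).
    rewrite (_ : psum c theta * _ = v `^ (al - 1) * (1 * (psum c theta * expR (- v)))); last by ring.
    apply: cvgMl_tmp; apply: cvgM.
      have := cvg_powR (q := p) ltr01 rV1.
      by rewrite powR1.
    apply: cvgMr_tmp; apply: (psum_expdiff_cvg j ler01 hc).
      by apply: ger_cvgy hm; near=> i; exact: ler_norm.
    by rewrite -[X in _ --> X]mulr1; exact: cvgMl_tmp.
  apply: cvg_trans; apply: near_eq_cvg; near=> i.
  rewrite /f_ indicE mem_set ?mulr1//= in_itv/= v0/=.
  by rewrite /r -ltr_pdivrMr//; near: i; exact: (cvgry_gt hm).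
have [_ H] := Rintegral_dominated_cvg mD H1 H2 H3 H4.
have E : \int[mu]_(v in `]0, +oo[) (psum c theta * (v `^ (al - 1) * expR (- v))) = Gamma al * psum c theta.
  by rewrite RintegralZl// mulrC.
rewrite E in H.
apply: cvg_trans H; apply: near_eq_cvg; near=> i.
have m1 : 1 <= m i by near: i; exact: (cvgry_ge hm).
have r0 : 0 < r i by rewrite mulr_gt0// (lt_le_trans _ m1).
have rV0 : 0 < (r i)^-1 by rewrite invr_gt0.
have rVn : - (r i)^-1 < 0 by rewrite oppr_lt0.
have rVn0 : - (r i)^-1 != 0 by rewrite lt_eqF.
have -> : \int[mu]_(v in `]0, +oo[) f_ i v = \int[mu]_(v in `]0, r i[) h i v.
  have -> : `]0, r i[%classic = `]0, +oo[%classic `&` `]0, r i[%classic :> set R.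
    by rewrite setIidr//; apply: subset_itvl; rewrite bnd_simp.
  by rewrite Rintegral_mkcondr; apply: eq_Rint => v _; rewrite patch_indic.
rewrite -/(r i) /Qint.
pose g (t : R) := (1 - t) `^ (al - 1) * (t `^ p * (psum (expdiff (m i) j c) (theta * t) * expR (- (r i * (1 - t))))).
have gE v : 0 < v -> g (affine (- (r i)^-1) 1 v) = (r i) `^ (1 - al) * h i v.
  move=> v0; rewrite /g /affine.
  have -> : 1 - (- (r i)^-1 * v + 1) = (r i)^-1 * v by ring.
  have -> : - (r i)^-1 * v + 1 = 1 - (r i)^-1 * v by ring.
  rewrite mulVKf ?gt_eqF// powRM ?(ltW rV0) ?(ltW v0)//.
  rewrite -[(r i)^-1 `^ _]/((r i)^-1 `^ (al - 1)) -powR_inv1 ?(ltW r0)// -powRrM mulN1r opprB.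
  by rewrite powR_inv1 ?(ltW r0)// /h; ring.
have ih : integ `]0, r i[ (h i).
  have ir : integ `]0, r i[ (fun v => 2 ^+ j * A * expR 1 * (v `^ (al - 1) * expR (- v))).
    by apply: integrableS H3 => //; apply: subset_itvl; rewrite bnd_simp.
  apply: (integrable_dom _ _ ir) => //; first by apply: measurable_funTS; exact: mh.
  by move=> v; rewrite /= in_itv/= => v01; exact: h_le.
have := @integral_affine R (- (r i)^-1) 1 `]0, 1[%classic g rVn0.
rewrite affine_itvoo_neg// subrr mul0r sub0r invrN invrK mulN1r opprK => /(_ _ _ _)[].
- exact: measurable_itv.
- by apply: measurable_funTS; exact: measurable_Qint_integrand1 (hd _ m1).
- apply: integrable_eq (integrableZ ((r i) `^ (1 - al)) _ ih) => //.
  by move=> v; rewrite /= in_itv/= => /andP[v0 _]; rewrite gE.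
move=> _ ->.
rewrite (eq_Rint (f := fun v => g (affine (- (r i)^-1) 1 v))
  (g := fun v => (r i) `^ (1 - al) * h i v)); last first.
  by move=> v; rewrite /= in_itv/= => /andP[v0 _]; rewrite gE.
rewrite RintegralZl// normrN (gtr0_norm rV0) !mulrA.
rewrite -[LHS]mul1r; congr (_ * _); apply/esym.
rewrite -mulrA mulrCA -gt0_powRD// addrCA subrr addr0 powRr1 ?(ltW r0)//.
by rewrite mulVf// gt_eqF.
Unshelve. all: by end_near. Qed.

End LeftAsymptotics.

(** * Left differintegrals of the Bessel functions *)

Section LeftKernel.
Context {R : realType}.

Lemma psum_mulr (A X : R) (c : nat -> R) (k u : R) : 0 <= X -> expbd A X c ->
  psum (fun i => c i * k) u = psum c u * k.
Proof.
move=> X0 hc; apply/cvg_lim => //.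
rewrite (_ : pseries _ u = (fun n => pseries c u n * k)).
  by apply: cvgMr_tmp; exact: (psum_cvg X0 hc).
apply/funext => n; rewrite /pseries /series/= mulr_suml.
by apply: eq_bigr => i _; ring.
Qed.

Lemma expdiff_mulr (c : nat -> R) (m k : R) j i : expdiff m j (fun i => c i * k) i = expdiff m j c i * k.
Proof.
elim: j i => [//|j IH] i /=; rewrite /pseries_diffs !IH; ring.
Qed.

Lemma sum_normr_le (T : Type) (P : T -> Prop) (w : T -> R) (F : nat -> T -> R) (N : nat) :
  (forall j, (j < N)%N -> exists2 C, 0 < C & forall q, P q -> `|F j q| <= C * w q) ->
  (forall q, P q -> 0 <= w q) ->
  exists2 C, 0 < C & forall q, P q -> `|\sum_(j < N) F j q| <= C * w q.
Proof.
move=> H w0; elim: N H => [|N IH] H.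
  by exists 1 => // q Pq; rewrite big_ord0 normr0 mul1r w0.
have [C1 C10 h1] := IH (fun j jN => H j (ltnW jN)).
have [C2 C20 h2] := H N (ltnSn N).
exists (C1 + C2); first exact: addr_gt0.
move=> q Pq; rewrite big_ord_recr/= mulrDl.
by apply: le_trans (ler_normD _ _) _; apply: lerD; [exact: h1|exact: h2].
Qed.

Variable nu : R.
Hypothesis nu1 : -1 < nu.

Section order.
Variable g : R.
Local Notation n := (RLorder g).
Local Notation al := ((RLorder g)%:R - g).
Let al0 : 0 < al. Proof. exact: RLorder_sub_gt0. Qed.
Let nuj1 (j : nat) : -1 < nu + j%:R. Proof. by rewrite ltr_wpDr. Qed.

Definition Jtilde_red (m x theta : R) : R := (Gamma al)^-1 *
  \sum_(j < n.+1) RLcoef (al + nu) n j *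
    ((m * theta) ^+ j * Qint al (nu + j%:R) (expdiff m j (besselcx nu x)) theta (m * theta)).

Lemma JtildeDE (theta x s m : R) : 0 < theta <= 1 -> 0 < x -> 1 <= m -> m = 2 * s ->
  JtildeD nu g theta 1 x s = (theta * x) `^ nu * expR (m * theta) * Jtilde_red m x theta.
Proof.
move=> /andP[t0 t1] x0 m1 mE; have m0 : 0 < m by apply: lt_le_trans m1.
have [A h] := expbd_besselcx nu1 x0 (@ltr01 R).
pose K := (theta * x) `^ nu.
pose c k := besselcx nu x k * theta ^+ k.
have hc : expbd A theta c by apply: expbd_power => //; exact: ltW.
(* [RLleft_exp] asks for y^nu times a series, so the constant (theta x)^nu is put into the
   coefficients and taken out again at the end. *)
pose cK k := c k * K.
have hcK : expbd (`|K| * A) theta cK by exact: expbd_scale.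
have tr : theta <= m * theta by rewrite ler_pMl.
have r0 : 0 < m * theta by rewrite mulr_gt0.
rewrite /JtildeD (RLleft_exp g (ltW t0) hcK tr r0 nu1); last first.
  move=> y y0; rewrite /Jtilde; have u0 : 0 < theta * y * x by rewrite !mulr_gt0.
  rewrite besselJ_sqrt// mulrA -(gt0_powRD _ _ u0) -splitr.
  rewrite /cK (psum_mulr K y (ltW t0) hc) /c psum_scale psum_besselcx.
  have -> : theta * y * x = y * (theta * x) by ring.
  rewrite powRM ?(ltW y0) ?mulr_ge0 ?(ltW t0) ?(ltW x0)// -/K -mE.
  have -> : y * (theta * x) = x * (theta * y) by ring.
  by ring.
rewrite /Jtilde_red [RHS]mulrCA; congr (_ * _); rewrite mulr_sumr; apply: eq_bigr => j _.
rewrite [RHS]mulrCA; congr (_ * _); rewrite [RHS]mulrCA; congr (_ * _).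
have hj : expbd (2 ^+ j * A) 1 (expdiff m j (besselcx nu x)).
  by apply: expbd_expdiff => //; rewrite ger0_norm// ltW.
have [C _ hC] := Qint_le al0 (nuj1 j).
have [iQ _] := hC _ _ theta (m * theta) hj (ltac:(by rewrite (ltW t0) t1)) (ltW r0).
rewrite /Qint -RintegralZl//; apply: eq_Rint => t _.
rewrite mul1r (_ : expdiff _ j cK = (fun k => expdiff m j (besselcx nu x) k * theta ^+ k * K)); last first.
  by apply/funext => k; rewrite /cK expdiff_mulr /c expdiff_scale// gt_eqF.
rewrite (psum_mulr (A := 2 ^+ j * A) (X := theta) K _ (ltW t0)); last first.
  by apply: expbd_power => //; exact: ltW.
rewrite psum_scale -/K.
have -> : expR (m * theta * t) = expR (m * theta) * expR (- (m * theta * (1 - t))).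
  by rewrite -expRD; congr expR; ring.
by ring.
Qed.

Lemma measurable_Jtilde_red (m x : R) : 0 < x -> 1 <= m -> measurable_fun setT (Jtilde_red m x).
Proof.
move=> x0 m1; have [A h] := expbd_besselcx nu1 x0 (@ltr01 R).
apply: measurable_funM => //; apply: measurable_sum => j.
apply: measurable_funM => //; apply: measurable_funM.
  by apply: measurable_funX; exact: measurable_funM.
have hj : expbd (2 ^+ j * A) 1 (expdiff m j (besselcx nu x)).
  by apply: expbd_expdiff => //; rewrite ger0_norm// (le_trans _ m1).
exact: measurable_Qint hj.
Qed.

(** With r = m theta, the j-th term is of order (1 + r)^(j - al), and j <= n bounds this by (1 +
    r)^(n - al) = (1 + r)^g, also for small theta. *)
Lemma Jtilde_red_le (x : R) : 0 < x -> exists2 C, 0 < C & forall m theta : R,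
  1 <= m -> 0 < theta <= 1 -> `|Jtilde_red m x theta| <= C * (1 + m * theta) `^ g.
Proof.
move=> x0; have [A h] := expbd_besselcx nu1 x0 (@ltr01 R).
have A0 := expbd_ge0 h.
pose P (q : R * R) := 1 <= q.1 /\ 0 < q.2 <= 1.
pose w (q : R * R) := (1 + q.1 * q.2) `^ g.
pose F j (q : R * R) := RLcoef (al + nu) n j *
    ((q.1 * q.2) ^+ j * Qint al (nu + j%:R) (expdiff q.1 j (besselcx nu x)) q.2 (q.1 * q.2)).
have w0 q : P q -> 0 <= w q by move=> _; exact: powR_ge0.
have HF j : (j < n.+1)%N -> exists2 C, 0 < C & forall q, P q -> `|F j q| <= C * w q.
  move=> jn; have [C C0 hC] := Qint_le al0 (nuj1 j).
  exists (`|RLcoef (al + nu) n j| * (C * (2 ^+ j * A)) + 1).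
    by rewrite ltr_wpDl// !mulr_ge0 ?exprn_ge0// ltW.
  move=> [m theta]; rewrite /P /w /F /= => -[m1 /andP[t0 t1]].
  have m0 : 0 < m by apply: lt_le_trans m1.
  have r0 : 0 < m * theta by rewrite mulr_gt0.
  have r10 : 0 < 1 + m * theta by rewrite addr_gt0.
  have hj : expbd (2 ^+ j * A) 1 (expdiff m j (besselcx nu x)).
    by apply: expbd_expdiff => //; rewrite ger0_norm// ltW.
  have [_ hQ] := hC _ _ theta (m * theta) hj (ltac:(by rewrite (ltW t0) t1)) (ltW r0).
  rewrite !normrM normrX (gtr0_norm r0).
  apply: (@le_trans _ _ (`|RLcoef (al + nu) n j| * (C * (2 ^+ j * A)) * (1 + m * theta) `^ g)).
    rewrite -mulrA ler_wpM2l//.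
    apply: (@le_trans _ _ ((1 + m * theta) ^+ n * (C * (2 ^+ j * A) * (1 + m * theta) `^ (- al)))).
      apply: ler_pM => //; first by rewrite exprn_ge0// ltW.
      apply: (@le_trans _ _ ((1 + m * theta) ^+ j)).
        by apply: lerXn2r; rewrite ?nnegrE ?(ltW r0) ?(ltW r10)// lerDr.
      by apply: ler_weXn2l; rewrite ?lerDl ?(ltW r0).
    rewrite mulrCA ler_wpM2l ?mulr_ge0 ?exprn_ge0 ?(ltW C0)//.
    by rewrite -powR_mulrn ?(ltW r10)// -gt0_powRD// opprB addrCA subrr addr0 lexx.
  by rewrite ler_wpM2r ?powR_ge0// lerDl.
have [C C0 hC] := sum_normr_le HF w0.
exists ((Gamma al)^-1 * C); first by rewrite mulr_gt0 ?invr_gt0 ?Gamma_gt0.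
move=> m theta m1 t01; rewrite /Jtilde_red normrM -mulrA.
have G0 : 0 < (Gamma al)^-1 by rewrite invr_gt0 Gamma_gt0.
rewrite (gtr0_norm G0) ler_wpM2l ?(ltW G0)//.
exact: (hC (m, theta) (conj m1 t01)).
Qed.

(** The decay r^(-al') of the integral exceeds the power r^q by at least one factor 1/r. *)
Lemma Qint_cvg0 (al' p theta q : R) (c : nat -> R) (A : R) (j : nat) (m : nat -> R) :
  0 < al' -> -1 < p -> expbd A 1 c -> 0 < theta <= 1 -> m i @[i --> \oo] --> +oo ->
  q <= al' - 1 ->
  (m i * theta) `^ q * Qint al' p (expdiff (m i) j c) theta (m i * theta) @[i --> \oo] --> (0 : R).
Proof.
move=> al'0 p1 h /andP[t0 t1] hm qa; have A0 := expbd_ge0 h.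
have hmV : (m i)^-1 @[i --> \oo] --> (0 : R).
  by apply/gtr0_cvgV0 => //; near=> i; near: i; exact: (cvgry_gt hm).
have [C C0 hC] := Qint_le al'0 p1.
have c2 : C * (2 ^+ j * A) * theta^-1 * (m i)^-1 @[i --> \oo] --> (0 : R).
  by rewrite -(mulr0 (C * (2 ^+ j * A) * theta^-1)); exact: cvgMl_tmp.
apply: norm_cvg0.
apply: (@squeeze_cvgr _ _ _ _ (cst 0) _ _ _ _ _ c2); last exact: cvg_cst.
near=> i; rewrite normr_ge0/=.
have m1 : 1 <= m i by near: i; exact: (cvgry_ge hm).
have m0 : 0 < m i by apply: lt_le_trans m1.
have r0 : 0 < m i * theta by rewrite mulr_gt0.
have r1 : 1 <= m i * theta by rewrite -ler_pdivrMr//; near: i; exact: (cvgry_ge hm).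
have r10 : 0 < 1 + m i * theta by rewrite addr_gt0.
have hj : expbd (2 ^+ j * A) 1 (expdiff (m i) j c).
  by apply: expbd_expdiff => //; rewrite ger0_norm// ltW.
have [_ hQ] := hC _ _ theta (m i * theta) hj (ltac:(by rewrite (ltW t0) t1)) (ltW r0).
rewrite normrM (ger0_norm (powR_ge0 _ _)).
apply: (@le_trans _ _ ((m i * theta) `^ (al' - 1) * (C * (2 ^+ j * A) * (m i * theta) `^ (- al')))).
  apply: ler_pM => //; rewrite ?powR_ge0//; first by rewrite ler_powR.
  apply: le_trans hQ _.
  rewrite ler_wpM2l ?mulr_ge0 ?exprn_ge0 ?(ltW C0)//.
  rewrite !powRN lef_pV2 ?posrE ?powR_gt0//.
  by apply: ge0_ler_powR; rewrite ?nnegrE ?(ltW r0) ?(ltW r10) ?(ltW al'0)// lerDr.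
rewrite mulrCA -gt0_powRD// addrAC subrr sub0r powR_inv1 ?(ltW r0)// invfM.
by apply: eq_ler; ring.
Unshelve. all: by end_near. Qed.

(** With r = m theta, the j-th term is of order r^(-g + j - al) = r^(j - n), so only j = n survives,
    and its coefficient is 1. *)
Lemma Jtilde_red_cvg (x theta : R) (m : nat -> R) : 0 < x -> 0 < theta <= 1 ->
  m i @[i --> \oo] --> +oo ->
  (m i * theta) `^ (- g) * Jtilde_red (m i) x theta @[i --> \oo] --> besselG nu (x * theta).
Proof.
move=> x0 t01 hm; have [A h] := expbd_besselcx nu1 x0 (@ltr01 R).
have t0 : 0 < theta by case/andP : t01.
pose q j i := (m i * theta) `^ (- g + j%:R) *
  Qint al (nu + j%:R) (expdiff (m i) j (besselcx nu x)) theta (m i * theta).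
have qlt j : (j < n)%N -> q j i @[i --> \oo] --> (0 : R).
  move=> jn; apply: Qint_cvg0 h _ _ _ => //.
  by rewrite addrC addrAC lerD2r lerBrDr natr1 ler_nat.
have qn : q n i @[i --> \oo] --> Gamma al * besselG nu (x * theta).
  (* For n = 0 the exponent nu + n may be negative, where [Qint_cvg] does not apply. After
     [Qint_split] the part of order al + 1 vanishes and the other has exponent nu + n + 1 >= 0. *)
  have c1 := @Qint_cvg0 (al + 1) (nu + n%:R) theta al _ _ n m
    (addr_gt0 al0 ltr01) (nuj1 n) h t01 hm (ltac:(by rewrite addrK)).
  have p0 : 0 <= nu + n%:R + 1.
    by rewrite addrAC addr_ge0// -lerBlDr sub0r ltW.
  have c2 := @Qint_cvg R al (nu + n%:R + 1) A theta _ n m al0 p0 h t01 hm.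
  rewrite psum_besselcx in c2; rewrite -[X in _ --> X]add0r.
  apply: cvg_trans (cvgD c1 c2); apply: near_eq_cvg; near=> i.
  have m1 : 1 <= m i by near: i; exact: (cvgry_ge hm).
  have m0 : 0 < m i by apply: lt_le_trans m1.
  have hj : expbd (2 ^+ n * A) 1 (expdiff (m i) n (besselcx nu x)).
    by apply: expbd_expdiff => //; rewrite ger0_norm// ltW.
  have t01' : 0 <= theta <= 1 by case/andP : t01 => /ltW -> ->.
  rewrite /q (Qint_split al0 (nuj1 n) hj t01'); last by rewrite mulr_ge0 ?(ltW m0) ?(ltW t0).
  by rewrite mulrDr [- g + _]addrC.
have E : \forall i \near \oo, (Gamma al)^-1 *
    (\sum_(j < n) RLcoef (al + nu) n j * q j i + q n i) =
    (m i * theta) `^ (- g) * Jtilde_red (m i) x theta.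
  near=> i; have m0 : 0 < m i by near: i; exact: (cvgry_gt hm).
  have r0 : 0 < m i * theta by rewrite mulr_gt0.
  rewrite /Jtilde_red [RHS]mulrCA; congr (_ * _).
  rewrite big_ord_recr/= RLcoef_diag mul1r mulrDr mulr_sumr.
  congr (_ + _).
    apply: eq_bigr => j _; rewrite /q gt0_powRD// powR_mulrn ?(ltW r0)//; ring.
  by rewrite /q gt0_powRD// powR_mulrn ?(ltW r0)//; ring.
apply: cvg_trans (near_eq_cvg E) _.
have c0 : \sum_(j < n) RLcoef (al + nu) n j * q j i @[i --> \oo] --> (0 : R).
  rewrite [X in _ --> X](_ : _ = \sum_(j < n) RLcoef (al + nu) n j * 0); last first.
    by rewrite big1// => j _; rewrite mulr0.
  apply: cvg_big => [|j _]; first exact: add_continuous.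
  by apply: cvgMl_tmp; exact: qlt.
have c1 : \sum_(j < n) RLcoef (al + nu) n j * q j i + q n i @[i --> \oo] -->
    0 + Gamma al * besselG nu (x * theta) by exact: cvgD.
rewrite -[X in _ `=>` nbhs X](mulKf (lt0r_neq0 (Gamma_gt0 al0))) -[X in _ * X]add0r.
by apply: cvgMl_tmp; exact: c1.
Unshelve. all: by end_near. Qed.

End order.

End LeftKernel.

(** * Uniform bounds on powers and concentration at an endpoint *)

Section DominatedLimits.
Context {R : realType}.

(** It replaces the shifted times l + d by l in powers of either sign, once l is large compared with
    d. *)
Lemma powR_comparable (u v q : R) : 0 < u -> 0 < v -> u <= 2 * v -> v <= 2 * u ->
  u `^ q <= 2 `^ `|q| * v `^ q.
Proof.
move=> u0 v0 uv vu; have [q0|q0] := leP 0 q.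
  rewrite ger0_norm// -powRM ?(ltW v0)//.
  by apply: ge0_ler_powR => //; rewrite ?nnegrE ?mulr_ge0 ?(ltW u0) ?(ltW v0).
have p0 : 0 <= - q by rewrite oppr_ge0 ltW.
have E z : z `^ q = (z `^ (- q))^-1 by rewrite -powRN opprK.
rewrite (E u) (E v) ltr0_norm//.
have hv : v `^ (- q) <= 2 `^ (- q) * u `^ (- q).
  rewrite -powRM ?(ltW u0)//.
  by apply: ge0_ler_powR => //; rewrite ?nnegrE ?mulr_ge0 ?(ltW u0) ?(ltW v0).
by rewrite ler_pdivlMr ?powR_gt0// mulrC ler_pdivrMr ?powR_gt0.
Qed.

Lemma ler_powR2l_neg (q u v : R) : q <= 0 -> 0 < u -> u <= v -> v `^ q <= u `^ q.
Proof.
move=> q0 u0 uv; have v0 : 0 < v by apply: lt_le_trans uv.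
rewrite -[q]opprK powRN [leRHS]powRN lef_pV2 ?posrE ?powR_gt0//.
by apply: ge0_ler_powR; rewrite ?nnegrE ?(ltW u0) ?(ltW v0) ?oppr_ge0.
Qed.

(* [r / (1 + r)] lies between [theta / 2] and [1] when [theta <= r]. *)
Lemma powR_ratio_le (q theta r : R) : 0 < theta <= 1 -> theta <= r ->
  (r / (1 + r)) `^ q <= 2 `^ `|q| * (1 + theta `^ q).
Proof.
move=> /andP[t0 t1] tr; have r0 : 0 < r by apply: lt_le_trans tr.
have r10 : 0 < 1 + r by rewrite addr_gt0.
have k0 : 0 < r / (1 + r) by rewrite divr_gt0.
have k1 : r / (1 + r) <= 1 by rewrite ler_pdivrMr// mul1r lerDr.
have p1 : 1 <= 2 `^ `|q| by rewrite -[leLHS](powRr0 2) ler_powR// ler1n.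
have [q0|q0] := leP 0 q.
  apply: (@le_trans _ _ 1).
    by rewrite -[leRHS](powRr0 (r / (1 + r))) ger_powR// k0.
  by rewrite mulr_ege1// lerDl powR_ge0.
apply: (@le_trans _ _ (2 `^ `|q| * theta `^ q)); last first.
  by rewrite ler_wpM2l ?powR_ge0// lerDr.
have t20 : 0 < theta / 2 by rewrite divr_gt0.
have h : theta / 2 <= r / (1 + r).
  rewrite ler_pdivlMr//.
  have : theta * r <= 1 * r by rewrite ler_wpM2r ?(ltW r0).
  by lra.
apply: le_trans (ler_powR2l_neg (ltW q0) t20 h) _.
rewrite mulrC ltr0_norm// powRM ?(ltW t0) ?invr_ge0// ler_wpM2r ?powR_ge0//.
by rewrite -powR_inv1// -powRrM mulN1r.
Qed.

(** l/(1 + l theta) lies between 1/2 and 1/theta; the upper bound serves for q >= 0 and the lower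
    one for q < 0. *)
Lemma powR_ratio_le' (q theta l : R) : 0 < theta <= 1 -> 1 <= l ->
  (l / (1 + l * theta)) `^ q <= 2 `^ `|q| * (1 + theta `^ (- q)).
Proof.
move=> /andP[t0 t1] l1; have l0 : 0 < l by apply: lt_le_trans l1.
have r0 : 0 < l * theta by rewrite mulr_gt0.
have r10 : 0 < 1 + l * theta by rewrite addr_gt0.
have k0 : 0 < l / (1 + l * theta) by rewrite divr_gt0.
have p1 : 1 <= 2 `^ `|q| by rewrite -[leLHS](powRr0 2) ler_powR// ler1n.
have [q0|q0] := leP 0 q.
  apply: (@le_trans _ _ (theta `^ (- q))); last first.
    apply: (@le_trans _ _ (1 * (1 + theta `^ (- q)))); first by rewrite mul1r lerDr.
    by rewrite ler_wpM2r// addr_ge0// powR_ge0.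
  have -> : theta `^ (- q) = (theta^-1) `^ q.
    by rewrite -powR_inv1 ?(ltW t0)// -powRrM mulN1r.
  apply: ge0_ler_powR; rewrite ?nnegrE ?invr_ge0 ?(ltW t0) ?(ltW k0)//.
  rewrite ler_pdivrMr// mulrDr mulr1 mulrCA mulVf ?gt_eqF// mulr1.
  by rewrite lerDr invr_ge0 ltW.
apply: (@le_trans _ _ (2 `^ `|q|)); last first.
  by rewrite ler_peMr ?powR_ge0// lerDl powR_ge0.
have h : 2^-1 <= l / (1 + l * theta).
  rewrite ler_pdivlMr//.
  have : l * theta <= l * 1 by rewrite ler_wpM2l ?(ltW l0).
  by lra.
have h20 : 0 < 2^-1 :> R by [].
apply: le_trans (ler_powR2l_neg (ltW q0) h20 h) _.
by rewrite ltr0_norm// -powR_inv1// -powRrM mulN1r.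
Qed.

(** The point of concentration, where [w] would vanish, is outside [D]: the exponential kills the
    integrand pointwise while [g] alone dominates it. *)
Lemma Rint_cvg0 (D : set R) (f_ : nat -> R -> R) (g w : R -> R) (l : nat -> R) :
  measurable D -> l i @[i --> \oo] --> +oo ->
  (\forall i \near \oo, measurable_fun D (f_ i)) ->
  integ D g -> (forall t, D t -> 0 < w t) ->
  (\forall i \near \oo, forall t, D t -> `|f_ i t| <= g t * expR (- (l i * w t))) ->
  \int[mu]_(t in D) f_ i t @[i --> \oo] --> (0 : R).
Proof.
move=> mD hl mf ig w0 fg.
have H2 t : D t -> f_ i t @[i --> \oo] --> (0 : R).
  move=> Dt; apply: norm_cvg0.
  have c0 : g t * expR (- (l i * w t)) @[i --> \oo] --> (0 : R).
    rewrite -(mulr0 (g t)); apply: cvgMl_tmp.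
    have : expR (- z) @[z --> +oo] --> (0 : R) by exact: cvgr_expR.
    move=> he; have hlw : l i * w t @[i --> \oo] --> +oo.
      apply/cvgryPge => A; near=> i; rewrite -ler_pdivrMr ?w0//.
      by near: i; exact: (cvgry_ge hl).
    exact: (cvg_comp _ _ hlw he).
  apply: (@squeeze_cvgr _ _ _ _ (cst 0) _ _ _ _ _ c0); last exact: cvg_cst.
  near=> i; rewrite normr_ge0/=.
  by move: t Dt {c0}; near: i.
have H4 : \forall i \near \oo, forall t, D t -> `|f_ i t| <= g t.
  near=> i => t Dt; have h : `|f_ i t| <= g t * expR (- (l i * w t)).
    by move: t Dt; near: i.
  have e1 : expR (- (l i * w t)) <= 1.
    rewrite -[leRHS]expR0 ler_expR oppr_le0 mulr_ge0 ?(ltW (w0 _ Dt))//.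
    by near: i; exact: (cvgry_ge hl).
  have e0 : 0 < expR (- (l i * w t)) by exact: expR_gt0.
  have g0 : 0 <= g t by rewrite -(pmulr_lge0 _ e0) (le_trans _ h).
  by apply: le_trans h _; rewrite ler_piMr.
have [_] := Rintegral_dominated_cvg mD mf H2 ig H4.
by rewrite Rintegral_cst// mul0r.
Unshelve. all: by end_near. Qed.

(** Moving k out of the integral requires [f_ i] to be integrable, which follows from the bound on k
    f after division by k > 0. *)
Lemma Rint_scaled_cvg0 (D : set R) (f_ : nat -> R -> R) (g w : R -> R) (l k : nat -> R) :
  measurable D -> l i @[i --> \oo] --> +oo ->
  (\forall i \near \oo, 0 < k i) ->
  (\forall i \near \oo, measurable_fun D (f_ i)) ->
  integ D g -> (forall t, D t -> 0 < w t) ->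
  (\forall i \near \oo, forall t, D t -> `|k i * f_ i t| <= g t * expR (- (l i * w t))) ->
  k i * \int[mu]_(t in D) f_ i t @[i --> \oo] --> (0 : R).
Proof.
move=> mD hl k0 mf ig w0 fg.
have mf' : \forall i \near \oo, measurable_fun D (fun t => k i * f_ i t).
  near=> i; have m1 : measurable_fun D (f_ i) by near: i; exact: mf.
  exact: measurable_funM.
apply: cvg_trans (Rint_cvg0 mD hl mf' ig w0 fg); apply: near_eq_cvg; near=> i.
have m1 : measurable_fun D (fun t => k i * f_ i t) by near: i.
have fgi : forall t, D t -> `|k i * f_ i t| <= g t * expR (- (l i * w t)) by near: i.
have ki : 0 < k i by near: i.
have gi : forall t, D t -> `|k i * f_ i t| <= `|g t|.
  move=> t Dt; apply: le_trans (fgi t Dt) _.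
  have e1 : expR (- (l i * w t)) <= 1.
    rewrite -[leRHS]expR0 ler_expR oppr_le0 mulr_ge0 ?(ltW (w0 _ Dt))//.
    by near: i; exact: (cvgry_ge hl).
  apply: le_trans (ler_wpM2r (expR_ge0 _) (ler_norm _)) _.
  by rewrite ler_piMr.
have ik : integ D (fun t => k i * f_ i t).
  have ign : integ D (fun t => `|g t|) by exact: (integrable_norm (mu := mu)).
  exact: integrable_dom ign gi.
have if_ : integ D (f_ i).
  apply: integrable_eq (integrableZ (k i)^-1 mD ik) => // t _.
  by rewrite mulKf// gt_eqF.
by rewrite RintegralZl.
Unshelve. all: by end_near. Qed.

End DominatedLimits.

(** * The kernel D after normalization *)

Section LeftKernelAsymptotics.
Context {R : realType}.
Variables nu kappa : R.
Hypotheses (nu1 : -1 < nu) (kappa0 : 0 <= kappa) (kappa_lt : kappa < 2 * (nu + 1)).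
Local Notation a := (nu - kappa / 2).
Local Notation b := (nu - kappa).

Lemma measurable_fun_eqD (D : set R) (f h : R -> R) :
  (forall t, D t -> f t = h t) -> measurable_fun D f -> measurable_fun D h.
Proof. by move=> fh; apply: eq_measurable_fun => t /set_mem; exact: fh. Qed.

Lemma measurable_JtildeD (g x s : R) : 0 < x -> 1 <= 2 * s ->
  measurable_fun (`]0, 1[%classic : set R) (fun theta => JtildeD nu g theta 1 x s).
Proof.
move=> x0 m1.
apply: (@measurable_fun_eqD _ (fun theta => (theta * x) `^ nu *
   expR (2 * s * theta) * Jtilde_red nu g (2 * s) x theta)).
  move=> theta; rewrite /= in_itv/= => /andP[t0 t1].
  by rewrite (JtildeDE nu1 g (m := 2 * s))// t0 ltW.
apply: measurable_funTS; apply: measurable_funM; last exact: measurable_Jtilde_red.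
apply: measurable_funM.
  apply: (measurableT_comp (f := fun z : R => z `^ nu)); first exact: measurable_powR.
  exact: measurable_funM.
by apply: measurableT_comp => //; exact: measurable_funM.
Qed.

Lemma measurable_JhatD (g x s : R) : 0 < x -> 1 < - (2 * s) ->
  measurable_fun (`]0, +oo[%classic : set R) (fun theta => JhatD nu g theta 1 x s).
Proof.
move=> x0 m1.
apply: (@measurable_fun_eqD _ (fun theta => (- (2 * s) * theta) `^ g *
  expR (- (- (2 * s) * theta * 1)) * Jhat_red nu g (- (2 * s)) x (theta * 1))).
  move=> theta; rewrite /= in_itv/= andbT => t0.
  by rewrite (JhatDE nu1 g t0 ltr01 x0 m1).
apply: measurable_funTS; apply: measurable_funM; last first.
  apply: (measurableT_comp (measurable_Jhat_red nu1 g x0 (ltW m1))).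
  exact: measurable_funM.
apply: measurable_funM.
  apply: (measurableT_comp (f := fun z : R => z `^ g)); first exact: measurable_powR.
  exact: measurable_funM.
by do 2 apply: measurableT_comp => //; apply: measurable_funM.
Qed.

Lemma measurable_JhatI (x s : R) : 0 < x -> 2 <= - (2 * s) ->
  measurable_fun (`]0, +oo[%classic : set R) (fun theta => JhatI nu kappa theta x s).
Proof.
move=> x0 m2.
apply: (@measurable_fun_eqD _ (fun theta => (- (2 * s) * theta) `^ b *
  expR (- (- (2 * s) * theta)) * JhatI_red nu kappa (- (2 * s)) x theta)).
  move=> theta; rewrite /= in_itv/= andbT => t0.
  by rewrite (JhatIE nu1 kappa_lt t0 x0 m2).
have m1 : 1 <= - (2 * s) by apply: le_trans m2; rewrite ler1n.
apply: measurable_funTS; apply: measurable_funM; last exact: measurable_JhatI_red.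
apply: measurable_funM.
  apply: (measurableT_comp (f := fun z : R => z `^ b)); first exact: measurable_powR.
  exact: measurable_funM.
do 2 apply: measurableT_comp => //; exact: measurable_funM.
Qed.

Lemma JtildeD_le (g x : R) : 0 < x -> exists2 C, 0 < C & forall s theta : R,
  1 <= 2 * s -> 0 < theta <= 1 ->
  `|JtildeD nu g theta 1 x s| <=
  C * (theta `^ nu * ((1 + 2 * s * theta) `^ g * expR (2 * s * theta))).
Proof.
move=> x0; have [C C0 hC] := Jtilde_red_le nu1 g x0.
exists (C * x `^ nu); first by rewrite mulr_gt0 ?powR_gt0.
move=> s theta m1 t01; have /andP[t0 t1] := t01.
rewrite (JtildeDE nu1 g t01 x0 m1 erefl) normrM.
rewrite [`|_ `^ _ * _|]ger0_norm ?mulr_ge0 ?powR_ge0 ?expR_ge0//.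
apply: le_trans (ler_wpM2l _ (hC _ _ m1 t01)) _.
  by rewrite mulr_ge0 ?powR_ge0 ?expR_ge0.
by rewrite powRM ?(ltW t0) ?(ltW x0)//; apply: eq_ler; ring.
Qed.

Lemma JhatD_le (g x : R) : 0 < x -> exists2 C, 0 < C & forall s theta : R,
  2 <= - (2 * s) -> 0 < theta ->
  `|JhatD nu g theta 1 x s| <=
  C * ((- (2 * s) * theta) `^ g * expR (- (- (2 * s) * theta)) * expR theta).
Proof.
move=> x0; have [C C0 hC] := Jhat_red_le nu1 g x0.
exists C => // s theta m2 t0.
have m1 : 1 < - (2 * s) by apply: lt_le_trans m2; rewrite ltr1n.
rewrite (JhatDE nu1 g t0 ltr01 x0 m1 erefl) !mulr1 normrM.
rewrite [`|_ `^ _ * _|]ger0_norm ?mulr_ge0 ?powR_ge0 ?expR_ge0// [leRHS]mulrCA.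
by rewrite ler_wpM2l ?hC ?(ltW t0)// mulr_ge0 ?powR_ge0 ?expR_ge0.
Qed.

Lemma JhatI_le (x : R) : 0 < x -> exists2 C, 0 < C & forall s theta : R,
  2 <= - (2 * s) -> 0 < theta ->
  `|JhatI nu kappa theta x s| <=
  C * ((- (2 * s) * theta) `^ b *
       ((1 + - (2 * s) * theta) / (- (2 * s) * theta)) `^ a *
       expR (- (- (2 * s) * theta)) * expR theta).
Proof.
move=> x0; have [C C0 hC] := JhatI_red_le nu1 kappa_lt x0.
exists C => // s theta m2 t0.
rewrite (JhatIE nu1 kappa_lt t0 x0 m2 erefl) normrM.
rewrite [`|_ `^ _ * _|]ger0_norm ?mulr_ge0 ?powR_ge0 ?expR_ge0//.
apply: le_trans (ler_wpM2l _ (hC _ _ m2 t0)) _.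
  by rewrite mulr_ge0 ?powR_ge0 ?expR_ge0.
by apply: eq_ler; ring.
Qed.

(** The two times share the scale l and have offsets d1 and d2. The threshold on l makes l + d and l
    comparable up to a factor 2, and theta < 1 bounds the exponentials of the offsets by K. *)
Lemma JtildeD_mul_le (g1 g2 x y d1 d2 : R) : 0 < x -> 0 < y ->
  exists2 C, 0 < C & forall s t l theta : R,
  4 + 2 * `|d1| + 2 * `|d2| <= l -> 2 * s = l + d1 -> 2 * t = l + d2 ->
  0 < theta < 1 ->
  `|JtildeD nu g1 theta 1 x s * JtildeD nu g2 theta 1 y t| <=
  C * (theta `^ (nu + nu) * (1 + l * theta) `^ (g1 + g2) * expR (2 * l * theta)).
Proof.
move=> x0 y0; have [C1 C10 h1] := JtildeD_le g1 x0; have [C2 C20 h2] := JtildeD_le g2 y0.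
pose K := expR (`|d1| + `|d2|).
have K0 : 0 < K by exact: expR_gt0.
exists (C1 * C2 * (2 `^ `|g1|) * (2 `^ `|g2|) * K).
  by rewrite !mulr_gt0 ?powR_gt0.
move=> s t l theta hl ms mt /andP[t0 t1].
have [n1 n2] : 0 <= `|d1| /\ 0 <= `|d2| by [].
have [a1 a2] : - `|d1| <= d1 <= `|d1| /\ - `|d2| <= d2 <= `|d2|.
  by split; rewrite -ler_norml.
have lp : 0 < l by lra.
have s1 : 1 <= 2 * s by lra.
have u1 : 1 <= 2 * t by lra.
have t01 : 0 < theta <= 1 by rewrite t0 ltW.
rewrite normrM.
have := ler_pM (normr_ge0 _) (normr_ge0 _) (h1 _ _ s1 t01) (h2 _ _ u1 t01).
move=> /le_trans; apply.
have l1 : 0 < 1 + l * theta by rewrite addr_gt0 ?mulr_gt0.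
have c1 : (1 + 2 * s * theta) `^ g1 <= 2 `^ `|g1| * (1 + l * theta) `^ g1.
  apply: powR_comparable => //.
  - by rewrite addr_gt0 ?mulr_gt0//; lra.
  - have : 2 * s * theta <= 2 * l * theta by rewrite ler_wpM2r ?(ltW t0)//; lra.
    by lra.
  - have : l * theta <= 2 * (2 * s) * theta by rewrite ler_wpM2r ?(ltW t0)//; lra.
    by lra.
have c2 : (1 + 2 * t * theta) `^ g2 <= 2 `^ `|g2| * (1 + l * theta) `^ g2.
  apply: powR_comparable => //.
  - by rewrite addr_gt0 ?mulr_gt0//; lra.
  - have : 2 * t * theta <= 2 * l * theta by rewrite ler_wpM2r ?(ltW t0)//; lra.
    by lra.
  - have : l * theta <= 2 * (2 * t) * theta by rewrite ler_wpM2r ?(ltW t0)//; lra.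
    by lra.
have e1 : expR (2 * s * theta) * expR (2 * t * theta) <= K * expR (2 * l * theta).
  rewrite /K -!expRD ler_expR ms mt.
  have : d1 * theta <= `|d1| * 1.
    by apply: le_trans (ler_wpM2r (ltW t0) _) (ler_wpM2l n1 (ltW t1)); lra.
  have : d2 * theta <= `|d2| * 1.
    by apply: le_trans (ler_wpM2r (ltW t0) _) (ler_wpM2l n2 (ltW t1)); lra.
  by lra.
apply: (@le_trans _ _ (C1 * C2 * (theta `^ nu * theta `^ nu) *
    (((1 + 2 * s * theta) `^ g1 * (1 + 2 * t * theta) `^ g2) *
     (expR (2 * s * theta) * expR (2 * t * theta))))).
  by apply: eq_ler; ring.
apply: (@le_trans _ _ (C1 * C2 * (theta `^ nu * theta `^ nu) *
    (((2 `^ `|g1| * (1 + l * theta) `^ g1) * (2 `^ `|g2| * (1 + l * theta) `^ g2)) *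
     (K * expR (2 * l * theta))))); last first.
  rewrite !gt0_powRD//; apply: eq_ler; ring.
apply: ler_wpM2l; first by rewrite !mulr_ge0 ?powR_ge0 ?(ltW C10) ?(ltW C20).
by apply: ler_pM => //; rewrite ?mulr_ge0 ?powR_ge0 ?expR_ge0//; apply: ler_pM; rewrite ?powR_ge0.
Qed.

(** In both products the orders -b - 1 and -b add up to -(2b + 1), whence the power of l in the
    normalization; each factor grows like exp (l theta) up to a constant, whence exp (-2l). *)
Lemma Dker_cvg0 (x y d1 d2 : R) (l s t : nat -> R) : 0 < x -> 0 < y ->
  l i @[i --> \oo] --> +oo ->
  (forall i, 2 * - s i = l i + d1) -> (forall i, 2 * - t i = l i + d2) ->
  (l i) `^ (2 * b + 1) * expR (- (2 * l i)) * Dker nu kappa (s i) x (t i) y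
    @[i --> \oo] --> (0 : R).
Proof.
move=> x0 y0 hl hs ht.
have [C1 C10 h1] := JtildeD_mul_le (- b - 1) (- b) d1 d2 x0 y0.
have [C2 C20 h2] := JtildeD_mul_le (- b) (- b - 1) d1 d2 x0 y0.
have mD : measurable (`]0, 1[%classic : set R) by exact: measurable_itv.
pose k i := (l i) `^ (2 * b + 1) * expR (- (2 * l i)).
pose f_ i (theta : R) := theta `^ (1 - kappa) *
     (JtildeD nu (- b - 1) theta 1 x (- s i) * JtildeD nu (- b) theta 1 y (- t i)
      - JtildeD nu (- b) theta 1 x (- s i) * JtildeD nu (- b - 1) theta 1 y (- t i)).
(* theta^(1 - kappa) and the two factors theta^nu meet a power 2b + 1 of l/(1 + l theta), which
   costs theta^(-(2b+1)) and leaves the exponent kappa. The exponent 1 - kappa + 2 nu exceeds -1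
   exactly when kappa < 2 (nu + 1). *)
pose g (theta : R) := (C1 + C2) * 2 `^ `|2 * b + 1| *
  (theta `^ (1 - kappa + (nu + nu)) + theta `^ kappa).
suff H : k i * \int[mu]_(theta in `]0, 1[) f_ i theta @[i --> \oo] --> (0 : R).
  rewrite -(mulr0 (- (4 * (x * y) `^ (kappa / 2))^-1)).
  rewrite (_ : (fun i => _) = (fun i => - (4 * (x * y) `^ (kappa / 2))^-1 *
      (k i * \int[mu]_(theta in `]0, 1[) f_ i theta))); first exact: cvgMl_tmp.
  by apply/funext => i; rewrite /Dker mulrCA.
apply: (@Rint_scaled_cvg0 R `]0, 1[ f_ g (fun theta => 2 * (1 - theta)) l k mD hl).
- near=> i; rewrite /k mulr_gt0 ?expR_gt0// powR_gt0//.
  by near: i; exact: (cvgry_gt hl).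
- near=> i.
  have s1 : 1 <= 2 * - s i.
    by rewrite hs -lerBlDr; near: i; exact: (cvgry_ge hl).
  have t1 : 1 <= 2 * - t i.
    by rewrite ht -lerBlDr; near: i; exact: (cvgry_ge hl).
  apply: measurable_funM; first by apply: measurable_funTS; exact: measurable_powR.
  by apply: measurable_funB; apply: measurable_funM; exact: measurable_JtildeD.
- apply: integrableZ => //; apply: integrable_add => //; apply: integrable_powR01.
    by have := kappa_lt; lra.
  by rewrite (lt_le_trans _ kappa0).
- by move=> theta; rewrite /= in_itv/= => /andP[t0 t1]; rewrite mulr_gt0// subr_gt0.
- near=> i => theta; rewrite /= in_itv/= => t01; have /andP[t0 t1] := t01.
  have L : 4 + 2 * `|d1| + 2 * `|d2| <= l i by near: i; exact: (cvgry_ge hl).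
  have [n1 n2] : 0 <= `|d1| /\ 0 <= `|d2| by [].
  have l1 : 1 <= l i by lra.
  have l0 : 0 < l i by lra.
  have lt0 : 0 < 1 + l i * theta by rewrite addr_gt0 ?mulr_gt0.
  have e1 := h1 _ _ _ _ L (hs i) (ht i) t01.
  have e2 := h2 _ _ _ _ L (hs i) (ht i) t01.
  pose W := theta `^ (nu + nu) * (1 + l i * theta) `^ (- (2 * b + 1)) * expR (2 * l i * theta).
  have w1 : - b - 1 - b = - (2 * b + 1) by ring.
  have w2 : - b + (- b - 1) = - (2 * b + 1) by ring.
  rewrite w1 -/W in e1; rewrite w2 -/W in e2.
  have k0 : 0 <= k i by rewrite mulr_ge0 ?powR_ge0 ?expR_ge0.
  rewrite normrM (ger0_norm k0) /f_ normrM (ger0_norm (powR_ge0 _ _)).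
  apply: (@le_trans _ _ (k i * (theta `^ (1 - kappa) * ((C1 + C2) * W)))).
    rewrite ler_wpM2l// ler_wpM2l ?powR_ge0// mulrDl.
    by apply: le_trans (ler_normB _ _) (lerD e1 e2).
  have r := powR_ratio_le' (2 * b + 1) (ltac:(by rewrite t0 ltW) : 0 < theta <= 1) l1.
  have -> : k i * (theta `^ (1 - kappa) * ((C1 + C2) * W)) =
    (C1 + C2) * theta `^ (1 - kappa + (nu + nu)) *
     (l i / (1 + l i * theta)) `^ (2 * b + 1) * expR (- (l i * (2 * (1 - theta)))).
    have -> : (l i / (1 + l i * theta)) `^ (2 * b + 1) =
       (l i) `^ (2 * b + 1) * (1 + l i * theta) `^ (- (2 * b + 1)).
      rewrite powRM ?invr_ge0 ?(ltW l0) ?(ltW lt0)//; congr (_ * _).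
      by rewrite -powR_inv1 ?(ltW lt0)// -powRrM mulN1r.
    have -> : expR (- (l i * (2 * (1 - theta)))) = expR (- (2 * l i)) * expR (2 * l i * theta).
      by rewrite -expRD; congr expR; ring.
    by rewrite (gt0_powRD (1 - kappa) (nu + nu) t0) /k /W; ring.
  apply: ler_wpM2r; first exact: expR_ge0.
  rewrite /g; apply: (@le_trans _ _ ((C1 + C2) * theta `^ (1 - kappa + (nu + nu)) *
     (2 `^ `|2 * b + 1| * (1 + theta `^ (- (2 * b + 1)))))).
    by apply: ler_wpM2l => //; rewrite mulr_ge0 ?powR_ge0// addr_ge0// ltW.
  have -> : theta `^ kappa = theta `^ (1 - kappa + (nu + nu)) * theta `^ (- (2 * b + 1)).
    by rewrite -gt0_powRD//; congr (_ `^ _); ring.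
  by apply: eq_ler; ring.
Unshelve. all: by end_near. Qed.

End LeftKernelAsymptotics.

(** * The normalized kernel I and the limit of the integral in S *)

Section ConvergentKernels.
Context {R : realType}.
Variables nu kappa : R.
Hypotheses (nu1 : -1 < nu) (kappa0 : 0 <= kappa) (kappa_lt : kappa < 2 * (nu + 1)).
Local Notation a := (nu - kappa / 2).
Local Notation b := (nu - kappa).

Lemma powR_ratio_le1 (q r : R) : 1 <= r -> ((1 + r) / r) `^ q <= 2 `^ `|q|.
Proof.
move=> r1; have r0 : 0 < r by apply: lt_le_trans r1.
apply: (@le_trans _ _ (((1 + r) / r) `^ `|q|)).
  by rewrite ler_powR ?ler_norm// ler_pdivlMr// mul1r; lra.
apply: ge0_ler_powR => //; rewrite ?nnegrE ?divr_ge0 ?addr_ge0 ?(ltW r0)//.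
by rewrite ler_pdivrMr//; lra.
Qed.

Lemma integrable_powR_expR1y (q : R) :
  integ `]1, +oo[ (fun t => t `^ q * expR (- t)).
Proof.
have q0 : 0 < `|q| + 1 by rewrite ltr_wpDl.
have iG : integ `]1, +oo[ (fun t => t `^ `|q| * expR (- t)).
  have := integrable_Gamma q0; rewrite addrK => h.
  by apply: integrableS h => //; apply: subset_itvr; rewrite bnd_simp.
apply: integrable_dom iG _ => //.
  apply: measurable_funTS; apply: measurable_funM; first exact: measurable_powR.
  by apply: measurableT_comp.
move=> t; rewrite /= in_itv/= andbT => t1.
rewrite ger0_norm ?mulr_ge0 ?powR_ge0 ?expR_ge0// ler_wpM2r ?expR_ge0//.
by rewrite ler_powR ?ler_norm// ltW.
Qed.

(** For theta > 1 the rate is at least 1, so the power of (1 + r)/r is bounded; the orders b and b +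
    1 add up to 2b + 1. The 2 in the last exponential comes from the factors exp theta in the bounds
    on [JhatI] and [JhatD]. *)
Lemma JhatI_mul_le (x y d1 d2 : R) : 0 < x -> 0 < y ->
  exists2 C, 0 < C & forall s t l theta : R,
  4 + 2 * `|d1| + 2 * `|d2| <= l -> - (2 * s) = l + d1 -> - (2 * t) = l + d2 ->
  1 < theta ->
  `|JhatI nu kappa theta x s * JhatD nu (b + 1) theta 1 y t| <=
  C * ((l * theta) `^ (2 * b + 1) * expR (- (2 * l * theta)) *
       expR ((2 - d1 - d2) * theta)).
Proof.
move=> x0 y0; have [C1 C10 h1] := JhatI_le nu1 kappa_lt x0.
have [C2 C20 h2] := JhatD_le nu1 (b + 1) y0.
exists (C1 * C2 * 2 `^ `|a| * 2 `^ `|b| * 2 `^ `|b + 1|).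
  by rewrite !mulr_gt0 ?powR_gt0.
move=> s t l theta hl ms mt t1.
have [n1 n2] : 0 <= `|d1| /\ 0 <= `|d2| by [].
have [a1 a2] : - `|d1| <= d1 <= `|d1| /\ - `|d2| <= d2 <= `|d2|.
  by split; rewrite -ler_norml.
have t0 : 0 < theta by lra.
have s2 : 2 <= - (2 * s) by lra.
have u2 : 2 <= - (2 * t) by lra.
have l0 : 0 < l by lra.
have lt0 : 0 < l * theta by rewrite mulr_gt0.
rewrite normrM.
have := ler_pM (normr_ge0 _) (normr_ge0 _) (h1 _ _ s2 t0) (h2 _ _ u2 t0).
move=> /le_trans; apply; rewrite ms mt.
have r10 : 0 < (l + d1) * theta by rewrite mulr_gt0//; lra.
have r20 : 0 < (l + d2) * theta by rewrite mulr_gt0//; lra.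
have r11 : 1 <= (l + d1) * theta.
  by rewrite -[leLHS]mulr1 ler_pM//; lra.
have c1 : ((l + d1) * theta) `^ b <= 2 `^ `|b| * (l * theta) `^ b.
  apply: powR_comparable => //; rewrite mulrA ler_wpM2r ?(ltW t0)//; lra.
have c2 : ((l + d2) * theta) `^ (b + 1) <= 2 `^ `|b + 1| * (l * theta) `^ (b + 1).
  apply: powR_comparable => //; rewrite mulrA ler_wpM2r ?(ltW t0)//; lra.
have c3 := powR_ratio_le1 a r11.
have -> : 2 * b + 1 = b + (b + 1) by ring.
rewrite -[X in _ <= _ * X]mulrA.
have -> : expR (- (2 * l * theta)) * expR ((2 - d1 - d2) * theta) =
   expR (- ((l + d1) * theta)) * expR theta * (expR (- ((l + d2) * theta)) * expR theta).
  by rewrite -!expRD; congr expR; ring.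
rewrite (gt0_powRD b (b + 1) lt0).
set e1 := expR (- ((l + d1) * theta)). set e2 := expR (- ((l + d2) * theta)).
set e := expR theta.
have [e10 e20 e0] : [/\ 0 <= e1, 0 <= e2 & 0 <= e] by rewrite /e1 /e2 /e !expR_ge0.
apply: (@le_trans _ _ (C1 * C2 * e1 * e * e2 * e *
  (((l + d1) * theta) `^ b * ((l + d2) * theta) `^ (b + 1) * ((1 + (l + d1) * theta) / ((l + d1) * theta)) `^ a))).
  by apply: eq_ler; ring.
apply: (@le_trans _ _ (C1 * C2 * e1 * e * e2 * e *
  ((2 `^ `|b| * (l * theta) `^ b) * (2 `^ `|b + 1| * (l * theta) `^ (b + 1)) * 2 `^ `|a|))); last first.
  by apply: eq_ler; ring.
apply: ler_wpM2l; first by rewrite !mulr_ge0 ?(ltW C10) ?(ltW C20).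
apply: ler_pM => //; rewrite ?mulr_ge0 ?powR_ge0//.
by apply: ler_pM => //; rewrite ?powR_ge0.
Qed.

Lemma Iker_cvg0 (x y d1 d2 : R) (l s t : nat -> R) : 0 < x -> 0 < y ->
  l i @[i --> \oo] --> +oo ->
  (forall i, - (2 * s i) = l i + d1) -> (forall i, - (2 * t i) = l i + d2) ->
  (l i) `^ (- (2 * b + 1)) * expR (2 * l i) * Iker nu kappa (s i) x (t i) y
    @[i --> \oo] --> (0 : R).
Proof.
move=> x0 y0 hl hs ht.
have [C1 C10 h1] := JhatI_mul_le d1 d2 x0 y0.
have [C2 C20 h2] := JhatI_mul_le d2 d1 y0 x0.
have mD : measurable (`]1, +oo[%classic : set R) by exact: measurable_itv.
pose k i := (l i) `^ (- (2 * b + 1)) * expR (2 * l i).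
pose f_ i (theta : R) := theta `^ (kappa - 1) *
     (JhatI nu kappa theta x (s i) * JhatD nu (b + 1) theta 1 y (t i)
      - JhatD nu (b + 1) theta 1 x (s i) * JhatI nu kappa theta y (t i)).
pose D := d1 + d2.
(* One half of exp (-2 l (theta - 1)) is kept as the decay; the other half, for l >= 3 - D, turns
   exp ((2 - D) theta) into at most exp (3 - D - theta), which is integrable against any power. *)
pose g (theta : R) := (C1 + C2) * expR (3 - D) * (theta `^ (kappa - 1 + (2 * b + 1)) * expR (- theta)).
suff H : k i * \int[mu]_(theta in `]1, +oo[) f_ i theta @[i --> \oo] --> (0 : R).
  rewrite -(mulr0 (- (x * y) `^ (kappa / 2))).
  rewrite (_ : (fun i => _) = (fun i => - (x * y) `^ (kappa / 2) *
      (k i * \int[mu]_(theta in `]1, +oo[) f_ i theta))); first exact: cvgMl_tmp.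
  by apply/funext => i; rewrite /Iker mulrCA.
apply: (@Rint_scaled_cvg0 R `]1, +oo[ f_ g (fun theta => theta - 1) l k mD hl).
- near=> i; rewrite /k mulr_gt0 ?expR_gt0// powR_gt0//.
  by near: i; exact: (cvgry_gt hl).
- near=> i.
  have s2 : 2 <= - (2 * s i).
    by rewrite hs -lerBlDr; near: i; exact: (cvgry_ge hl).
  have t2 : 2 <= - (2 * t i).
    by rewrite ht -lerBlDr; near: i; exact: (cvgry_ge hl).
  have s1 : 1 < - (2 * s i) by rewrite (lt_le_trans _ s2)// ltr1n.
  have t1 : 1 < - (2 * t i) by rewrite (lt_le_trans _ t2)// ltr1n.
  have sub : (`]1, +oo[%classic : set R) `<=` `]0, +oo[%classic.
    by apply: subset_itvr; rewrite bnd_simp.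
  have mD0 : measurable (`]0, +oo[%classic : set R) by exact: measurable_itv.
  apply: measurable_funM; first by apply: measurable_funTS; exact: measurable_powR.
  apply: measurable_funB; apply: measurable_funM; apply: (measurable_funS mD0 sub);
   by [exact: measurable_JhatD|exact: measurable_JhatI].
- by apply: integrableZ => //; exact: integrable_powR_expR1y.
- by move=> theta; rewrite /= in_itv/= andbT => t1; rewrite subr_gt0.
- near=> i => theta; rewrite /= in_itv/= andbT => t1.
  have t0 : 0 < theta by rewrite (lt_trans _ t1).
  have L : 4 + 2 * `|d1| + 2 * `|d2| <= l i by near: i; exact: (cvgry_ge hl).
  have L' : 4 + 2 * `|d2| + 2 * `|d1| <= l i by rewrite addrAC.
  have L3 : 3 - D <= l i by near: i; exact: (cvgry_ge hl).
  have [n1 n2] : 0 <= `|d1| /\ 0 <= `|d2| by [].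
  have l0 : 0 < l i by lra.
  have e1 := h1 _ _ _ _ L (hs i) (ht i) t1.
  have e2 := h2 _ _ _ _ L' (ht i) (hs i) t1.
  pose W := (l i * theta) `^ (2 * b + 1) * expR (- (2 * l i * theta)) * expR ((2 - D) * theta).
  have w1 : 2 - d1 - d2 = 2 - D by rewrite /D; ring.
  have w2 : 2 - d2 - d1 = 2 - D by rewrite /D; ring.
  rewrite w1 -/W in e1; rewrite w2 -/W in e2.
  have k0 : 0 <= k i by rewrite mulr_ge0 ?powR_ge0 ?expR_ge0.
  rewrite normrM (ger0_norm k0) /f_ normrM (ger0_norm (powR_ge0 _ _)).
  apply: (@le_trans _ _ (k i * (theta `^ (kappa - 1) * ((C1 + C2) * W)))).
    rewrite ler_wpM2l// ler_wpM2l ?powR_ge0// mulrDl.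
    apply: le_trans (ler_normB _ _) _.
    by rewrite [X in _ + `|X|]mulrC; exact: lerD e1 e2.
  have -> : k i * (theta `^ (kappa - 1) * ((C1 + C2) * W)) =
    (C1 + C2) * theta `^ (kappa - 1 + (2 * b + 1)) *
      expR (2 * l i - 2 * l i * theta + (2 - D) * theta).
    have -> : expR (2 * l i - 2 * l i * theta + (2 - D) * theta) =
      expR (2 * l i) * expR (- (2 * l i * theta)) * expR ((2 - D) * theta) by rewrite !expRD.
    rewrite (gt0_powRD (kappa - 1) (2 * b + 1) t0) /k /W powRM ?(ltW l0) ?(ltW t0)//.
    have -> : l i `^ (2 * b + 1) = (l i `^ (- (2 * b + 1)))^-1 by rewrite powRN invrK.
    by field; rewrite gt_eqF// powR_gt0.
  rewrite /g -!mulrA ler_wpM2l ?addr_ge0 ?(ltW C10) ?(ltW C20)//.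
  rewrite [leRHS]mulrCA ler_wpM2l ?powR_ge0// -!expRD ler_expR.
  have hq : 0 <= (l i - (3 - D)) * (theta - 1) by rewrite mulr_ge0 ?subr_ge0// ltW.
  by clear -hq; lra.
Unshelve. all: by end_near. Qed.

(** The powers r^(b+1) and r^b of the right differintegral and of the inner integral meet r^(-b-1)
    and r^(-b) of the left ones, and the exponentials cancel up to exp ((d2 - d1) theta). Two
    products survive with equal limits, which absorbs the factor 1/2 of S; the term with a is
    smaller by 1/r. *)
Lemma Sker0_cvg (x y d1 d2 : R) (l s t : nat -> R) : 0 < x -> 0 < y ->
  l i @[i --> \oo] --> +oo ->
  (forall i, - (2 * s i) = l i + d1) -> (forall i, - (2 * t i) = l i + d2) ->
  Sker0 nu kappa (s i) x (t i) y @[i --> \oo] -->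
   (x / y) `^ (kappa / 2) * \int[mu]_(theta in `]0, 1[)
     ((theta * y) `^ nu * expR ((d2 - d1) * theta) * (besselG nu (x * theta) * besselG nu (y * theta))).
Proof.
move=> x0 y0 hl hs ht.
have [CT1 CT10 hT1] := Jtilde_red_le nu1 (- b - 1) y0.
have [CT0 CT00 hT0] := Jtilde_red_le nu1 (- b) y0.
have [CH CH0 hH] := Jhat_red_le nu1 (b + 1) x0.
have [CI CI0 hI] := JhatI_red_le nu1 kappa_lt x0.
have mD : measurable (`]0, 1[%classic : set R) by exact: measurable_itv.
pose m1 i := l i + d1; pose m2 i := l i + d2.
have hm1 : m1 i @[i --> \oo] --> +oo.
  by apply/cvgryPge => A; near=> i; rewrite /m1 -lerBlDr; near: i; exact: (cvgry_ge hl).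
have hm2 : m2 i @[i --> \oo] --> +oo.
  by apply/cvgryPge => A; near=> i; rewrite /m2 -lerBlDr; near: i; exact: (cvgry_ge hl).
pose f_ i (theta : R) :=
    (JhatD nu (b + 1) theta 1 x (s i) * JtildeD nu (- b - 1) theta 1 y (- t i)
     - (a * JtildeD nu (- b - 1) theta 1 y (- t i) - JtildeD nu (- b) theta 1 y (- t i))
       * JhatI nu kappa theta x (s i)).
(* At unequal times the two rates differ; powers of m1 theta are expressed by those of m2 theta and
   of this ratio, which tends to 1. *)
pose rho i := m1 i / m2 i.
pose P theta := (theta * y) `^ nu * expR ((d2 - d1) * theta).
pose F i theta := P theta *
  (rho i `^ (b + 1) * Jhat_red nu (b + 1) (m1 i) x theta *
     ((m2 i * theta) `^ (- (- b - 1)) * Jtilde_red nu (- b - 1) (m2 i) y theta)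
   - (a * (m2 i * theta)^-1 * ((m2 i * theta) `^ (- (- b - 1)) * Jtilde_red nu (- b - 1) (m2 i) y theta)
      - (m2 i * theta) `^ (- - b) * Jtilde_red nu (- b) (m2 i) y theta) *
     (rho i `^ b * JhatI_red nu kappa (m1 i) x theta)).
have fF : \forall i \near \oo, forall theta, 0 < theta < 1 -> f_ i theta = F i theta.
  near=> i => theta /andP[t0 t1].
  have m12 : 2 <= m1 i by near: i; exact: (cvgry_ge hm1).
  have m21 : 1 <= m2 i by near: i; exact: (cvgry_ge hm2).
  have m11 : 1 < m1 i by rewrite (lt_le_trans _ m12)// ltr1n.
  have m10 : 0 < m1 i by rewrite (lt_trans _ m11).
  have m20 : 0 < m2 i by rewrite (lt_le_trans _ m21).
  have t01 : 0 < theta <= 1 by rewrite t0 ltW.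
  have E1 : m1 i = - (2 * s i) by rewrite hs.
  have E2 : m2 i = 2 * (- t i) by rewrite mulrN ht.
  have r20 : 0 < m2 i * theta by rewrite mulr_gt0.
  have r10 : 0 < m1 i * theta by rewrite mulr_gt0.
  have rho0 : 0 < rho i by rewrite divr_gt0.
  have pr q : (m1 i * theta) `^ q = rho i `^ q * (m2 i * theta) `^ q.
    by rewrite -powRM ?(ltW rho0) ?(ltW r20)//; congr (_ `^ q); rewrite /rho; field; rewrite gt_eqF.
  have ex : expR (m2 i * theta) = expR (m1 i * theta) * expR ((d2 - d1) * theta).
    by rewrite -expRD; congr expR; rewrite /m1 /m2; ring.
  rewrite /f_ (JhatDE nu1 (b + 1) t0 ltr01 x0 m11 E1).
  rewrite (JtildeDE nu1 (- b - 1) t01 y0 m21 E2) (JtildeDE nu1 (- b) t01 y0 m21 E2).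
  rewrite (JhatIE nu1 kappa_lt t0 x0 m12 E1) !mulr1 !pr ex expRN /F /P.
  have -> : - (- b - 1) = b + 1 by ring.
  have -> : - - b = b by ring.
  rewrite (gt0_powRD b 1 r20) powRr1 ?(ltW r20)//.
  move: (Jhat_red _ _ _ _ _) (Jtilde_red nu (- b - 1) _ _ _) (Jtilde_red nu (- b) _ _ _) (JhatI_red _ _ _ _ _) => H T1 T0 I.
  move: (rho i `^ (b + 1)) (rho i `^ b) ((m2 i * theta) `^ b) ((theta * y) `^ nu) (expR ((d2 - d1) * theta)) => A B E G0 K.
  have := expR_gt0 (m1 i * theta); move: (expR _) => e e0.
  move: r20; move: (m2 i * theta) => r r20.
  by field; rewrite !gt_eqF.
pose lim theta := 2 * (P theta * (besselG nu (x * theta) * besselG nu (y * theta))).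
have H2 theta : `]0, 1[%classic theta -> f_ i theta @[i --> \oo] --> lim theta.
  rewrite /= in_itv/= => t01; have /andP[t0 t1] := t01.
  have t01' : 0 < theta <= 1 by rewrite t0 ltW.
  have cFf : F i theta @[i --> \oo] --> lim theta -> f_ i theta @[i --> \oo] --> lim theta.
    apply: cvg_trans; apply: near_eq_cvg; near=> i.
    have H : forall theta, 0 < theta < 1 -> f_ i theta = F i theta by near: i.
    by rewrite H.
  apply: cFf.
  have m2V : (m2 i)^-1 @[i --> \oo] --> (0 : R).
    by apply/gtr0_cvgV0 => //; near=> i; near: i; exact: (cvgry_gt hm2).
  have rho1 : rho i @[i --> \oo] --> (1 : R).
    have c : 1 + (d1 - d2) * (m2 i)^-1 @[i --> \oo] --> 1 + (d1 - d2) * 0.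
      by apply: cvgD; [exact: cvg_cst|exact: cvgMl_tmp].
    rewrite mulr0 addr0 in c; apply: cvg_trans c; apply: near_eq_cvg; near=> i.
    have m20 : 0 < m2 i by near: i; exact: (cvgry_gt hm2).
    by rewrite /rho /m1 /m2; field; rewrite gt_eqF.
  have rhoq q : rho i `^ q @[i --> \oo] --> (1 : R).
    by have := cvg_powR (q := q) ltr01 rho1; rewrite powR1.
  have cH : Jhat_red nu (b + 1) (m1 i) x theta @[i --> \oo] --> besselG nu (x * theta).
    by apply: (Jhat_red_cvg nu1 (b + 1) x0 hm1 (cvg_cst theta)) => i; exact: ltW.
  have cI := JhatI_red_cvg nu1 kappa_lt x0 t0 hm1.
  have cT1 := Jtilde_red_cvg nu1 (- b - 1) y0 t01' hm2.
  have cT0 := Jtilde_red_cvg nu1 (- b) y0 t01' hm2.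
  have cV : a * (m2 i * theta)^-1 @[i --> \oo] --> a * 0.
    apply: cvgMl_tmp; rewrite -(mul0r theta^-1).
    by under eq_fun do rewrite invfM; exact: cvgMr_tmp.
  have -> : lim theta = P theta * (1 * besselG nu (x * theta) * besselG nu (y * theta) -
     (a * 0 * besselG nu (y * theta) - besselG nu (y * theta)) * (1 * besselG nu (x * theta))).
    by rewrite /lim; ring.
  apply: cvgMl_tmp; apply: cvgB.
    by apply: cvgM cT1; apply: cvgM.
  apply: cvgM; last by apply: cvgM.
  apply: cvgB cT0.
  exact: cvgM cT1.
pose K := expR (`|d1| + `|d2|).
have K0 : 0 <= K by exact: expR_ge0.
pose A1 := y `^ nu * K * (2 `^ `|b + 1| * (CH * expR 1) * (CT1 * 2 `^ `|b + 1|)).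
pose A2 := y `^ nu * K * ((`|a| * CT1 + CT0) * 2 `^ `|b| * (CI * expR 1) * 2 `^ `|a|
   * 2 `^ `|- (kappa / 2)|).
(* The cancellations leave powers of r/(1 + r) with the exponents b + 1 and b - a = - kappa/2, which
   [powR_ratio_le] turns into powers of theta. Multiplied by theta^nu, both are integrable at 0
   because kappa < 2 (nu + 1). *)
pose g theta := A1 * (theta `^ nu + theta `^ (nu + (b + 1))) +
   A2 * (theta `^ nu + theta `^ (nu + - (kappa / 2))).
have ig : integ `]0, 1[ g.
  apply: integrable_add => //; apply: integrableZ => //; apply: integrable_add => //;
   apply: integrable_powR01 => //; by have := kappa_lt; lra.
have H4 : \forall i \near \oo, forall theta, `]0, 1[%classic theta -> `|f_ i theta| <= g theta.
  near=> i => theta; rewrite /= in_itv/= => t01; have /andP[t0 t1] := t01.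
  have t01' : 0 < theta <= 1 by rewrite t0 ltW.
  have L : 4 + 2 * `|d1| + 2 * `|d2| <= l i by near: i; exact: (cvgry_ge hl).
  have [n1 n2] : 0 <= `|d1| /\ 0 <= `|d2| by [].
  have [a1 a2] : - `|d1| <= d1 <= `|d1| /\ - `|d2| <= d2 <= `|d2|.
    by split; rewrite -ler_norml.
  have [[m12 m21] [m1m2 m2m1]] : (2 <= m1 i /\ 1 <= m2 i) /\
      (m1 i <= 2 * m2 i /\ m2 i <= 2 * m1 i).
    by rewrite /m1 /m2; clear -L n1 n2 a1 a2; split; split; lra.
  have m10 : 0 < m1 i by rewrite (lt_le_trans _ m12).
  have m20 : 0 < m2 i by rewrite (lt_le_trans _ m21).
  have Ff : forall theta, 0 < theta < 1 -> f_ i theta = F i theta by near: i.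
  rewrite Ff// /F.
  pose r2 := m2 i * theta; pose r1 := m1 i * theta.
  have r20 : 0 < r2 by rewrite mulr_gt0.
  have r10 : 0 < r1 by rewrite mulr_gt0.
  have r210 : 0 < 1 + r2 by rewrite addr_gt0.
  have rho0 : 0 < rho i by rewrite divr_gt0.
  have rhoq q : rho i `^ q <= 2 `^ `|q|.
    have := @powR_comparable R (rho i) 1 q rho0 ltr01; rewrite powR1 !mulr1; apply.
      by rewrite /rho ler_pdivrMr.
    by rewrite /rho mulrA ler_pdivlMr// mul1r.
  have bH : `|Jhat_red nu (b + 1) (m1 i) x theta| <= CH * expR 1.
    apply: le_trans (hH _ _ m12 (ltW t0)) _.
    by rewrite ler_wpM2l ?(ltW CH0)// ler_expR ltW.
  have tr2 : theta <= r2 by rewrite /r2 ler_peMl// ltW.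
  have rat q : r2 `^ q * (1 + r2) `^ (- q) = (r2 / (1 + r2)) `^ q.
    rewrite powRM ?invr_ge0 ?(ltW r20) ?(ltW r210)//; congr (_ * _).
    by rewrite -powR_inv1 ?(ltW r210)// -powRrM mulN1r.
  have bT1 := hT1 _ _ m21 t01'; rewrite -/r2 in bT1.
  have bT0 := hT0 _ _ m21 t01'; rewrite -/r2 in bT0.
  have nb1 : - b - 1 = - (b + 1) by ring.
  rewrite nb1 in bT1.
  have bT1' : `|r2 `^ (- (- b - 1)) * Jtilde_red nu (- b - 1) (m2 i) y theta| <=
      CT1 * 2 `^ `|b + 1| * (1 + theta `^ (b + 1)).
    rewrite normrM (ger0_norm (powR_ge0 _ _)) nb1 opprK.
    apply: (@le_trans _ _ (CT1 * (r2 `^ (b + 1) * (1 + r2) `^ (- (b + 1))))).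
      by rewrite [leRHS]mulrCA ler_wpM2l ?powR_ge0.
    by rewrite rat -[leRHS]mulrA ler_wpM2l ?(ltW CT10)//; exact: powR_ratio_le.
  (* A common bound for both terms in the braces: the factor 1/r2 lowers r2^(b+1) to r2^b in the
     term with a, and (1 + r2)^(-(b+1)) is at most (1 + r2)^(-b). *)
  pose V := r2 `^ b * (1 + r2) `^ (- b).
  have V0 : 0 <= V by rewrite mulr_ge0 ?powR_ge0.
  have bT1'' : `|a * r2^-1 * (r2 `^ (- (- b - 1)) * Jtilde_red nu (- b - 1) (m2 i) y theta)| <=
      `|a| * CT1 * V.
    rewrite nb1 opprK (gt0_powRD b 1 r20) powRr1 ?(ltW r20)//.
    rewrite (_ : a * r2^-1 * (r2 `^ b * r2 * Jtilde_red nu (- (b + 1)) (m2 i) y theta) =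
      a * (r2 `^ b * Jtilde_red nu (- (b + 1)) (m2 i) y theta)); last first.
      by move: (Jtilde_red _ _ _ _ _) => T; field; rewrite gt_eqF.
    rewrite normrM -mulrA ler_wpM2l// normrM (ger0_norm (powR_ge0 _ _)) /V.
    rewrite mulrCA ler_wpM2l ?powR_ge0//; apply: le_trans bT1 _.
    by clear -CT10 r20; rewrite ler_wpM2l ?(ltW CT10)// ler_powR ?lerDl ?(ltW r20)//; lra.
  have bT0' : `|r2 `^ (- - b) * Jtilde_red nu (- b) (m2 i) y theta| <= CT0 * V.
    by rewrite opprK normrM (ger0_norm (powR_ge0 _ _)) mulrCA ler_wpM2l ?powR_ge0.
  have bI : `|JhatI_red nu kappa (m1 i) x theta| <= CI * expR 1 * (2 `^ `|a| * ((1 + r2) / r2) `^ a).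
    apply: le_trans (hI _ _ m12 t0) _; apply: ler_pM; rewrite ?powR_ge0//.
    - by rewrite mulr_ge0 ?expR_ge0 ?(ltW CI0).
    - by rewrite ler_wpM2l ?(ltW CI0)// ler_expR ltW.
    rewrite -/r1.
    have q1 : 0 < (1 + r1) / r1 by rewrite divr_gt0// addr_gt0.
    have q2 : 0 < (1 + r2) / r2 by rewrite divr_gt0.
    have r1r2 : r1 <= 2 * r2 by rewrite /r1 /r2 mulrA ler_wpM2r// ltW.
    have r2r1 : r2 <= 2 * r1 by rewrite /r1 /r2 mulrA ler_wpM2r// ltW.
    have pp : 0 < r1 * r2 by rewrite mulr_gt0.
    apply: powR_comparable => //; clear -q1 q2 r1r2 r2r1 pp r10 r20.
    - by rewrite mulrA ler_pdivrMr// mulrAC ler_pdivlMr//; lra.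
    - by rewrite mulrA ler_pdivrMr// mulrAC ler_pdivlMr//; lra.
  have VI : V * ((1 + r2) / r2) `^ a <= 2 `^ `|- (kappa / 2)| * (1 + theta `^ (- (kappa / 2))).
    rewrite /V rat.
    have -> : (1 + r2) / r2 = (r2 / (1 + r2))^-1 by rewrite invf_div.
    have k0 : 0 < r2 / (1 + r2) by rewrite divr_gt0.
    move: k0; set k := r2 / (1 + r2) => k0.
    have -> : k^-1 `^ a = k `^ (- a) by rewrite -powR_inv1 ?(ltW k0)// -powRrM mulN1r.
    rewrite -gt0_powRD//.
    have -> : b + - a = - (kappa / 2) by field.
    exact: powR_ratio_le.
  have PK : `|P theta| <= y `^ nu * K * theta `^ nu.
    rewrite /P ger0_norm ?mulr_ge0 ?powR_ge0 ?expR_ge0//.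
    rewrite powRM ?(ltW t0) ?(ltW y0)// [leRHS]mulrC mulrA ler_wpM2l ?mulr_ge0 ?powR_ge0//.
    rewrite /K ler_expR.
    apply: (@le_trans _ _ ((`|d1| + `|d2|) * theta)).
      by clear -a1 a2 t0; rewrite ler_wpM2r ?(ltW t0)//; lra.
    by rewrite ler_piMr ?addr_ge0 ?(ltW t1).
  rewrite normrM.
  apply: (@le_trans _ _ (y `^ nu * K * theta `^ nu *
    ((2 `^ `|b + 1| * (CH * expR 1)) * (CT1 * 2 `^ `|b + 1| * (1 + theta `^ (b + 1))) +
     (`|a| * CT1 * V + CT0 * V) * (2 `^ `|b| * (CI * expR 1 * (2 `^ `|a| * ((1 + r2) / r2) `^ a)))))).
    apply: ler_pM => //; apply: le_trans (ler_normB _ _) _; apply: lerD.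
      rewrite normrM; apply: ler_pM => //.
      by rewrite normrM (ger0_norm (powR_ge0 _ _)); apply: ler_pM; rewrite ?powR_ge0.
    rewrite normrM; apply: ler_pM => //.
      by apply: le_trans (ler_normB _ _) _; apply: lerD.
    by rewrite normrM (ger0_norm (powR_ge0 _ _)); apply: ler_pM; rewrite ?powR_ge0.
  rewrite mulrDr /g; apply: lerD.
    by rewrite (gt0_powRD nu (b + 1) t0) /A1; apply: eq_ler; ring.
  apply: (@le_trans _ _ (y `^ nu * K * theta `^ nu * ((`|a| * CT1 + CT0) * 2 `^ `|b| * (CI * expR 1) * 2 `^ `|a|) *
     (V * ((1 + r2) / r2) `^ a))).
    by apply: eq_ler; ring.
  apply: le_trans (ler_wpM2l _ VI) _.
    by rewrite !mulr_ge0 ?addr_ge0 ?mulr_ge0 ?powR_ge0 ?expR_ge0 ?(ltW CT10) ?(ltW CT00) ?(ltW CI0).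
  by rewrite (gt0_powRD nu (- (kappa / 2)) t0) /A2; apply: eq_ler; ring.
have H1 : \forall i \near \oo, measurable_fun (`]0, 1[%classic : set R) (f_ i).
  near=> i.
  have m12 : 2 <= m1 i by near: i; exact: (cvgry_ge hm1).
  have m21 : 1 <= m2 i by near: i; exact: (cvgry_ge hm2).
  have s2 : 2 <= - (2 * s i) by rewrite hs.
  have s1 : 1 < - (2 * s i) by rewrite (lt_le_trans _ s2)// ltr1n.
  have u1 : 1 <= 2 * - t i by rewrite mulrN ht.
  have sub : (`]0, 1[%classic : set R) `<=` `]0, +oo[%classic.
    by apply: subset_itvl; rewrite bnd_simp.
  have mD0 : measurable (`]0, +oo[%classic : set R) by exact: measurable_itv.
  have mI := measurable_funS mD0 sub (measurable_JhatI nu1 kappa_lt x0 s2).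
  have mH := measurable_funS mD0 sub (measurable_JhatD nu1 (b + 1) x0 s1).
  have mT1 := measurable_JtildeD nu1 (- b - 1) y0 u1.
  have mT0 := measurable_JtildeD nu1 (- b) y0 u1.
  have mA := @measurable_cst _ _ _ _ (`]0, 1[%classic : set R) a.
  exact: (measurable_funB (measurable_funM mH mT1)
    (measurable_funM (measurable_funB (measurable_funM mA mT1) mT0) mI)).
have [il H] := Rintegral_dominated_cvg mD H1 H2 ig H4.
rewrite /Sker0.
have E : (x / y) `^ (kappa / 2) * \int[mu]_(theta in `]0, 1[)
     ((theta * y) `^ nu * expR ((d2 - d1) * theta) * (besselG nu (x * theta) * besselG nu (y * theta))) =
   2^-1 * (x / y) `^ (kappa / 2) * \int[mu]_(theta in `]0, 1[) lim theta.
  have iP : integ `]0, 1[ (fun theta => P theta * (besselG nu (x * theta) * besselG nu (y * theta))).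
    apply: integrable_eq (integrableZ 2^-1 mD il) => // theta _.
    by rewrite /lim mulKf.
  by rewrite /lim RintegralZl// -/P; field.
rewrite E; apply: cvgMl_tmp; exact: H.
Unshelve. all: by end_near. Qed.

End ConvergentKernels.

(** * The limit kernel: Bessel's equation and the Christoffel-Darboux formula *)

Section HomogeneousKernel.
Context {R : realType}.
Variable nu : R.
Hypothesis nu1 : -1 < nu.
Local Notation G := (besselG nu).

Definition besselG1 (u : R) : R := psum (pseries_diffs (besselc nu)) u.
Definition besselG2 (u : R) : R := psum (pseries_diffs (pseries_diffs (besselc nu))) u.

Lemma is_derive_besselG (u : R) : is_derive u 1 G (besselG1 u).
Proof. by have [A h] := expbd_besselc nu1 (@ltr01 R); exact: (is_derive_psum u ler01 h). Qed.

Lemma is_derive_besselG1 (u : R) : is_derive u 1 besselG1 (besselG2 u).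
Proof.
have [A h] := expbd_besselc nu1 (@ltr01 R).
exact: (is_derive_psum u ler01 (expbd_diffs h)).
Qed.

(** Bessel's equation transported by J_nu (2 sqrt u) = u^(nu/2) G u; on the coefficients it is the
    recursion that [GammaS] gives. *)
Lemma besselG_ode (u : R) : u * besselG2 u + (nu + 1) * besselG1 u + G u = 0.
Proof.
have [A h] := expbd_besselc nu1 (@ltr01 R).
have h1 := expbd_diffs h; have h2 := expbd_diffs h1.
(* The coefficients of u G''(u): the factor u shifts the series by one place, and d 0 = 0 fills the
   gap. *)
pose d k : R := k%:R * (k.+1%:R * besselc nu k.+1).
have Ed : series (fun k => d k * u ^+ k) n @[n --> \oo] --> u * besselG2 u.
  rewrite -cvg_shiftS.
  rewrite (_ : (fun n => _) = (fun n => u * pseries (pseries_diffs (pseries_diffs (besselc nu))) u n)).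
    by apply: cvgMl_tmp; exact: (psum_cvg ler01 h2).
  apply/funext => n; rewrite /pseries /series/= big_nat_recl//= {1}/d !mul0r add0r.
  rewrite mulr_sumr; apply: eq_bigr => k _.
  by rewrite /d /pseries_diffs exprS; ring.
have E1 : (nu + 1) * pseries (pseries_diffs (besselc nu)) u n @[n --> \oo] --> (nu + 1) * besselG1 u.
  by apply: cvgMl_tmp; exact: (psum_cvg ler01 h1).
have E0 : pseries (besselc nu) u n @[n --> \oo] --> G u by exact: (psum_cvg ler01 h).
have S : series (fun k => d k * u ^+ k) n + (nu + 1) * pseries (pseries_diffs (besselc nu)) u n +
    pseries (besselc nu) u n @[n --> \oo] --> u * besselG2 u + (nu + 1) * besselG1 u + G u.
  by apply: cvgD => //; apply: cvgD.
have Z : (fun n => series (fun k => d k * u ^+ k) n + (nu + 1) * pseries (pseries_diffs (besselc nu)) u n +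
    pseries (besselc nu) u n) = (fun=> 0).
  apply/funext => n; rewrite /pseries /series/= mulr_sumr -!big_split/= big1// => k _.
  rewrite /d /pseries_diffs /besselc factS natrM exprS.
  have k0 : 0 < k%:R + nu + 1 by rewrite -addrA ltr_wpDl// -ltrBlDr sub0r.
  have -> : Gamma (k.+1%:R + nu + 1) = (k%:R + nu + 1) * Gamma (k%:R + nu + 1).
    by rewrite -(GammaS k0); congr Gamma; rewrite -natr1; ring.
  have := Gamma_besselc_gt0 nu1 k; move: (Gamma _) => g g0.
  have : k`!%:R != 0 :> R by rewrite pnatr_eq0 -lt0n fact_gt0.
  move: k`!%:R => w w0.
  have : k.+1%:R != 0 :> R by rewrite pnatr_eq0.
  rewrite -natr1; move: k0; move: k%:R => z z0 z1.
  by field; rewrite w0 z1 !gt_eqF.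
rewrite Z in S; apply/esym; exact: (cvg_unique _ (cvg_cst 0) S).
Qed.

(** The integrand may be unbounded at 0, where the power t^nu can have a negative exponent. The
    theorem is used on intervals from 1/(n+2), which is below 1 also for n = 0, and the
    integrability of [f] gives the limit. *)
Lemma FTC_oo01 (F f : R -> R) (L : R) :
  (forall x : R, 0 < x -> is_derive x 1 F (f x)) ->
  (forall x : R, 0 < x -> {for x, continuous f}) ->
  integ `]0, 1[ f -> F x @[x --> 0^'+] --> L ->
  \int[mu]_(x in `]0, 1[) f x = F 1 - L.
Proof.
move=> dF cf if_ FL.
pose e (n : nat) : R := n.+2%:R^-1.
have e0 n : 0 < e n by rewrite invr_gt0.
have e1 n : e n < 1 by rewrite invf_lt1// ltr1n.
have ce : e n @[n --> \oo] --> (0 : R).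
  have := @cvg_harmonic R; rewrite -cvg_shiftS; exact.
have mD : measurable (`]0, 1[%classic : set R) by exact: measurable_itv.
pose f_ n x := f x * \1_(`[e n, 1[%classic) x.
have mf := integrable_measurable if_.
have H1 : \forall n \near \oo, measurable_fun (`]0, 1[%classic : set R) (f_ n).
  by apply: nearW => n; apply: measurable_funM => //; apply: measurable_indic.
have H2 x : `]0, 1[%classic x -> f_ n x @[n --> \oo] --> f x.
  rewrite /= in_itv/= => /andP[x0 x1].
  have : (fun=> f x) n @[n --> \oo] --> f x by exact: cvg_cst.
  apply: cvg_trans; apply: near_eq_cvg; near=> n.
  rewrite /f_ indicE mem_set ?mulr1//= in_itv/= x1 andbT.
  by near: n; apply: (cvgr_le (0 : R)) => //; exact: ce.
have ign : integ `]0, 1[ (fun x => `|f x|) by exact: (integrable_norm (mu := mu)).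
have H4 : \forall n \near \oo, forall x, `]0, 1[%classic x -> `|f_ n x| <= `|f x|.
  apply: nearW => n x _; rewrite /f_ indicE; case: (x \in _); by rewrite ?mulr1 ?mulr0 ?normr0.
have [_ H] := Rintegral_dominated_cvg mD H1 H2 ign H4.
have E n : \int[mu]_(x in `]0, 1[) f_ n x = F 1 - F (e n).
  have -> : \int[mu]_(x in `]0, 1[) f_ n x = \int[mu]_(x in `[e n, 1[) f x.
    have U : `[e n, 1[%classic = `]0, 1[%classic `&` `[e n, 1[%classic :> set R.
      by rewrite setIidr//; apply: subset_itvr; rewrite bnd_simp.
    rewrite [in RHS]U Rintegral_mkcondr; apply: eq_Rint => v _.
    by rewrite patch_indic.
  have cfw : {within `[e n, 1], continuous f}.
    apply: continuous_in_subspaceT => x; rewrite inE/= in_itv/= => /andP[h _].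
    by apply: cf; exact: lt_le_trans h.
  have iec : integ `[e n, 1] f.
    apply: continuous_compact_integrable => //; exact: segment_compact.
  rewrite Rintegral_itv_bndo_bndc; last first.
    by apply: integrableS iec => //; apply: subset_itvl; rewrite bnd_simp.
  rewrite /Rintegral (@continuous_FTC2 _ f F (e n) 1)//.
  - split.
    + move=> x; rewrite in_itv/= => /andP[h _].
      exact: is_derive_derivable (dF _ (lt_trans (e0 n) h)).
    + by apply: cvg_at_right_filter; exact: is_derive_continuous (dF _ (e0 n)).
    + by apply: cvg_at_left_filter; exact: is_derive_continuous (dF _ ltr01).
  - move=> x; rewrite in_itv/= => /andP[h _].
    exact: is_derive_derive1 (dF _ (lt_trans (e0 n) h)).
have H' : F 1 - F (e n) @[n --> \oo] --> F 1 - L.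
  apply: cvgB; first exact: cvg_cst.
  by move/cvg_at_rightP : FL; apply; split => //.
rewrite (_ : (fun n => _) = (fun n => F 1 - F (e n))) in H; last exact/funext.
exact: (cvg_unique _ H H').
Unshelve. all: by end_near. Qed.

Lemma measurable_besselG_prod (x y : R) :
  measurable_fun setT (fun t => t `^ nu * (G (x * t) * G (y * t))).
Proof.
apply: measurable_funM; first exact: measurable_powR.
by apply: measurable_funM; apply: (measurableT_comp (measurable_besselG nu1)); exact: measurable_funM.
Qed.

Lemma integrable_besselG_prod (x y : R) : 0 < x -> 0 < y ->
  integ `]0, 1[ (fun t => t `^ nu * (G (x * t) * G (y * t))).
Proof.
move=> x0 y0; have [A h] := expbd_besselc nu1 (@ltr01 R); have A0 := expbd_ge0 h.
apply: (@integrable_dom _ _ _ (fun t => A * expR x * (A * expR y) * t `^ nu)) => //.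
- by apply: measurable_funTS; exact: measurable_besselG_prod.
- by apply: integrableZ => //; exact: integrable_powR01.
move=> t; rewrite /= in_itv/= => /andP[t0 t1].
rewrite normrM (ger0_norm (powR_ge0 _ _)) mulrC ler_wpM2r ?powR_ge0// normrM.
have bd z : 0 < z -> `|G (z * t)| <= A * expR z.
  move=> z0; apply: le_trans (psum_le ler01 h _) _.
  rewrite mul1r gtr0_norm ?mulr_gt0// ler_wpM2l// ler_expR.
  by rewrite ler_piMr// ltW.
by apply: ler_pM => //; exact: bd.
Qed.

(* The Wronskian-type antiderivative behind the Christoffel-Darboux formula. *)
Lemma integral_besselG_prod (x y : R) : 0 < x -> 0 < y -> x != y ->
  \int[mu]_(t in `]0, 1[) (t `^ nu * (G (x * t) * G (y * t))) =
  (G x * (y * besselG1 y) - G y * (x * besselG1 x)) / (x - y).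
Proof.
move=> x0 y0 xy; have xy0 : x - y != 0 by rewrite subr_eq0.
pose V t := G (x * t) * (y * besselG1 (y * t)) - G (y * t) * (x * besselG1 (x * t)).
pose F t := (x - y)^-1 * (t `^ (nu + 1) * V t).
have dG (z t : R) : is_derive t 1 (fun t : R => G (z * t)) (z * besselG1 (z * t)).
  have := @is_derive_comp_affine R G z 0 t (besselG1 (z * t)).
  rewrite addr0 => /(_ (is_derive_besselG _)) hd.
  by rewrite (_ : (fun t => _) = (fun t => G (z * t + 0)))//; apply/funext => w; rewrite addr0.
have dG1 (z t : R) : is_derive t 1 (fun t : R => besselG1 (z * t)) (z * besselG2 (z * t)).
  have := @is_derive_comp_affine R besselG1 z 0 t (besselG2 (z * t)).
  rewrite addr0 => /(_ (is_derive_besselG1 _)) hd.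
  by rewrite (_ : (fun t => _) = (fun t => besselG1 (z * t + 0)))//; apply/funext => w; rewrite addr0.
have dV (t : R) : is_derive t 1 V (G (x * t) * (y * (y * besselG2 (y * t))) - G (y * t) * (x * (x * besselG2 (x * t)))).
  have ha := is_deriveM (dG x t) (is_deriveZ y (dG1 y t)).
  have hb := is_deriveM (dG y t) (is_deriveZ x (dG1 x t)).
  apply: is_derive_eq (is_deriveB ha hb) _.
  change (G (x * t) * (y * (y * besselG2 (y * t))) + (y * besselG1 (y * t)) * (x * besselG1 (x * t)) -
    (G (y * t) * (x * (x * besselG2 (x * t))) + (x * besselG1 (x * t)) * (y * besselG1 (y * t))) =
    G (x * t) * (y * (y * besselG2 (y * t))) - G (y * t) * (x * (x * besselG2 (x * t)))).
  by ring.
have dF (t : R) : 0 < t -> is_derive t 1 F (t `^ nu * (G (x * t) * G (y * t))).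
  move=> t0; have hp := is_derive1_powR (nu + 1) t0.
  apply: is_derive_eq (is_deriveZ (x - y)^-1 (is_deriveM hp (dV t))) _.
  have ox := besselG_ode (x * t); have oy := besselG_ode (y * t).
  rewrite addrK.
  change ((x - y)^-1 * (t `^ (nu + 1) * (G (x * t) * (y * (y * besselG2 (y * t))) - G (y * t) * (x * (x * besselG2 (x * t))))
    + V t * ((nu + 1) * t `^ nu)) = t `^ nu * (G (x * t) * G (y * t))).
  rewrite (gt0_powRD nu 1 t0) powRr1 ?(ltW t0)// /V.
  (* Bessel's equation eliminates the second derivatives; the first derivatives it introduces cancel
     with the derivative of t^(nu+1), which is why this power multiplies the Wronskian. *)
  have ox' : x * t * besselG2 (x * t) = - ((nu + 1) * besselG1 (x * t)) - G (x * t) by lra.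
  have oy' : y * t * besselG2 (y * t) = - ((nu + 1) * besselG1 (y * t)) - G (y * t) by lra.
  have -> : t `^ nu * t * (G (x * t) * (y * (y * besselG2 (y * t))) - G (y * t) * (x * (x * besselG2 (x * t)))) =
    t `^ nu * (G (x * t) * (y * (y * t * besselG2 (y * t))) - G (y * t) * (x * (x * t * besselG2 (x * t)))) by ring.
  by rewrite ox' oy'; field.
rewrite (@FTC_oo01 F _ 0)//.
- by rewrite /F powR1 mul1r /V !mulr1 subr0 mulrC.
- move=> t t0; have hp := is_derive1_powR nu t0.
  exact: is_derive_continuous (is_deriveM hp (is_deriveM (dG x t) (dG y t))).
- exact: integrable_besselG_prod.
have : F t @[t --> 0^'+] --> (x - y)^-1 * (0 * V 0); last by rewrite mul0r mulr0.
apply: cvgMl_tmp; apply: cvgM.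
  by apply: powR_cvg0; rewrite -ltrBlDr sub0r.
by apply: cvg_at_right_filter; exact: is_derive_continuous (dV 0).
Qed.

Lemma JprodE (s x t y theta : R) : 0 < x -> 0 < y -> 0 < theta ->
  Jprod nu s x t y theta = x `^ (nu / 2) * y `^ (nu / 2) *
    (theta `^ nu * (G (x * theta) * G (y * theta)) * expR (2 * (s - t) * theta)).
Proof.
move=> x0 y0 t0; rewrite /Jprod !besselJ_sqrt ?mulr_gt0//.
rewrite !powRM ?(ltW t0) ?(ltW x0) ?(ltW y0)//.
have -> : theta `^ nu = theta `^ (nu / 2) * theta `^ (nu / 2).
  by rewrite -gt0_powRD// -splitr.
by rewrite [theta * x]mulrC [theta * y]mulrC; ring.
Qed.

Lemma integral_Jprod_eq_time (s x y : R) : 0 < x -> 0 < y ->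
  \int[mu]_(theta in `]0, 1[) Jprod nu s x s y theta =
  x `^ (nu / 2) * y `^ (nu / 2) *
    \int[mu]_(theta in `]0, 1[) (theta `^ nu * (G (x * theta) * G (y * theta))).
Proof.
move=> x0 y0; rewrite -RintegralZl//; last exact: integrable_besselG_prod.
apply: eq_Rint => theta; rewrite /= in_itv/= => /andP[t0 _].
by rewrite JprodE// subrr mulr0 mul0r expR0 mulr1.
Qed.

Lemma derive1_besselJ_sqrt (y : R) : 0 < y ->
  Num.sqrt y * derive1 (besselJ nu) (2 * Num.sqrt y) =
  y `^ (nu / 2) * (nu * G y + 2 * (y * besselG1 y)) / 2.
Proof.
move=> y0; pose q := Num.sqrt y; have q0 : 0 < q by rewrite sqrtr_gt0.
have qq : q ^+ 2 = y by rewrite sqr_sqrtr// ltW.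
have z0 : 0 < 2 * q by rewrite mulr_gt0.
pose H (w : R) := w `^ nu * G (w ^+ 2).
have dH : is_derive q 1 H (nu * q `^ (nu - 1) * G (q ^+ 2) + q `^ nu * (2 * q * besselG1 (q ^+ 2))).
  have h1 := is_derive1_powR nu q0.
  have h2 : is_derive q 1 (fun w : R => w ^+ 2) (2 * q).
    have hi := is_derive_id q (1 : R).
    apply: is_derive_eq (is_deriveM hi hi) _.
    change (q * 1 + q * 1 = 2 * q); by ring.
  have h3 := @is_derive1_comp R G (fun w => w ^+ 2) q _ _ (is_derive_besselG _) h2.
  apply: is_derive_eq (is_deriveM h1 h3) _.
  change (q `^ nu * (besselG1 (q ^+ 2) * (2 * q)) + G (q ^+ 2) * (nu * q `^ (nu - 1)) =
    nu * q `^ (nu - 1) * G (q ^+ 2) + q `^ nu * (2 * q * besselG1 (q ^+ 2))).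
  by ring.
have E2 : 2^-1 * (2 * q) + 0 = q by rewrite addr0 mulKf.
have dJ := @is_derive_comp_affine R H 2^-1 0 (2 * q) _ (ltac:(by rewrite E2; exact: dH)).
have -> : derive1 (besselJ nu) (2 * q) = 2^-1 * (nu * q `^ (nu - 1) * G (q ^+ 2) + q `^ nu * (2 * q * besselG1 (q ^+ 2))).
  rewrite -(is_derive_derive1 dJ) !derive1E; apply: near_eq_derive => //; near=> z.
  have zp : 0 < z by near: z; exact: lt_nbhsr.
  by rewrite besselJE// /H addr0 [2^-1 * z]mulrC.
have -> : y `^ (nu / 2) = q `^ nu.
  rewrite -qq -powR_mulrn ?(ltW q0)// -powRrM; congr (_ `^ _).
  by field.
have -> : q `^ (nu - 1) = q `^ nu / q.
  by rewrite (gt0_powRD nu (-1) q0) powR_inv1// ltW.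
rewrite -/q qq; have -> : 2 * (y * besselG1 y) = 2 * (q ^+ 2 * besselG1 y) by rewrite qq.
by field; rewrite gt_eqF.
Unshelve. all: by end_near. Qed.

(** In the antisymmetric numerator the terms nu G(x) G(y) cancel, and the Wronskian of G remains. *)
Lemma bessel_kernelE (s x y : R) : 0 < x -> 0 < y -> x != y ->
  bessel_kernel nu x y = \int[mu]_(theta in `]0, 1[) Jprod nu s x s y theta.
Proof.
move=> x0 y0 xy; have xy0 : x - y != 0 by rewrite subr_eq0.
rewrite integral_Jprod_eq_time// integral_besselG_prod// /bessel_kernel -!mulrA !derive1_besselJ_sqrt// !besselJ_sqrt//.
by field.
Qed.

(** Off the diagonal the kernel is the integral [Phi], which is continuous at x: the integral in it
    is differentiated under the integral sign for z between 0 and 2x. *)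
Lemma Shom_diag (s x : R) : 0 < x ->
  bessel_kernel nu x z @[z --> x^'] --> \int[mu]_(theta in `]0, 1[) Jprod nu s x s x theta.
Proof.
move=> x0.
pose Phi z := x `^ (nu / 2) * z `^ (nu / 2) *
  \int[mu]_(theta in `]0, 1[) (theta `^ nu * (G (x * theta) * G (z * theta))).
have EPhi z : 0 < z -> \int[mu]_(theta in `]0, 1[) Jprod nu s x s z theta = Phi z.
  exact: integral_Jprod_eq_time.
rewrite EPhi//.
have [A h] := expbd_besselc nu1 (@ltr01 R); have A0 := expbd_ge0 h; have h1 := expbd_diffs h.
rewrite mulr1 in h1.
have cPhi : {for x, continuous Phi}.
  have D := @is_derive_under_integral R `]0, 1[
    (fun z theta => theta `^ nu * (G (x * theta) * G (z * theta)))
    (fun z theta => theta `^ nu * (G (x * theta) * (theta * besselG1 (z * theta))))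
    x 0 (2 * x) (fun theta => A * expR x * (A * expR (2 * x)) * theta `^ nu).
  have dI := D _ _ _ _ _ _.
  apply: cvgM.
    apply: cvgMl_tmp; exact: (is_derive_continuous (is_derive1_powR (nu / 2) x0)).
  apply: is_derive_continuous; apply: dI.
  - exact: measurable_itv.
  - by rewrite x0/=; lra.
  - by move=> z /andP[z0 _]; exact: integrable_besselG_prod.
  - move=> z theta /andP[z0 _] _.
    have := @is_derive_comp_affine R G theta 0 z (besselG1 (z * theta)).
    rewrite addr0 [theta * z]mulrC => /(_ (is_derive_besselG _)) hd.
    have h2 := is_deriveZ (theta `^ nu * G (x * theta)) hd.
    rewrite (_ : (fun z0 => _) = (theta `^ nu * G (x * theta)) \*: (fun z => G (theta * z + 0))); last first.
      by apply/funext => w; rewrite /= addr0 [theta * w]mulrC mulrA.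
    by apply: is_derive_eq h2 _; rewrite /GRing.scale/= mulrA.
  - by apply: integrableZ => //; exact: integrable_powR01.
  - move=> z theta /andP[z0 z2]; rewrite /= in_itv/= => /andP[t0 t1].
    rewrite normrM (ger0_norm (powR_ge0 _ _)) mulrC ler_wpM2r ?powR_ge0// normrM.
    apply: ler_pM => //.
      apply: le_trans (psum_le ler01 h _) _.
      rewrite mul1r gtr0_norm ?mulr_gt0// ler_wpM2l// ler_expR.
      by rewrite ler_piMr// ltW.
    rewrite normrM (gtr0_norm t0) -[leRHS]mul1r; apply: ler_pM => //; try exact: ltW.
    apply: le_trans (psum_le ler01 h1 _) _.
    rewrite mul1r gtr0_norm ?mulr_gt0// ler_wpM2l// ler_expR.
    apply: (@le_trans _ _ z); last exact: ltW.
    by rewrite ler_piMr// ltW.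
have c1 : Phi z @[z --> x^'] --> Phi x.
  by apply: cvg_trans cPhi; apply: cvg_app; exact: cvg_within.
apply: cvg_trans c1; apply: near_eq_cvg; near=> z.
have z0 : 0 < z.
  near: z; apply: cvg_within; exact: lt_nbhsr.
have xz : x != z by rewrite eq_sym; near: z; exact: nbhs_dnbhs_neq.
by rewrite -EPhi// (bessel_kernelE s).
Unshelve. all: by end_near. Qed.

Lemma Shom_eq_time (s x y : R) : 0 < x -> 0 < y ->
  Shom nu s x s y = \int[mu]_(theta in `]0, 1[) Jprod nu s x s y theta.
Proof.
move=> x0 y0; rewrite /Shom ltxx eqxx; have [->|xy] := eqVneq x y.
  by apply/cvg_lim => //; exact: Shom_diag.
exact: bessel_kernelE.
Qed.

Lemma integrable_Jprod (s x t y : R) : 0 < x -> 0 < y -> s < t ->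
  integ `]0, +oo[ (Jprod nu s x t y).
Proof.
move=> x0 y0 st; have xy : 0 < x + y by rewrite addr_gt0.
(* With this type for G the product G(x theta) G(y theta) grows at most like exp ((t - s) theta),
   half the rate at which exp (2 (s - t) theta) decays. *)
have e0 : 0 < (t - s) / (x + y) by rewrite divr_gt0// subr_gt0.
have [A h] := expbd_besselc nu1 e0; have A0 := expbd_ge0 h.
have nu10 : 0 < nu + 1 by rewrite -ltrBlDr sub0r.
have ts0 : 0 < t - s by rewrite subr_gt0.
have [iG _] := Gamma_scale nu10 ts0; rewrite addrK in iG.
have ik := integrableZ (x `^ (nu / 2) * y `^ (nu / 2) * A ^+ 2) (measurable_itv _) iG.
pose g theta := x `^ (nu / 2) * y `^ (nu / 2) *
    (theta `^ nu * (G (x * theta) * G (y * theta)) * expR (2 * (s - t) * theta)).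
apply: (@integrable_eq R `]0, +oo[%classic g) => //.
  by move=> theta; rewrite /= in_itv/= andbT => t0; rewrite JprodE.
apply: integrable_dom ik _ => //.
  apply: measurable_funTS; apply: measurable_funM => //; apply: measurable_funM; first exact: measurable_besselG_prod.
  by apply: measurableT_comp => //; exact: measurable_funM.
move=> theta; rewrite /= in_itv/= andbT => t0.
rewrite /g normrM ger0_norm ?mulr_ge0 ?powR_ge0// -[leRHS]mulrA ler_wpM2l ?mulr_ge0 ?powR_ge0//.
rewrite !normrM (ger0_norm (powR_ge0 _ _)) (ger0_norm (expR_ge0 _)).
have bd z : 0 < z -> `|G (z * theta)| <= A * expR ((t - s) / (x + y) * (z * theta)).
  move=> z0; apply: le_trans (psum_le (ltW e0) h _) _.
  by rewrite gtr0_norm ?mulr_gt0.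
have := ler_pM (normr_ge0 _) (normr_ge0 _) (bd _ x0) (bd _ y0) => hb.
apply: (@le_trans _ _ (theta `^ nu * (A * expR ((t - s) / (x + y) * (x * theta)) *
   (A * expR ((t - s) / (x + y) * (y * theta)))) * expR (2 * (s - t) * theta))).
  by rewrite ler_wpM2r ?expR_ge0// ler_wpM2l ?powR_ge0.
have -> : expR (- ((t - s) * theta)) = expR ((t - s) / (x + y) * (x * theta)) *
   expR ((t - s) / (x + y) * (y * theta)) * expR (2 * (s - t) * theta).
  by rewrite -!expRD; congr expR; field; rewrite gt_eqF.
by apply: eq_ler; ring.
Qed.

Lemma integral_Jprod_split (s x t y : R) : 0 < x -> 0 < y -> s < t ->
  \int[mu]_(theta in `]0, 1[) Jprod nu s x t y theta -
  \int[mu]_(theta in `]0, +oo[) Jprod nu s x t y theta =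
  - \int[mu]_(theta in `]1, +oo[) Jprod nu s x t y theta.
Proof.
move=> x0 y0 st; have iJ := integrable_Jprod x0 y0 st.
have i1 : integ `]0, 1[ (Jprod nu s x t y).
  by apply: integrableS iJ => //; apply: subset_itvl; rewrite bnd_simp.
have := @Rintegral_itvB R (Jprod nu s x t y) (BRight 0) +oo%O 1 iJ.
move=> /(_ _ _) <- //; last by rewrite bnd_simp.
by rewrite (Rintegral_itv_bndo_bndc i1) opprB.
Qed.

End HomogeneousKernel.

(** * Limits of the kernels along sequences of time shifts *)

Section KernelLimits.
Context {R : realType}.
Variables nu kappa : R.
Hypothesis nu1 : -1 < nu.
Hypothesis kappa0 : 0 <= kappa.
Hypothesis kappa_lt : kappa < 2 * (nu + 1).
Local Notation b := (nu - kappa).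
Local Notation G := (besselG nu).

Lemma cvg_neg2 (u : nat -> R) : u i @[i --> \oo] --> -oo ->
  - (2 * u i) @[i --> \oo] --> +oo.
Proof.
move=> /cvgrNyPle h; apply/cvgryPge => A; near=> i.
suff : u i <= - (A / 2) by lra.
by near: i; exact: h.
Unshelve. all: by end_near. Qed.

Lemma Jprod_shift (T s x t y : R) : Jprod nu (s + T) x (t + T) y = Jprod nu s x t y.
Proof. by apply/funext => theta; rewrite /Jprod (_ : s + T - (t + T) = s - t)//; ring. Qed.

Lemma Shom_shift (T s x t y : R) : Shom nu (s + T) x (t + T) y = Shom nu s x t y.
Proof. by rewrite /Shom Jprod_shift ltrD2r (inj_eq (addIr T)). Qed.

Lemma integrable_Jprod01 (x y c : R) : 0 < x -> 0 < y ->
  integ `]0, 1[ (fun theta => theta `^ nu * (G (x * theta) * G (y * theta)) * expR (c * theta)).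
Proof.
move=> x0 y0.
have ib : integ `]0, 1[ (fun t => `|t `^ nu * (G (x * t) * G (y * t))|).
  by apply: (integrable_norm (mu := mu)); exact: integrable_besselG_prod.
have ik := integrableZ (expR `|c|) (measurable_itv _) ib.
apply: integrable_dom ik _ => //.
  apply: measurable_funTS; apply: measurable_funM; first exact: measurable_besselG_prod.
  by apply: measurableT_comp => //; exact: measurable_funM.
move=> theta; rewrite /= in_itv/= => /andP[t0 t1].
rewrite normrM mulrC ler_wpM2r// ger0_norm ?expR_ge0// ler_expR.
apply: (le_trans (ler_norm _)); rewrite normrM (gtr0_norm t0).
by rewrite ler_piMr// ltW.
Qed.

(** The factors in x and y agree because x^(kappa/2) y^(nu - kappa/2) = (y/x)^(b/2) (x y)^(nu/2). *)
Lemma Sker0_limitE (s t x y : R) : 0 < x -> 0 < y ->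
  (x / y) `^ (kappa / 2) * \int[mu]_(theta in `]0,1[)
    ((theta * y) `^ nu * expR ((- (2 * t) - - (2 * s)) * theta) * (G (x * theta) * G (y * theta))) =
  (y / x) `^ (b / 2) * \int[mu]_(theta in `]0, 1[) Jprod nu s x t y theta.
Proof.
move=> x0 y0.
have i0 := integrable_Jprod01 (2 * (s - t)) x0 y0.
rewrite [in RHS](eq_Rint (g := fun theta => x `^ (nu / 2) * y `^ (nu / 2) *
   (theta `^ nu * (G (x * theta) * G (y * theta)) * expR (2 * (s - t) * theta)))); last first.
  by move=> theta; rewrite /= in_itv/= => /andP[t0 _]; rewrite JprodE.
rewrite [in LHS](eq_Rint (g := fun theta => y `^ nu *
   (theta `^ nu * (G (x * theta) * G (y * theta)) * expR (2 * (s - t) * theta)))); last first.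
  move=> theta; rewrite /= in_itv/= => /andP[t0 _].
  rewrite powRM ?(ltW t0) ?(ltW y0)// (_ : - (2 * t) - - (2 * s) = 2 * (s - t)); last by ring.
  by ring.
rewrite !RintegralZl// !mulrA; congr (_ * _).
rewrite /powR !gt_eqF ?divr_gt0// !ln_div ?posrE// -!expRD; congr expR.
by field.
Qed.

Lemma Sker_cvg (s t x y : R) (u : nat -> R) : 0 < x -> 0 < y ->
  u i @[i --> \oo] --> -oo ->
  Sker nu kappa (s + u i) x (t + u i) y @[i --> \oo] -->
  (y / x) `^ (b / 2) * Shom nu s x t y.
Proof.
move=> x0 y0 hu.
have hl : - (2 * u i) @[i --> \oo] --> +oo.
  exact: cvg_neg2.
have := @Sker0_cvg R nu kappa nu1 kappa_lt x y (- (2 * s)) (- (2 * t))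
  (fun i => - (2 * u i)) (fun i => s + u i) (fun i => t + u i) x0 y0 hl.
rewrite Sker0_limitE// => H.
have {}H := H (ltac:(by move=> i; ring)) (ltac:(by move=> i; ring)).
(* The indicator term depends on the time difference only, so it is constant along the sequence. *)
pose c := (s < t)%R%:R * (y / x) `^ (b / 2) * \int[mu]_(theta in `]0, +oo[) Jprod nu s x t y theta.
rewrite (_ : (fun i => _) = (fun i => Sker0 nu kappa (s + u i) x (t + u i) y - c)); last first.
  by apply/funext => i; rewrite /Sker Jprod_shift ltrD2r.
rewrite (_ : _ * Shom _ _ _ _ _ = (y / x) `^ (b / 2) *
   \int[mu]_(theta in `]0, 1[) Jprod nu s x t y theta - c).
  by apply: cvgB => //; exact: cvg_cst.
rewrite /c; have [st|ts|<-] := ltgtP s t.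
- by rewrite mul1r -mulrBr integral_Jprod_split// /Shom ltNge (ltW st)/= lt_eqF.
- by rewrite !mul0r subr0 /Shom ts.
- by rewrite !mul0r subr0 Shom_eq_time.
Qed.

Lemma DIker_cvg0 (s t x y : R) (u : nat -> R) : 0 < x -> 0 < y ->
  u i @[i --> \oo] --> -oo ->
  let l i := - (2 * u i) in
  (l i) `^ (2 * b + 1) * expR (- (2 * l i)) *
    Dker nu kappa (s + u i) x (t + u i) y @[i --> \oo] --> (0 : R) /\
  ((l i) `^ (2 * b + 1) * expR (- (2 * l i)))^-1 *
    Iker nu kappa (s + u i) x (t + u i) y @[i --> \oo] --> (0 : R).
Proof.
move=> x0 y0 hu l.
have hl : l i @[i --> \oo] --> +oo.
  exact: cvg_neg2.
split.
  apply: (@Dker_cvg0 R nu kappa nu1 kappa0 kappa_lt x y (- (2 * s)) (- (2 * t)) l) => //.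
    by move=> i; rewrite /l; ring.
  by move=> i; rewrite /l; ring.
have := @Iker_cvg0 R nu kappa nu1 kappa_lt x y (- (2 * s)) (- (2 * t)) l
  (fun i => s + u i) (fun i => t + u i) x0 y0 hl
  (ltac:(by move=> i; rewrite /l; ring)) (ltac:(by move=> i; rewrite /l; ring)).
rewrite (_ : (fun i => _) = (fun i => ((l i) `^ (2 * b + 1) * expR (- (2 * l i)))^-1 *
    Iker nu kappa (s + u i) x (t + u i) y))//.
by apply/funext => i; rewrite invfM powRN expRN invrK.
Qed.

End KernelLimits.

(** * Permutation sums, Pfaffians and determinants *)

Section PermutationSums.
Context {R : comNzRingType} {h : nat}.
Implicit Types (U X : 'M[R]_(h + h)).

(* Every factor doubles the sum: exchanging the values of the permutation at
   the two positions of the k-th pair changes its sign. *)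
Lemma sum_perm_antisym U :
  \sum_(s : 'S_(h + h)) (-1) ^+ s * \prod_(k < h)
    (U (s (lshift h k)) (s (rshift h k)) - U (s (rshift h k)) (s (lshift h k))) =
  2 ^+ h * \sum_(s : 'S_(h + h)) (-1) ^+ s *
    \prod_(k < h) U (s (lshift h k)) (s (rshift h k)).
Proof.
pose a (s : 'S_(h + h)) k := U (s (lshift h k)) (s (rshift h k)).
pose b (s : 'S_(h + h)) k := U (s (rshift h k)) (s (lshift h k)).
suff Q m : (m <= h)%N -> \sum_(s : 'S_(h + h)) (-1) ^+ s *
    \prod_(k < h) (if (k < m)%N then a s k - b s k else a s k) =
    2 ^+ m * \sum_(s : 'S_(h + h)) (-1) ^+ s * \prod_(k < h) a s k.
  rewrite -[RHS](Q h (leqnn h)); apply: eq_bigr => s _; congr (_ * _).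
  by apply: eq_bigr => k _; rewrite ltn_ord.
elim: m => [_|m IH mh]; first by rewrite expr0 mul1r.
pose i : 'I_h := Ordinal mh.
rewrite exprS -mulrA -IH 1?ltnW//.
pose rest s := \prod_(k < h | k != i) (if (k < m)%N then a s k - b s k else a s k).
have sw : \sum_(s : 'S_(h + h)) (-1) ^+ s * (b s i * rest s) =
    - \sum_(s : 'S_(h + h)) (-1) ^+ s * (a s i * rest s).
  rewrite (reindex_inj (mulgI (tperm (lshift h i) (rshift h i)))) -sumrN.
  apply: eq_bigr => s _; rewrite odd_permM odd_tperm eq_lrshift/= -mulNr.
  congr (_ * (_ * _)).
  - by rewrite signrN.
  - by rewrite /a /b !permM tpermL tpermR.
  apply: eq_bigr => k ki; rewrite /a /b !permM.
  by rewrite !tpermD// ?eq_lshift ?eq_rshift ?eq_lrshift ?eq_rlshift// eq_sym.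
transitivity (\sum_(s : 'S_(h + h)) (-1) ^+ s * (a s i * rest s) -
    \sum_(s : 'S_(h + h)) (-1) ^+ s * (b s i * rest s)).
  rewrite -sumrB; apply: eq_bigr => s _; rewrite (bigD1 i)//= ltnSn -mulrBr -mulrBl.
  congr (_ * (_ * _)); apply: eq_bigr => k ki.
  rewrite ltnS leq_eqVlt (_ : (k == m :> nat) = false)//.
  by apply: contra_neqF ki => /eqP km; apply/val_inj.
rewrite sw opprK -mulr2n mulr_natl; congr (_ *+ _).
apply: eq_bigr => s _; rewrite [in RHS](bigD1 i)//= ltnn//.
Qed.

Lemma sum_perm_block_det (X : 'M[R]_h) :
  \sum_(s : 'S_(h + h)) (-1) ^+ s * \prod_(k < h)
    block_mx 0 X 0 0 (s (lshift h k)) (s (rshift h k)) = h`!%:R * \det X.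
Proof.
pose P := block_mx X 0 0 1%:M : 'M[R]_(h + h).
have UE p q : block_mx 0 X 0 0 p q = \sum_(g < h) P p (lshift h g) * P q (rshift h g).
  case: (split_ordP p) => i ->; case: (split_ordP q) => j ->; rewrite /P.
  - rewrite block_mxEul mxE big1// => g _.
    by rewrite (block_mxEur _ _ _ _ j g) [X in _ * X]mxE mulr0.
  - rewrite block_mxEur (bigD1 j)//= block_mxEul block_mxEdr [1%:M _ _]mxE eqxx mulr1.
    rewrite big1 ?addr0// => g gj.
    by rewrite (block_mxEdr _ _ _ _ j g) [1%:M _ _]mxE eq_sym (negbTE gj) mulr0.
  - rewrite block_mxEdl mxE big1// => g _.
    by rewrite (block_mxEdl _ _ _ _ i g) [X in X * _]mxE mul0r.
  - rewrite block_mxEdr mxE big1// => g _.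
    by rewrite (block_mxEdl _ _ _ _ i g) [X in X * _]mxE mul0r.
transitivity (\sum_(g : {ffun 'I_h -> 'I_h}) \det (colsub g X) * \det (colsub g 1%:M)).
  under eq_bigr => s _.
    under eq_bigr => k _ do rewrite UE.
    rewrite bigA_distr_bigA/= mulr_sumr; over.
  rewrite exchange_big; apply: eq_bigr => g _ /=.
  rewrite -(det_ublock (colsub g X) 0) -det_tr /determinant; apply: eq_bigr => s _.
  congr (_ * _); rewrite big_split [in RHS]big_split_ord/=.
  congr (_ * _); apply: eq_bigr => k _; rewrite [in RHS]mxE /P.
    case: (split_ordP (s (lshift h k))) => j ->.
      by rewrite !block_mxEul [in RHS]mxE.
    by rewrite !block_mxEdl !mxE.
  case: (split_ordP (s (rshift h k))) => j ->.
    by rewrite !block_mxEur !mxE.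
  by rewrite !block_mxEdr [in RHS]mxE.
transitivity (\sum_(g : {ffun 'I_h -> 'I_h}) \sum_(s : 'S_h)
    (if g == finfun s then (-1) ^+ s * \det (colsub g X) else 0)).
  apply: eq_bigr => g _; rewrite -[\det (colsub g 1%:M)]det_tr mulr_sumr; apply: eq_bigr => s _.
  case: eqP => [->|gs].
    rewrite big1 ?mulr1 1?mulrC// => k _; by rewrite !mxE ffunE eqxx.
  have [k gk] : exists k, g k != s k.
    apply/existsP; apply: contra_notT gs => /existsPn h1.
    by apply/ffunP => k; rewrite ffunE; have := h1 k; rewrite negbK => /eqP.
  by rewrite (bigD1 k)//= !mxE eq_sym (negbTE gk) mul0r !mulr0.
rewrite exchange_big/= (eq_bigr (fun=> \det X)) ?sumr_const ?card_Sn ?mulr_natl//.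
move=> s _; rewrite -big_mkcond big_pred1_eq.
rewrite (_ : colsub _ X = X *m perm_mx s^-1).
  by rewrite det_mulmx det_perm odd_permV mulrCA -expr2 sqrr_sign mulr1.
by rewrite -col_permE; apply/matrixP => i j; rewrite !mxE ffunE.
Qed.

End PermutationSums.

(** [phi] puts the first half on the even positions and the second half on the odd ones, hence is a
    bijection. Conjugating the permutations by it preserves their signs and turns the consecutive
    pairs into pairs (lshift k, rshift k), so that block matrices can be used. *)
Lemma PfE (R : fieldType) (h n : nat) (A : 'M[R]_n) (phi : 'I_(h + h) -> 'I_n) :
  n = (h + h)%N ->
  (forall k, phi (lshift h k) = k.*2 :> nat) ->
  (forall k, phi (rshift h k) = k.*2.+1 :> nat) ->
  Pf A = (2 ^+ h * h`!%:R)^-1 * \sum_(s : 'S_(h + h)) (-1) ^+ s *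
    \prod_(k < h) A (phi (s (lshift h k))) (phi (s (rshift h k))).
Proof.
move=> nE; subst n => phil phir.
have phi_inj : injective phi.
  move=> p q /(congr1 (@nat_of_ord _)).
  case: (split_ordP p) => i ->; case: (split_ordP q) => j ->; rewrite ?phil ?phir.
  - by move=> /double_inj/val_inj ->.
  - by move=> /(congr1 odd); rewrite /= !odd_double.
  - by move=> /(congr1 odd); rewrite /= !odd_double.
  - by move=> /succn_inj/double_inj/val_inj ->.
pose f := perm phi_inj; have fE p : phi p = f p by rewrite permE.
have oh : odd (h + h) = false by rewrite addnn odd_double.
have hh : (h + h)./2 = h by rewrite addnn doubleK.
rewrite /Pf oh hh; congr (_ * _).
rewrite (reindex_inj (conjg_inj f)); apply: eq_bigr => s _; rewrite odd_permJ.
congr (_ * _); rewrite (reindex_perm f) big_split_ord/= [X in _ * X]big_pred0 ?mulr1; last first.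
  by move=> k; rewrite -fE phir/= odd_double.
apply: eq_big => k; first by rewrite -fE phil odd_double.
move=> _; have -> : ordS (f (lshift h k)) = f (rshift h k).
  apply/val_inj; rewrite /= -!fE phil phir modn_small// addnn -doubleS.
  by rewrite leq_double.
by rewrite !permJ !fE.
Qed.

(* Multiplying the rows and the columns phi (lshift k) by q and the rows and the
   columns phi (rshift k) by 1/q does not change the Pfaffian; with q^2 = g, this
   makes both diagonal entries of the 2x2 blocks vanish in the limit. *)
Lemma Pf_cvg_det (R : realType) (h n : nat) (A : nat -> 'M[R]_n)
    (phi : 'I_(h + h) -> 'I_n) (g : nat -> R) (X : 'M[R]_h) :
  n = (h + h)%N ->
  (forall k, phi (lshift h k) = k.*2 :> nat) ->
  (forall k, phi (rshift h k) = k.*2.+1 :> nat) ->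
  (\forall i \near \oo, 0 < g i) ->
  (forall j k, g i * A i (phi (lshift h j)) (phi (lshift h k)) @[i --> \oo] --> (0 : R)) ->
  (forall j k, (g i)^-1 * A i (phi (rshift h j)) (phi (rshift h k)) @[i --> \oo] --> (0 : R)) ->
  (forall j k, A i (phi (lshift h j)) (phi (rshift h k)) @[i --> \oo] --> X j k) ->
  (forall j k, A i (phi (rshift h j)) (phi (lshift h k)) @[i --> \oo] --> - X k j) ->
  Pf (A i) @[i --> \oo] --> \det X.
Proof.
move=> nE phil phir g0 Dc Ic Sc Sc'.
pose w i (p : 'I_(h + h)) : R := if fintype.split p is inl _ then Num.sqrt (g i) else (Num.sqrt (g i))^-1.
have wl i k : w i (lshift h k) = Num.sqrt (g i).
  by rewrite /w (unsplitK (inl k)).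
have wr i k : w i (rshift h k) = (Num.sqrt (g i))^-1.
  by rewrite /w (unsplitK (inr k)).
pose B i p q := w i p * w i q * A i (phi p) (phi q).
pose U : 'M[R]_(h + h) := block_mx 0 X 0 0.
(* The limit matrix is the antisymmetrization of [U], whose only nonzero block is X;
   [sum_perm_antisym] then exchanges it for [U]. *)
have Bc p q : B i p q @[i --> \oo] --> U p q - U q p.
  rewrite /B /U; case: (split_ordP p) => j ->; case: (split_ordP q) => k ->.
  - rewrite !block_mxEul !mxE subrr; have := Dc j k.
    apply: cvg_trans; apply: near_eq_cvg; near=> i.
    rewrite !wl -expr2 sqr_sqrtr// ltW//; by near: i.
  - rewrite block_mxEur block_mxEdl [X in _ - X]mxE subr0; have := Sc j k.
    apply: cvg_trans; apply: near_eq_cvg; near=> i.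
    rewrite wl wr divff ?mul1r// gt_eqF// sqrtr_gt0; by near: i.
  - rewrite block_mxEur block_mxEdl [X in X - _]mxE sub0r; have := Sc' j k.
    apply: cvg_trans; apply: near_eq_cvg; near=> i.
    rewrite wl wr mulVf ?mul1r// gt_eqF// sqrtr_gt0; by near: i.
  - rewrite !block_mxEdr !mxE subrr; have := Ic j k.
    apply: cvg_trans; apply: near_eq_cvg; near=> i.
    rewrite !wr -expr2 exprVn sqr_sqrtr// ltW//; by near: i.
have C0 : 2 ^+ h * h`!%:R != 0 :> R.
  by rewrite mulf_neq0 ?expf_neq0 ?pnatr_eq0// -lt0n fact_gt0.
have -> : \det X = (2 ^+ h * h`!%:R)^-1 * \sum_(s : 'S_(h + h)) (-1) ^+ s *
   \prod_(k < h) (U (s (lshift h k)) (s (rshift h k)) - U (s (rshift h k)) (s (lshift h k))).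
  by rewrite sum_perm_antisym sum_perm_block_det (mulrA (2 ^+ h)) mulKf.
have : (2 ^+ h * h`!%:R)^-1 * (\sum_(s : 'S_(h + h)) (-1) ^+ s *
    \prod_(k < h) B i (s (lshift h k)) (s (rshift h k))) @[i --> \oo] -->
    (2 ^+ h * h`!%:R)^-1 * \sum_(s : 'S_(h + h)) (-1) ^+ s *
   \prod_(k < h) (U (s (lshift h k)) (s (rshift h k)) - U (s (rshift h k)) (s (lshift h k))).
  apply: cvgMl_tmp; apply: (cvg_big (op := +%R)) => [|s _]; first exact: add_continuous.
  apply: cvgMl_tmp; apply: (@cvg_big R _ *%R) => [|k _]; first exact: mul_continuous.
  exact: Bc.
apply: cvg_trans; apply: near_eq_cvg; near=> i.
rewrite (PfE (A i) nE phil phir); congr (_ * _); apply: eq_bigr => s _; congr (_ * _).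
have q0 : Num.sqrt (g i) != 0 by rewrite gt_eqF// sqrtr_gt0; near: i.
(* For any s every index occurs exactly once as a row or as a column, so the weights multiply to
   1. *)
have W : \prod_(k < h) (w i (s (lshift h k)) * w i (s (rshift h k))) = 1.
  transitivity (\prod_p w i (s p)); first by rewrite big_split_ord big_split.
  transitivity (\prod_p w i p); first by rewrite [RHS](reindex_perm s).
  by rewrite big_split_ord/= -big_split big1// => k _; rewrite wl wr; exact: divff.
by rewrite /B big_split/= W mul1r.
Unshelve. all: by end_near. Qed.

Lemma det_conj_diag (R : fieldType) (h : nat) (c : 'I_h -> R) (X : 'M[R]_h) :
  (forall i, c i != 0) -> \det (\matrix_(i, j) (c j / c i * X i j)) = \det X.
Proof.
move=> c0; apply: eq_bigr => s _; congr (_ * _).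
under eq_bigr do rewrite mxE; rewrite big_split/= big_split/=.
have -> : \prod_i c (s i) = \prod_i c i by rewrite [RHS](reindex_perm s).
by rewrite -big_split big1 ?mul1r// => i _; exact: divff.
Qed.

Lemma mxblock_Rank (T : Type) (p q : nat) (p_ : 'I_p -> nat) (q_ : 'I_q -> nat)
    (B : forall i j, 'M[T]_(p_ i, q_ j)) i j (a : 'I_(p_ i)) (b : 'I_(q_ j)) :
  (\mxblock_(i, j) B i j) (tagnat.Rank i a) (tagnat.Rank j b) = B i j a b.
Proof. by have /matrixP/(_ a b) := mxblockK B i j; rewrite mxE. Qed.

(** * Indexing of the block matrices and convergence of the correlations *)

Section Correlations.
Context {R : realType}.
Variables (nu kappa : R) (M : nat) (N : 'I_M -> nat).
Hypothesis nu1 : -1 < nu.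
Hypothesis kappa0 : 0 <= kappa.
Hypothesis kappa_lt : kappa < 2 * (nu + 1).
Local Notation h := (\sum_m N m)%N.
Local Notation sig1 := (tagnat.sig1 (p_ := N)).
Local Notation sig2 := (tagnat.sig2 (p_ := N)).

Definition pairRank (k : 'I_h) (e : 'I_(1 + 1)) : 'I_(\sum_(m < M) \sum_(i < N m) (1 + 1)) :=
  tagnat.Rank (sig1 k) (tagnat.Rank (sig2 k) e).

(** Replacing entries by 2 x 2 blocks doubles the offset of every pair, so the k-th pair in
    lexicographic order occupies the rows 2k and 2k + 1. *)
Lemma pairRankE k e : pairRank k e = (k.*2 + e)%N :> nat.
Proof.
rewrite /pairRank !tagnat.RankEsum addnA; congr (_ + _)%N.
rewrite -(big_ord_widen (N (sig1 k)) (fun=> (1 + 1)%N)) ?(ltnW (ltn_ord _))//.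
rewrite sum_nat_const card_ord [in RHS](tagnat.rect k) doubleD -!muln2; congr (_ + _)%N.
by rewrite big_distrl/=; apply: eq_bigr => m _; rewrite sum_nat_const card_ord.
Qed.

Definition pairRank_half (p : 'I_(h + h)) :=
  match fintype.split p with
  | inl k => pairRank k (lshift 1 ord0)
  | inr k => pairRank k (rshift 1 ord0)
  end.

Lemma pairRank_halfl k : pairRank_half (lshift h k) = pairRank k (lshift 1 ord0).
Proof. by rewrite /pairRank_half (unsplitK (inl k)). Qed.

Lemma pairRank_halfr k : pairRank_half (rshift h k) = pairRank k (rshift 1 ord0).
Proof. by rewrite /pairRank_half (unsplitK (inr k)). Qed.

(** D and I have reciprocal normalizations, so these cancel in the product. *)
Lemma DIker_mul_cvg0 (s t x y : R) : 0 < x -> 0 < y ->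
  Dker nu kappa (s + T) x (t + T) y * Iker nu kappa (s + T) x (t + T) y
    @[T --> -oo] --> (0 : R).
Proof.
move=> x0 y0; apply/cvg_ninftyP => u hu.
have [hD hI] := DIker_cvg0 nu1 kappa0 kappa_lt s t x0 y0 hu.
have hl := cvg_neg2 hu.
rewrite -(mulr0 0); apply: cvg_trans (cvgM hD hI); apply: near_eq_cvg; near=> i.
have l0 : 0 < - (2 * u i) by near: i; exact: (cvgry_gt hl).
rewrite /= mulrACA mulfV ?mul1r// gt_eqF// mulr_gt0 ?powR_gt0 ?expR_gt0//.
Unshelve. all: by end_near. Qed.

Variables (s : 'I_M -> R) (y : forall m, 'I_(N m) -> R).
Hypothesis y_gt0 : forall m (i : 'I_(N m)), 0 < y i.

Lemma rhoY_cvg : rhoY nu kappa (fun m => s m + T) y @[T --> -oo] --> rhoY_hom nu s y.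
Proof.
apply/cvg_ninftyP => u hu; have hl := cvg_neg2 hu.
pose yk k := y (sig2 k); pose sk k := s (sig1 k); pose c k := yk k `^ ((nu - kappa) / 2).
have yk0 k : 0 < yk k by exact: y_gt0.
pose X : 'M[R]_h := \matrix_(i, j) (c j / c i * (\mxblock_(m < M, n < M) \matrix_(i < N m, j < N n)
          Shom nu (s m) (y i) (s n) (y j)) i j).
(* The upper right entry of a block holds the S-kernel with its arguments exchanged, so the limit of
   these entries is the transposed matrix. *)
have -> : rhoY_hom nu s y = \det X^T.
  by rewrite det_tr det_conj_diag// => k; rewrite gt_eqF// powR_gt0.
have XE j k : X k j = (yk j / yk k) `^ ((nu - kappa) / 2) * Shom nu (sk k) (yk k) (sk j) (yk j).
  rewrite !mxE; congr (_ * _).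
  rewrite powRM ?invr_ge0 ?ltW// -[(yk k)^-1]powR_inv1 ?ltW// -powRrM mulN1r powRN//.
apply: (@Pf_cvg_det R h _ _ pairRank_half
   (fun i => (- (2 * u i)) `^ (2 * (nu - kappa) + 1) * expR (- (2 * - (2 * u i))))).
- rewrite -big_split/=; apply: eq_bigr => m _.
  by rewrite sum_nat_const card_ord mulnDr muln1.
- by move=> k; rewrite pairRank_halfl pairRankE addn0.
- by move=> k; rewrite pairRank_halfr pairRankE; exact: addn1.
- near=> i.
  have l0 : 0 < - (2 * u i) by near: i; exact: (cvgry_gt hl).
  by rewrite mulr_gt0 ?powR_gt0 ?expR_gt0.
- move=> j k; rewrite !pairRank_halfl /pairRank.
  under eq_cvg do rewrite !mxblock_Rank /Ablock block_mxEul mxE eqxx mulr1n.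
  by have [] := DIker_cvg0 nu1 kappa0 kappa_lt (sk j) (sk k) (yk0 j) (yk0 k) hu.
- move=> j k; rewrite !pairRank_halfr /pairRank.
  under eq_cvg do rewrite !mxblock_Rank /Ablock block_mxEdr mxE eqxx mulr1n mulrN.
  have [_ /cvgN] := DIker_cvg0 nu1 kappa0 kappa_lt (sk j) (sk k) (yk0 j) (yk0 k) hu.
  by rewrite oppr0; exact.
- move=> j k; rewrite pairRank_halfl pairRank_halfr /pairRank.
  under eq_cvg do rewrite !mxblock_Rank /Ablock block_mxEur mxE eqxx mulr1n.
  by rewrite mxE XE; exact: Sker_cvg.
- move=> j k; rewrite pairRank_halfl pairRank_halfr /pairRank.
  under eq_cvg do rewrite !mxblock_Rank /Ablock block_mxEdl mxE eqxx mulr1n.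
  rewrite mxE XE; have /cvgN := Sker_cvg (s := sk j) (t := sk k) nu1 kappa_lt (yk0 j) (yk0 k) hu.
  exact.
Unshelve. all: by end_near. Qed.

Lemma rhoY_hom_shift (T : R) : rhoY_hom nu (fun m => s m + T) y = rhoY_hom nu s y.
Proof.
rewrite /rhoY_hom; congr (\det _); apply: eq_mxblock => m n.
by apply/matrixP => i j; rewrite !mxE Shom_shift.
Qed.

End Correlations.

(* s m + T with T --> -oo : every time tends to -oo, and all the differences
   s n - s m are fixed. *)
Theorem mainTheorem2 (R : realType) (nu kappa : R) (M : nat) (N : 'I_M -> nat)
    (s : 'I_M -> R)
    (nu_gt : -1 < nu) (kappa_ge0 : 0 <= kappa) (kappa_lt : kappa < 2 * (nu + 1))
    (M_ge1 : (1 <= M)%N) (N_gt0 : forall m, (0 < N m)%N)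
    (s_incr : forall m n : 'I_M, (m < n)%N -> s m < s n)
    (s_lt0 : forall m, s m < 0) :
  [/\ forall (m n : 'I_M) (x y : R), 0 < x -> 0 < y ->
        Dker nu kappa (s m + T) x (s n + T) y *
        Iker nu kappa (s m + T) x (s n + T) y @[T --> -oo] --> (0 : R),
      forall y : forall m, 'I_(N m) -> R, (forall m i, 0 < y m i) ->
        rhoY nu kappa (fun m => s m + T) y @[T --> -oo] --> rhoY_hom nu s y
    & forall (y : forall m, 'I_(N m) -> R) (T : R), (forall m i, 0 < y m i) ->
        rhoY_hom nu (fun m => s m + T) y = rhoY_hom nu s y].
Proof.
split=> [m n x y x0 y0|y y0|y T _].
- exact: DIker_mul_cvg0.
- exact: rhoY_cvg.
- exact: rhoY_hom_shift.
Qed.
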